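(* Let $\sigma>0$, let $f:\mathbb{R}^n\to\mathbb{R}$ be locally Lipschitz continuous, and let $g(x):=f(x)+\frac{\sigma}{2}\|x\|^2$. Assume: (A1) $f$ is path-differentiable and admits a convex-valued set-valued mapping $\mathcal{D}_f$ as its conservative field; (A2) the set $\{g(x):x\in\mathbb{R}^n,\ 0\in\mathcal{D}_f(x)+\sigma x\}$ has empty interior in $\mathbb{R}$; (A3) $\inf_{x\in\mathbb{R}^n}g(x)>-\infty$. Let $\{(x_k,m_k,v_k)\}$ be generated by the framework (AFMDW) described in the context, and assume: (C1) there exists a constant $M_x$ such that almost surely $\max\{\|m_0\|,\sup_{k\ge0}\|x_k\|\}\le M_x$; (C2) there exist a locally bounded mapping $W:\mathbb{R}^n\times\mathbb{R}^n\to\mathbb{R}^n_+$ and a fixed constant $\tau_2>0$ such that $v_{k+1}=v_k-\tau_2\eta_k\,(v_k-W(g_k,m_{k+1}))$ for all $k\ge0$; (C3) $H(v)=(\max\{v,0\}+\varepsilon)^{-1/2}$ (entrywise) for a fixed constant $\varepsilon>0$; (C4) the stepsizes $\{\eta_k\}$, $\{\theta_k\}$ are positive and satisfy $\sum_{k=0}^\infty\theta_k=\infty$, $\lim_{k\to\infty}\theta_k\log(k)=0$, $\lim_{k\to\infty}\frac{\theta_k}{\eta_k}=\tau_1$ for a fixed constant $\tau_1\in[\frac{\tau_2}{4},\infty)$, $\tau_1>0$; (C5) there exists a nonnegative sequence $\{\delta_k\}$ with $\lim_{k\to\infty}\delta_k=0$ and $d_k\in\mathcal{D}_f^{\delta_k}(x_k)$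 for all $k$; (C6) $\{\xi_k\}$ is a uniformly bounded martingale difference sequence. Let $y_k:=-\frac1\sigma m_k$ for $k\ge0$. Then almost surely, the interpolated process of the sequence $\{y_k\}$ (with stepsizes $\{\theta_k/\sigma\}$) is a perturbed solution of the differential inclusion $\frac{\mathrm{d}y}{\mathrm{d}t}\in-\mathcal{D}_g(y)$.
   Context: All random variables live on a probability space $(\Omega,\mathcal{F},\mathbb{P})$ with a filtration $\{\mathcal{F}_k\}$. $\odot$ is the entrywise product; $\mathbb{R}^n_+$ is the nonnegative orthant. A uniformly bounded martingale difference sequence $\{\xi_k\}$ is one adapted to $\{\mathcal{F}_k\}$ with $\mathbb{E}[\xi_{k+1}\mid\mathcal{F}_k]=0$ and, for some constant $M_\xi$, $\sup_k\|\xi_k\|\le M_\xi$ almost surely. Framework (AFMDW): from an initial point $(x_0,m_0,v_0)$, for $k\ge0$: $g_k=d_k+\xi_{k+1}$; $m_{k+1}=(1-\theta_k)m_k+\theta_k g_k$; choose an estimator $v_{k+1}\in\mathbb{R}^n$ (here by the rule in (C2)); $x_{k+1}=x_k-\eta_k H(v_{k+1})\odot(m_{k+1}+\sigma x_k)$. With $y_k=-m_k/\sigma$ the update of $m_k$ reads $y_{k+1}=y_k-\frac{\theta_k}{\sigma}(d_k+\sigma y_k+\xi_{k+1})$. A conservative field on $\mathbb{R}^n$ is a graph-closed set-valued mapping $\mathcal{D}:\mathbb{R}^n\rightrightarrows\mathbb{R}^n$ with nonempty compact values such that $\int_0^1\max_{v\in\mathcal{D}(\gamma(t))}\langle\gamma'(t),v\rangle\,dt=0$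 for every absolutely continuous $\gamma:[0,1]\to\mathbb{R}^n$ with $\gamma(0)=\gamma(1)$. A function $f$ admits $\mathcal{D}$ as its conservative field if $f(\gamma(1))=f(\gamma(0))+\int_0^1\max_{d\in\mathcal{D}(\gamma(t))}\langle\gamma'(t),d\rangle\,dt$ for every absolutely continuous $\gamma:[0,1]\to\mathbb{R}^n$. A locally Lipschitz function is path-differentiable if it admits some conservative field. For a set-valued mapping $\mathcal{D}$ and $\delta\ge0$, $\mathcal{D}^\delta(x):=\{w:\exists z\in\mathbb{B}_\delta(x),\ \mathrm{dist}(w,\mathcal{D}(z))\le\delta\}$, where $\mathbb{B}_\delta(x)$ is the ball of radius $\delta$ centred at $x$. $\mathcal{D}_g(x):=\mathcal{D}_f(x)+\sigma x$. Interpolated process: for a sequence $\{z_k\}$ with positive stepsizes $\{\alpha_k\}$, let $\lambda_0=0$, $\lambda_i=\sum_{k=0}^{i-1}\alpha_k$; the interpolated process is $w:\mathbb{R}_+\to\mathbb{R}^n$, $w(\lambda_i+s)=z_i+\frac{s}{\alpha_i}(z_{i+1}-z_i)$ for $s\in[0,\alpha_i)$. Perturbed solution: an absolutely continuous $\gamma:\mathbb{R}_+\to\mathbb{R}^n$ is a perturbed solution of $\frac{\mathrm{d}x}{\mathrm{d}t}\in\mathcal{D}(x)$ if there exist a locally integrable $u:\mathbb{R}_+\to\mathbb{R}^n$ with $\lim_{t\to\infty}\sup_{0\le l\le T}\left\|\int_t^{t+l}u(s)\,\mathrm{d}s\right\|=0$ for every $T>0$, and $\delta:\mathbb{R}_+\to\mathbb{R}$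 with $\lim_{t\to\infty}\delta(t)=0$ such that $\dot\gamma(t)-u(t)\in\mathcal{D}^{\delta(t)}(\gamma(t))$ for almost every $t$. *)

(* Defs.v *)
From HB Require Import structures.
From mathcomp Require Import all_boot all_order all_algebra.
From mathcomp Require Import all_classical all_reals all_analysis.

Set Implicit Arguments.
Unset Strict Implicit.
Unset Printing Implicit Defensive.

Import Order.TTheory GRing.Theory Num.Theory.
Import numFieldNormedType.Exports.

Local Open Scope classical_set_scope.
Local Open Scope ring_scope.

Section Euclidean.
Context {R : realType} {n : nat}.
Implicit Types u v w x z : 'rV[R]_n.

Definition dotp u v : R := \sum_(i < n) u 0 i * v 0 i.

(* The library norm on 'rV[R]_n is the sup norm; it induces the same topology,
   but the balls, distances and ||x||^2 below are Euclidean. *)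
Definition enorm u : R := Num.sqrt (dotp u u).

Definition hadamard u v : 'rV[R]_n := map2_mx *%R u v.

(* Equal to +oo when A is empty. *)
Definition set_dist w (A : set 'rV[R]_n) : \bar R :=
  ereal_inf [set (enorm (w - a))%:E | a in A].

(* D^delta, with closed balls so that delta = 0 is meaningful. *)
Definition expansion (D : 'rV[R]_n -> set 'rV[R]_n) (delta : R) x :
    set 'rV[R]_n :=
  [set w | exists2 z, enorm (z - x) <= delta &
                      (set_dist w (D z) <= delta%:E)%E].

Definition locally_lipschitz (f : 'rV[R]_n -> R) : Prop :=
  forall x, exists2 r, 0 < r & [lipschitz f z | z in ball x r].

Definition abs_continuous_on (a b : R) (gamma : R -> 'rV[R]_n) : Prop :=
  forall e, 0 < e -> exists2 d, 0 < d &
    forall (m : nat) (l r : 'I_m -> R),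
      (forall i, a <= l i /\ l i <= r i /\ r i <= b) ->
      trivIset [set: 'I_m] (fun i => `]l i, r i[%classic) ->
      \sum_(i < m) (r i - l i) < d ->
      \sum_(i < m) enorm (gamma (r i) - gamma (l i)) < e.

(* The support function is real-valued since D has nonempty compact values;
   the derivative of an absolutely continuous curve exists almost everywhere,
   and its values elsewhere do not affect the integral.  Keeping the integral
   in \bar R makes its finiteness part of the equations below. *)
Definition chain_integral (D : 'rV[R]_n -> set 'rV[R]_n) (gamma : R -> 'rV[R]_n)
    : \bar R :=
  (\int[@lebesgue_measure R]_(t in `[0%R, 1%R])
     (sup [set dotp (derive1 gamma t) v | v in D (gamma t)])%:E)%E.

Definition conservative_field (D : 'rV[R]_n -> set 'rV[R]_n) : Prop :=
  [/\ closed [set p : 'rV[R]_n * 'rV[R]_n | D p.1 p.2],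
      forall x, D x !=set0,
      forall x, compact (D x) &
      forall gamma, abs_continuous_on 0 1 gamma -> gamma 0 = gamma 1 ->
        chain_integral D gamma = 0%E].

Definition admits_conservative_field (f : 'rV[R]_n -> R)
    (D : 'rV[R]_n -> set 'rV[R]_n) : Prop :=
  conservative_field D /\
  forall gamma, abs_continuous_on 0 1 gamma ->
    (f (gamma 1))%:E = ((f (gamma 0))%:E + chain_integral D gamma)%E.

Definition path_differentiable (f : 'rV[R]_n -> R) : Prop :=
  locally_lipschitz f /\ exists D, admits_conservative_field f D.

Definition convex_valued (D : 'rV[R]_n -> set 'rV[R]_n) : Prop :=
  forall x, convex_set (D x : set (convex_lmodType 'rV[R]_n)).

Definition regularized (sigma : R) (f : 'rV[R]_n -> R) x : R :=
  f x + sigma / 2 * enorm x ^+ 2.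

Definition regularized_field (sigma : R) (D : 'rV[R]_n -> set 'rV[R]_n) x :
    set 'rV[R]_n :=
  [set w + sigma *: x | w in D x].

Definition opp_field (D : 'rV[R]_n -> set 'rV[R]_n) x : set 'rV[R]_n :=
  [set - w | w in D x].

Definition vintegral (u : R -> 'rV[R]_n) (a b : R) : 'rV[R]_n :=
  \row_i \int[@lebesgue_measure R]_(s in `[a, b]) u s 0 i.

(* Curves on [0, +oo) are total functions on R of which only the values at
   nonnegative times matter; absolute continuity and integrability on
   [0, +oo) are meant on every compact subinterval. *)
Definition perturbed_solution (D : 'rV[R]_n -> set 'rV[R]_n)
    (gamma : R -> 'rV[R]_n) : Prop :=
  (forall T, 0 < T -> abs_continuous_on 0 T gamma) /\
  exists (u : R -> 'rV[R]_n) (delta : R -> R),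
    [/\ forall T i, 0 < T -> (@lebesgue_measure R).-integrable `[0, T]
          (fun s => (u s 0 i)%:E),
        forall T, 0 < T ->
          ereal_sup [set (enorm (vintegral u t (t + l)))%:E | l in `[0, T]]
            @[t --> +oo] --> 0%E,
        delta t @[t --> +oo] --> 0 &
        {ae @lebesgue_measure R, forall t, 0 <= t ->
          derivable gamma t 1 /\
          expansion D (delta t) (gamma t) (derive1 gamma t - u t)}].

Definition itime (alpha : nat -> R) (i : nat) : R := \sum_(k < i) alpha k.

(* The index i of the cell [lambda_i, lambda_{i+1}) containing t; the default
   value 0 is only used when there is no such cell. *)
Definition iindex (alpha : nat -> R) (t : R) : nat :=
  xget 0%N [set i | itime alpha i <= t < itime alpha i.+1].

Definition interpolated_process (alpha : nat -> R) (z : nat -> 'rV[R]_n)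
    (t : R) : 'rV[R]_n :=
  let i := iindex alpha t in
  z i + ((t - itime alpha i) / alpha i) *: (z i.+1 - z i).

Lemma interpolated_processE (alpha : nat -> R) (z : nat -> 'rV[R]_n) (i : nat)
    (s : R) :
  (forall k, 0 < alpha k) -> 0 <= s < alpha i ->
  interpolated_process alpha z (itime alpha i + s) =
    z i + (s / alpha i) *: (z i.+1 - z i).
Proof.
move=> a_gt0 /andP[s_ge0 s_lt].
have itimeS k : itime alpha k.+1 = itime alpha k + alpha k.
  by rewrite /itime big_ord_recr.
have itime_le : {homo itime alpha : j k / (j <= k)%N >-> j <= k}.
  by apply: homo_leq => // [? ? ?|k]; [exact: le_trans|
     rewrite itimeS lerDl ltW].
rewrite /interpolated_process; suff -> : iindex alpha (itime alpha i + s) = i.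
  by rewrite addrAC subrr add0r.
rewrite /iindex; case: xgetP => [j _ /= /andP[le_j lt_j]|/(_ i) []]; last first.
  by rewrite /= lerDl s_ge0 itimeS ltrD2l.
apply/eqP; rewrite eqn_leq; apply/andP; split; rewrite leqNgt; apply/negP => ij.
  have := le_trans (itime_le _ _ ij) le_j.
  by rewrite itimeS lerD2l leNgt s_lt.
have := lt_le_trans lt_j (itime_le _ _ ij).
by rewrite gtrDl ltNge s_ge0.
Qed.

End Euclidean.

Section Stochastic.
Context {d : measure_display} {Omega : measurableType d} {R : realType}.
Implicit Types (P : probability Omega R) (F : nat -> set (set Omega)).

Definition filtration F : Prop :=
  [/\ forall k, sigma_algebra [set: Omega] (F k),
      forall k, F k `<=` measurable &
      forall j k, (j <= k)%N -> F j `<=` F k].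

Definition sub_measurable (G : set (set Omega)) (X : Omega -> R) : Prop :=
  forall B : set R, measurable B -> G (X @^-1` B).

(* Y is a version of E[X | G]. *)
Definition is_cond_expectation P (G : set (set Omega)) (X Y : Omega -> R) :
    Prop :=
  [/\ P.-integrable setT (EFin \o X), P.-integrable setT (EFin \o Y),
      sub_measurable G Y &
      forall A, G A ->
        (\int[P]_(w in A) (Y w)%:E = \int[P]_(w in A) (X w)%:E)%E].

Definition random_vector n (X : Omega -> 'rV[R]_n) : Prop :=
  forall i, measurable_fun setT (fun w => X w 0 i).

Definition bounded_martingale_difference P F n
    (xi : nat -> Omega -> 'rV[R]_n) : Prop :=
  [/\ forall k i, sub_measurable (F k) (fun w => xi k w 0 i),
      forall k i,
        is_cond_expectation P (F k) (fun w => xi k.+1 w 0 i) (fun=> 0) &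
      exists M, {ae P, forall w, forall k, enorm (xi k w) <= M}].

(* The choice of v_{k+1} is left open, as the framework does. *)
Definition AFMDW n (sigma : R) (eta theta : nat -> R)
    (H : 'rV[R]_n -> 'rV[R]_n) (x m v dk xi g : nat -> Omega -> 'rV[R]_n) :
    Prop :=
  forall k w,
    [/\ g k w = dk k w + xi k.+1 w,
        m k.+1 w = (1 - theta k) *: m k w + theta k *: g k w &
        x k.+1 w = x k w -
          eta k *: hadamard (H (v k.+1 w)) (m k.+1 w + sigma *: x k w)].

End Stochastic.

Definition preconditioner {R : realType} {n : nat} (eps : R) (v : 'rV[R]_n) :
    'rV[R]_n :=
  \row_i (Num.max (v 0 i) 0 + eps) `^ (- 2^-1).

(* Main.v *)
Require Import Defs.
From HB Require Import structures.
From mathcomp Require Import all_boot all_order all_algebra.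
From mathcomp Require Import all_classical all_reals all_analysis.
From mathcomp Require Import measurable_realfun.
From mathcomp Require Import ring lra.

Set Implicit Arguments.
Unset Strict Implicit.
Unset Printing Implicit Defensive.

Import Order.TTheory GRing.Theory Num.Theory.
Import numFieldNormedType.Exports.

Local Open Scope classical_set_scope.
Local Open Scope ring_scope.

(** Write [p = m + sigma x] and [y = - m / sigma]. The theorem reduces to the
    fact that [p] tends to [0] almost surely ([momentum_tracks_position]): [x]
    and [y] are then asymptotically equal, and the update of [m], read as
    [y' = y - theta / sigma (d + sigma y + xi)], is an Euler scheme for the
    inclusion in which [d] is taken at a point close to [y] and the noise is a
    perturbation. Interpolated Euler schemes of this kind are perturbed
    solutions ([interpolated_perturbed_solution]) as soon as the sums of the
    noise over windows of bounded duration vanish. They do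
    ([noise_windows_vanish]): the martingale differences being bounded, the
    tails of these sums are exponentially small, and the condition
    [theta k * ln k --> 0] makes them summable.

    For the convergence of [p], consider the Lyapunov function
    [L = g(x) + (2 tau1)^-1 * sum_i h_i p_i ^+ 2], where [h] is the
    preconditioner. The increments of [f] over a window are given by the work of
    the elements [d], because the trajectory is close to a curve of class C1 on
    which conservativity can be used ([window_chain_rule]); this rests on the
    local boundedness of the field, which follows from convexity of its values,
    the Lipschitz bound on [f] and Baire's theorem
    ([conservative_bounded_around]). The work then cancels against the change of
    the quadratic term in [p]. The weights [h] grow at relative rate at most [tau2 / 2]
    while the squares contract at rate [2 tau1], so [tau2 <= 4 tau1] leaves, up
    to vanishing errors, a decrease of [L] by the dissipated energy
    [sigma / tau1 * sum eta |q| ^+ 2] of the velocity [q], which is close to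
    [- h p] ([energy_step], [lyapunov_window]).

    A fast velocity therefore costs a fixed amount of [L] ([fast_descent]).
    So does the neighbourhood of a noncritical point, since a state at rest
    there would drive the momentum away in a fixed direction
    ([noncritical_descent]). As the critical values have empty interior, [L]
    cannot cross an interval upwards infinitely often ([no_upcrossing]); it
    follows that the velocity tends to [0] ([velocity_cvg0]), and [p] with
    it. *)

(** * Inner product, norms and limits along ultrafilters *)

Section Preliminaries.
Context {R : realType} {n : nat}.
Implicit Types (u v w x z : 'rV[R]_n) (A : set 'rV[R]_n).

Lemma coord_le_norm u i : `|u 0 i| <= `|u|.
Proof.
by rewrite [leRHS]/Num.norm /= mx_normrE; apply/bigmax_geP; right => /=; exists (0, i).
Qed.

Lemma norm_le_coord u c : 0 <= c -> (forall i, `|u 0 i| <= c) -> `|u| <= c.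
Proof.
move=> c0 uc; rewrite [leLHS]/Num.norm /= mx_normrE; apply/bigmax_leP.
by split=> // -[i j] _ /=; rewrite ord1.
Qed.

Lemma dotpC u v : dotp u v = dotp v u.
Proof. by apply: eq_bigr => i _; rewrite mulrC. Qed.

Lemma dotpDl u v w : dotp (u + v) w = dotp u w + dotp v w.
Proof. by rewrite -big_split; apply: eq_bigr => i _ /=; rewrite mxE mulrDl. Qed.

Lemma dotpZl (c : R) u w : dotp (c *: u) w = c * dotp u w.
Proof. by rewrite /dotp mulr_sumr; apply: eq_bigr => i _; rewrite mxE mulrA. Qed.

Lemma dotpNl u w : dotp (- u) w = - dotp u w.
Proof. by rewrite -scaleN1r dotpZl mulN1r. Qed.

Lemma dotpBl u v w : dotp (u - v) w = dotp u w - dotp v w.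
Proof. by rewrite dotpDl dotpNl. Qed.

Lemma dotpDr u v w : dotp w (u + v) = dotp w u + dotp w v.
Proof. by rewrite dotpC dotpDl !(dotpC w). Qed.

Lemma dotpZr (c : R) u w : dotp w (c *: u) = c * dotp w u.
Proof. by rewrite dotpC dotpZl dotpC. Qed.

Lemma dotpNr u w : dotp w (- u) = - dotp w u.
Proof. by rewrite dotpC dotpNl dotpC. Qed.

Lemma dotp0l u : dotp 0 u = 0.
Proof. by rewrite /dotp big1 // => i _; rewrite mxE mul0r. Qed.

Lemma dotp_suml (I : Type) (r : seq I) (F : I -> 'rV[R]_n) w :
  dotp (\sum_(i <- r) F i) w = \sum_(i <- r) dotp (F i) w.
Proof.
elim: r => [|i r IH]; first by rewrite !big_nil dotp0l.
by rewrite !big_cons dotpDl IH.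
Qed.

Lemma dotp_ge0 u : 0 <= dotp u u.
Proof. by apply: sumr_ge0 => i _; rewrite -expr2 sqr_ge0. Qed.

Lemma dotp_le u v : `|dotp u v| <= n%:R * (`|u| * `|v|).
Proof.
apply: (le_trans (ler_norm_sum _ _ _)).
have -> : n%:R * (`|u| * `|v|) = \sum_(i < n) `|u| * `|v|.
  by rewrite sumr_const card_ord mulr_natl.
apply: ler_sum => i _.
by rewrite normrM ler_pM // coord_le_norm.
Qed.

Lemma enorm_ge0 u : 0 <= enorm u. Proof. exact: sqrtr_ge0. Qed.

Lemma enorm_sq u : enorm u ^+ 2 = dotp u u.
Proof. by rewrite sqr_sqrtr // dotp_ge0. Qed.

Lemma norm_le_enorm u : `|u| <= enorm u.
Proof.
apply: norm_le_coord; first exact: enorm_ge0.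
move=> i; rewrite -sqrtr_sqr ler_wsqrtr // /dotp (bigD1 i) //= -expr2 lerDl.
by apply: sumr_ge0 => j _; rewrite -expr2 sqr_ge0.
Qed.

Lemma enorm_le_norm u : enorm u <= n%:R * `|u|.
Proof.
have n0 : 0 <= n%:R * `|u| by rewrite mulr_ge0.
rewrite -(ger0_norm n0) -sqrtr_sqr ler_wsqrtr //.
apply: (le_trans (ler_norm _)); apply: (le_trans (dotp_le _ _)).
rewrite exprMn -expr2 ler_wpM2r ?sqr_ge0 //.
by case: (n) => [|k]; rewrite ?expr0n // expr2 ler_peMl // ler1n.
Qed.

Lemma dotp_cvg (T : Type) (F : set_system T) (u_ v_ : T -> 'rV[R]_n) u v :
  Filter F -> u_ t @[t --> F] --> u -> v_ t @[t --> F] --> v ->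
  dotp (u_ t) (v_ t) @[t --> F] --> dotp u v.
Proof.
move=> FF cu cv; apply: cvg_big; first exact: add_continuous.
by move=> i _; apply: cvgM;
  [apply: (@cvg_comp _ _ _ u_ (fun M => M 0 i) F (nbhs u)) => //
  |apply: (@cvg_comp _ _ _ v_ (fun M => M 0 i) F (nbhs v)) => //];
  exact: coord_continuous.
Qed.

Lemma convex_segment A u v (t : R) :
  convex_set (A : set (convex_lmodType 'rV[R]_n)) -> A u -> A v ->
  0 <= t -> t <= 1 -> A (u + t *: (v - u)).
Proof.
move=> convA Au Av t0 t1.
have /set_mem := convA v u (Itv01 t0 t1) (mem_set Av) (mem_set Au).
congr A; rewrite /conv /= scalerBr scalerBl scale1r.
by rewrite addrCA.
Qed.

(** Minimality of [c] is exactly the first-order condition along the segments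
    issued from [c]; it turns the absence of small (or zero) elements in a
    convex set into a strict separation from a half space. *)
Lemma min_norm_element A : A !=set0 -> compact A ->
  convex_set (A : set (convex_lmodType 'rV[R]_n)) ->
  exists2 c, A c & forall v, A v -> dotp c c <= dotp v c.
Proof.
move=> A0 cA convA.
have [|c /set_mem Ac cmin] :=
    compact_EVT_min (f := fun v : 'rV[R]_n => dotp v v) A0 cA.
  by apply: continuous_subspaceT => v; exact: (@dotp_cvg _ (nbhs v) id id v v).
exists c => // v Av; rewrite leNgt; apply/negP => vc.
set a := dotp v c - dotp c c; set b := dotp (v - c) (v - c).
have a0 : a < 0 by rewrite subr_lt0.
have b0 : 0 <= b by exact: dotp_ge0.
have D0 : 0 < b - a by rewrite subr_gt0; exact: lt_le_trans b0.
pose t := - a / (b - a).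
have t0 : 0 < t by rewrite divr_gt0 // oppr_gt0.
have t1 : t <= 1 by rewrite /t ler_pdivrMr // mul1r lerDr.
have := convex_segment convA Ac Av (ltW t0) t1.
move=> /mem_set/cmin.
rewrite dotpDl !dotpDr !dotpZl !dotpZr -/b (dotpC c) dotpBl -/a => le.
have tb : t * b <= - a.
  rewrite /t mulrAC ler_pdivrMr // ler_wpM2l //; first by rewrite oppr_ge0 ltW.
  by rewrite lerDl oppr_ge0 ltW.
suff : t * (2 * a + t * b) < 0 by lra.
by rewrite pmulr_rlt0 //; lra.
Qed.

End Preliminaries.

Section Ultrafilters.
Context {R : realType}.

Lemma eventually_ultra : exists U : set_system nat,
  UltraFilter U /\ \oo `<=` U.
Proof. exact: ultraFilterLemma. Qed.

(** All bounded sequences converge along the same ultrafilter, uncountable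
    families of them included: this replaces the extraction of subsequences in
    the compactness arguments below. *)
Lemma ultra_bounded_cvg (U : set_system nat) n (u : nat -> 'rV[R]_n) (B : R) :
  UltraFilter U -> (forall i, `|u i| <= B) ->
  exists2 l, u i @[i --> U] --> l & `|l| <= B.
Proof.
move=> UU uB; pose A := [set v : 'rV[R]_n | `|v| <= B].
have clA : closed A.
  rewrite (_ : A = (fun v : 'rV[R]_n => `|v|) @^-1` [set r | r <= B]) //.
  by apply: closed_comp; [move=> ? _; exact: norm_continuous|exact: closed_le].
have cA : compact A.
  apply: bounded_closed_compact => //.
  by exists B; split; [exact: num_real|move=> y By v /= Av; exact: le_trans Av (ltW By)].
have UA : (u i @[i --> U]) A by apply: (@filterE _ U) => i; exact: uB.
have [l [Al cl]] := cA (u i @[i --> U]) _ UA.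
exists l => //.
move=> N lN; have [//|UC] := in_ultra_setVsetC (u @^-1` N) UU.
by have [y [yN ynN]] := cl (~` N) N UC lN.
Qed.

End Ultrafilters.

(** * Set-valued maps with closed graph *)

Section Sequences.
Context {R : realType}.

Lemma cvg_dominated (V : normedModType R) (u : nat -> V) (l : V) (r : nat -> R) :
  (forall i, `|u i - l| <= r i) -> r i @[i --> \oo] --> 0 ->
  u i @[i --> \oo] --> l.
Proof.
move=> ur r0; apply/cvgrPdist_le => e e0; near=> i.
rewrite distrC; apply: le_trans (ur i) (le_trans (ler_norm _) _).
by near: i; move/cvgr0Pnorm_le : r0; exact.
Unshelve. all: by end_near. Qed.

Lemma cvg_scaled_harmonic (c : R) : c / i.+1%:R @[i --> \oo] --> 0.
Proof.
rewrite -(mulr0 c); apply: cvgM; first exact: cvg_cst.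
exact: cvg_harmonic.
Qed.

End Sequences.

(** The counterpart of [expansion] for the sup norm, with attained distances. *)
Definition near_field {R : realType} {n : nat} (D : 'rV[R]_n -> set 'rV[R]_n)
    (r : R) (x w : 'rV[R]_n) : Prop :=
  exists z a, [/\ `|z - x| <= r, D z a & `|w - a| <= r].

(** Local boundedness of [D] at [x], which a closed graph and compact values do
    not imply. *)
Definition bounded_around {R : realType} {n : nat}
    (D : 'rV[R]_n -> set 'rV[R]_n) (x : 'rV[R]_n) : Prop :=
  exists r B, [/\ 0 < r & forall z a, `|z - x| < r -> D z a -> `|a| <= B].

Section ClosedGraph.
Context {R : realType} {n : nat}.
Variable D : 'rV[R]_n -> set 'rV[R]_n.
Hypothesis closedD : closed [set p : 'rV[R]_n * 'rV[R]_n | D p.1 p.2].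
Implicit Types (u v w x z a : 'rV[R]_n).

Lemma near_fieldW r s x y w : `|y - x| <= s -> near_field D r y w ->
  near_field D (r + s) x w.
Proof.
move=> yx [z [a [zy Dza wa]]]; have s0 : 0 <= s by exact: le_trans yx.
exists z, a; split => //; last by apply: le_trans wa _; rewrite lerDl.
by rewrite -(subrK y z) -addrA; apply: le_trans (ler_normD _ _) (lerD zy yx).
Qed.

Lemma closed_graph_cvg (F : set_system nat) x v : ProperFilter F ->
  forall z_ a_ : nat -> 'rV[R]_n, (forall i, D (z_ i) (a_ i)) ->
  z_ i @[i --> F] --> x -> a_ i @[i --> F] --> v -> D x v.
Proof.
move=> FF z_ a_ Dza zx av.
apply: (@closed_cvg _ _ F FF (fun i => (z_ i, a_ i)) _ closedD _ (x, v)).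
  by apply: nearW => i; exact: Dza.
exact: (cvg_pair zx av).
Qed.

(** A strict upper bound of the support function of [D x] persists under small
    perturbations of the base point, of the direction and of the selected
    element: otherwise a limit of violating elements would belong to [D x]. *)
Lemma support_usc x u c : bounded_around D x ->
  (forall v, D x v -> dotp v u < c) ->
  exists2 r, 0 < r & forall w u', near_field D r x w -> `|u' - u| <= r ->
    dotp w u' < c.
Proof.
move=> [r0 [B [r0_gt0 DB]]] Dxc; apply: contrapT => /forall2NP noR.
pose r i : R := (r0 / 2) / i.+1%:R.
have r_gt0 i : 0 < r i by rewrite !divr_gt0.
have r_cvg : r i @[i --> \oo] --> 0 by exact: cvg_scaled_harmonic.
have /choice[s sP] i : exists s : 'rV[R]_n * 'rV[R]_n * ('rV[R]_n * 'rV[R]_n),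
    [/\ `|s.1.1 - x| <= r i, D s.1.1 s.1.2, `|s.2.1 - s.1.2| <= r i,
        `|s.2.2 - u| <= r i & c <= dotp s.2.1 s.2.2].
  have [/(_ (r_gt0 i))//|] := noR (r i).
  move=> /existsNP[w /existsNP[u' /not_implyP[[z [a [zx Dza wa]]] ]]].
  move=> /not_implyP[uu /negP]; rewrite -leNgt => cw.
  by exists (z, a, (w, u')).
have rB i : r i < r0.
  rewrite /r ltr_pdivrMr // ltr_pdivrMr // -mulrA ltr_pMr //.
  by rewrite (lt_le_trans (_ : 1 < 2)) ?ltr1n // ler_peMl // ler1n.
have [U [UU oU]] := eventually_ultra.
have [|a aC _] := @ultra_bounded_cvg R U n (fun i => (s i).1.2) B UU.
  move=> i; have [zx Dza _ _ _] := sP i.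
  exact: DB (le_lt_trans zx (rB i)) Dza.
have zC : (s i).1.1 @[i --> U] --> x.
  have zx i : `|(s i).1.1 - x| <= r i by have [] := sP i.
  by move=> N /(cvg_dominated zx r_cvg); exact: oU.
have uC : (s i).2.2 @[i --> U] --> u.
  have uu i : `|(s i).2.2 - u| <= r i by have [] := sP i.
  by move=> N /(cvg_dominated uu r_cvg); exact: oU.
have wC : (s i).2.1 @[i --> U] --> a.
  rewrite -[a]add0r.
  rewrite [X in X i @[i --> U]](_ : _ =
      fun i => ((s i).2.1 - (s i).1.2) + (s i).1.2); last first.
    by apply/funext => i; rewrite subrK.
  apply: cvgD => //.
  have wa i : `|((s i).2.1 - (s i).1.2) - 0| <= r i.
    by rewrite subr0; have [] := sP i.
  by move=> N /(cvg_dominated wa r_cvg); exact: oU.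
have Dxa : D x a.
  by apply: closed_graph_cvg zC aC => // i; have [] := sP i.
have := Dxc _ Dxa; rewrite ltNge => /negP; apply.
apply: (cvgr_to_ge (dotp_cvg _ wC uC)).
by apply: nearW => i; have [] := sP i.
Qed.

End ClosedGraph.

(** * Curves and support functions *)

Section Curves.
Context {R : realType} {n : nat}.
Implicit Types (gamma : R -> 'rV[R]_n).

Lemma first_order_expansion_derive gamma (t : R) (q : 'rV[R]_n) :
  (forall e, 0 < e -> exists2 h, 0 < h & forall s, `|s - t| < h ->
     `|gamma s - gamma t - (s - t) *: q| <= e * `|s - t|) ->
  derivable gamma t 1 /\ derive1 gamma t = q.
Proof.
move=> gq.
have cv : h^-1 *: ((gamma \o shift t) (h *: (1 : R)) - gamma t) @[h --> 0^'] --> q.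
  apply/cvgrPdist_le => e e0; have [h0 h0_gt0 gh] := gq e e0.
  near=> h.
  have h_neq0 : h != 0 by near: h; exact: nbhs_dnbhs_neq.
  have hh : `|h| < h0.
    near: h; apply: nbhs_dnbhs; apply/nbhs_ballP; exists h0 => //= y.
    by rewrite -ball_normE /ball_ /= sub0r normrN.
  have := gh (h + t); rewrite addrK => /(_ hh).
  rewrite /= /GRing.scale /= mulr1 => le.
  rewrite -(ler_pM2l (_ : 0 < `|h|)) ?normr_gt0 // -normrZ scalerBr scalerA.
  by rewrite divff // scale1r -normrN opprB (mulrC _ e).
by split; [apply: cvgP cv|rewrite derive1E; exact: (cvg_lim _ cv)].
Unshelve. all: by end_near. Qed.

Lemma lipschitz_abs_continuous (a b K : R) gamma :
  (forall s t, a <= s -> s <= t -> t <= b -> `|gamma t - gamma s| <= K * (t - s)) ->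
  abs_continuous_on a b gamma.
Proof.
move=> gK e e0; pose C := n%:R * `|K| + 1.
have C0 : 0 < C by rewrite ltr_wpDl // mulr_ge0.
exists (e / C); first by rewrite divr_gt0.
move=> k l r lr _ slr; apply: (@le_lt_trans _ _ (C * \sum_(i < k) (r i - l i))).
  rewrite mulr_sumr; apply: ler_sum => i _.
  have [al [lri rb]] := lr i; have rl0 : 0 <= r i - l i by rewrite subr_ge0.
  apply: (le_trans (enorm_le_norm _)).
  rewrite (@le_trans _ _ (n%:R * (`|K| * (r i - l i)))) // ?ler_wpM2l //.
    by apply: le_trans (gK _ _ al lri rb) _; rewrite ler_wpM2r // ler_norm.
  by rewrite mulrA ler_wpM2r // /C lerDl.
by rewrite mulrC -ltr_pdivlMr.
Qed.

End Curves.

Section SupportFunction.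
Context {R : realType} {n : nat}.
Variable D : 'rV[R]_n -> set 'rV[R]_n.
Hypothesis closedD : closed [set p : 'rV[R]_n * 'rV[R]_n | D p.1 p.2].
Hypothesis D_neq0 : forall x, D x !=set0.
Hypothesis compactD : forall x, compact (D x).
Implicit Types (u v w x z a : 'rV[R]_n).

Definition support x u : R := sup [set dotp u v | v in D x].

Lemma compact_bound x : exists2 B, 0 <= B & forall v, D x v -> `|v| <= B.
Proof.
have [M [_ hM]] := compact_bounded (@compactD x).
exists (`|M| + 1) => [|v Dv]; first by rewrite addr_ge0.
by apply: hM Dv; rewrite (le_lt_trans (ler_norm _)) // ltrDl.
Qed.

Lemma le_support x u v : D x v -> dotp u v <= support x u.
Proof.
move=> Dv; apply: ub_le_sup; last by exists v.
have [B _ DB] := compact_bound x; exists (n%:R * (`|u| * B)) => _ [w Dw <-].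
apply: le_trans (ler_norm _) (le_trans (dotp_le _ _) _).
by rewrite ler_wpM2l // ler_wpM2l // DB.
Qed.

Lemma support_le x u c : (forall v, D x v -> dotp u v <= c) -> support x u <= c.
Proof.
move=> le; apply: ge_sup; last by move=> _ [v Dv <-]; exact: le.
by have [v Dv] := D_neq0 x; exists (dotp u v), v.
Qed.

Lemma support_measurable (X Q : R -> 'rV[R]_n) (a b : R) :
  {in `]a, b[, forall t, {for t, continuous X}} ->
  {in `]a, b[, forall t, {for t, continuous Q}} ->
  {in `]a, b[, forall t, bounded_around D (X t)} ->
  measurable_fun `]a, b[ (fun t => support (X t) (Q t)).
Proof.
move=> cX cQ bD; apply: (measurability _ (RGenInftyO.measurableE R)).
move=> _ [_ [c ->] <-]; apply: open_measurable.
rewrite openE => t [tab /=]; rewrite in_itv /= => tc.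
pose c' := (support (X t) (Q t) + c) / 2.
have [|r r0 rD] := support_usc closedD (c := c') (u := Q t) (bD t tab).
  move=> v Dv; rewrite dotpC; apply: le_lt_trans (le_support (Q t) Dv) _.
  by rewrite /c'; lra.
have Xr : \forall s \near t, `|X s - X t| <= r.
  by have /cvgrPdist_le/(_ _ r0) := cX t tab; apply: filterS => s; rewrite distrC.
have Qr : \forall s \near t, `|Q s - Q t| <= r.
  by have /cvgrPdist_le/(_ _ r0) := cQ t tab; apply: filterS => s; rewrite distrC.
have tO : \forall s \near t, `]a, b[%classic s.
  by apply: open_nbhs_nbhs; split => //; exact: interval_open.
apply: filterS (filterI tO (filterI Xr Qr)) => s [sab [Xs Qs]].
split => //=; rewrite in_itv /=; apply: (@le_lt_trans _ _ c'); last first.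
  by rewrite /c'; lra.
apply: support_le => v Dv; rewrite dotpC; apply/ltW/rD => //.
by exists (X s), v; split => //; rewrite subrr normr0 ltW.
Qed.

(** On curves of class C1 the integrand of [chain_integral] is measurable by
    upper semicontinuity of the support function. *)
Lemma chain_integralE (gamma Q : R -> 'rV[R]_n) :
  (forall t : R, 0 < t < 1 -> derivable gamma t 1 /\ derive1 gamma t = Q t) ->
  {in `]0, 1[, forall t : R, {for t, continuous Q}} ->
  {in `]0, 1[, forall t : R, bounded_around D (gamma t)} ->
  measurable_fun (`]0, 1[%classic : set R) (fun t => support (gamma t) (Q t)) /\
  (chain_integral D gamma =
   \int[@lebesgue_measure R]_(t in `]0%R, 1%R[) (support (gamma t) (Q t))%:E)%E.
Proof.
move=> dg cQ bD.
have mS : measurable_fun (`]0, 1[%classic : set R)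
    (fun t => support (gamma t) (Q t)).
  apply: support_measurable => // t; rewrite in_itv /= => /dg[+ _].
  by move=> /derivable1_diffP/differentiable_continuous.
have eS : {in (`]0, 1[%classic : set R),
    (fun t => sup [set dotp (derive1 gamma t) v | v in D (gamma t)]) =1
    (fun t => support (gamma t) (Q t))}.
  by move=> t; rewrite inE /= in_itv /= => t01; rewrite (dg t t01).2.
split => //; rewrite /chain_integral integral_itv_bndoo //; last first.
  by apply/measurable_EFinP; apply: eq_measurable_fun mS => t /eS.
by apply: eq_integral => t /eS ->.
Qed.

End SupportFunction.

(** * Local boundedness of conservative fields *)

(** Completeness makes Baire's theorem available for vectors. *)
HB.instance Definition _ (R : realType) (m n : nat) :=
  Uniform_isComplete.Build 'M[R]_(m, n) (@cauchy_cvg 'M[R]_(m, n)).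

Lemma sequentially_closed {R : realType} (V : normedModType R) (A : set V) :
  (forall (u : nat -> V) l, (forall i, A (u i)) ->
    u i @[i --> \oo] --> l -> A l) -> closed A.
Proof.
move=> Aseq p clp.
have /choice[u uP] i : exists y, A y /\ `|y - p| <= 1 / i.+1%:R.
  have i0 : 0 < 1 / i.+1%:R :> R by rewrite divr_gt0.
  have [y [Ay yp]] := clp _ (nbhsx_ballx p _ i0); exists y; split => //.
  by move: yp; rewrite -ball_normE /ball_ /= distrC => /ltW.
apply: (Aseq u p) => [i|]; first by have [] := uP i.
exact: cvg_dominated (fun i => (uP i).2) (cvg_scaled_harmonic 1).
Qed.

Section LocalBoundedness.
Context {R : realType} {n : nat}.
Variable D : 'rV[R]_n -> set 'rV[R]_n.
Hypothesis closedD : closed [set p : 'rV[R]_n * 'rV[R]_n | D p.1 p.2].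
Hypothesis D_neq0 : forall x, D x !=set0.
Hypothesis compactD : forall x, compact (D x).
Hypothesis convexD : convex_valued D.
Implicit Types (u v w x z a : 'rV[R]_n).

(** A closed graph alone does not prevent values from escaping to infinity.
    With convex values, a bounded selection does: a long segment of [D z]
    issued from the selection would cross every sphere, and leave in the limit
    an element of [D x] on a sphere that the compact set [D x] does not meet. *)
Lemma anchored_bounded_around x r N : 0 < r ->
  (forall z, `|z - x| < r -> exists2 v, D z v & `|v| <= N) ->
  bounded_around D x.
Proof.
move=> r0 DN; have [M M0 DM] := compact_bound compactD x.
have N0 : 0 <= N.
  have [|v _ vN] := DN x; first by rewrite subrr normr0.
  exact: le_trans vN.
pose Q := M + N + 1; apply: contrapT => nb.
pose s i : R := (r / 2) / i.+1%:R.
have s0 i : 0 < s i by rewrite !divr_gt0.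
have sr i : s i < r.
  rewrite /s ltr_pdivrMr // ltr_pdivrMr // -mulrA ltr_pMr //.
  by rewrite (lt_le_trans (_ : 1 < 2)) ?ltr1n // ler_peMl // ler1n.
have /choice[p pP] i : exists p : 'rV[R]_n * 'rV[R]_n,
    [/\ `|p.1 - x| <= s i, D p.1 p.2, Q <= `|p.2| & `|p.2| <= Q + 2 * N].
  have [z [a [zx Dza aQ]]] : exists z a, [/\ `|z - x| < s i, D z a & Q < `|a|].
    apply: contrapT => H; apply: nb; exists (s i), Q; split => //.
    move=> z a zx Dza; rewrite leNgt; apply/negP => Qa; apply: H.
    by exists z, a.
  have [c Dzc cN] := DN z (lt_trans zx (sr i)).
  have [aQ2|aQ2] := leP `|a| (Q + 2 * N).
    by exists (z, a); split => //=; exact: ltW.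
  have ac : Q + N < `|a - c|.
    by have := lerB_dist a c; lra.
  pose t := (Q + N) / `|a - c|.
  have QN0 : 0 < Q + N by rewrite /Q; lra.
  have ac0 : 0 < `|a - c| by exact: lt_trans ac.
  have t0 : 0 <= t by rewrite divr_ge0 // ltW.
  have t1 : t <= 1 by rewrite ler_pdivrMr // mul1r ltW.
  have tac : `|t *: (a - c)| = Q + N.
    by rewrite normrZ ger0_norm // -mulrA mulVf ?mulr1 // gt_eqF.
  exists (z, c + t *: (a - c)); split => /=.
  - exact: ltW.
  - exact: (convex_segment (@convexD z)).
  - have := lerB_normD (t *: (a - c)) c; rewrite tac (addrC _ c); lra.
  - by have := ler_normD c (t *: (a - c)); rewrite tac; lra.
have [U [UU oU]] := eventually_ultra.
have [|b bC _] := @ultra_bounded_cvg R U n (fun i => (p i).2) (Q + 2 * N) UU.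
  by move=> i; have [] := pP i.
have zC : (p i).1 @[i --> U] --> x.
  have zx i : `|(p i).1 - x| <= s i by have [] := pP i.
  by move=> A /(cvg_dominated zx (cvg_scaled_harmonic _)); exact: oU.
have Db : D x b by apply: (closed_graph_cvg closedD) zC bC => // i; have [] := pP i.
have : Q <= `|b|.
  apply: (@cvgr_to_ge _ U _ _ (fun i => `|(p i).2|)); first exact: cvg_norm.
  by apply: nearW => i; have [] := pP i.
by have := DM _ Db; rewrite /Q; lra.
Qed.

(** Space is the union of the closed sets [E N] of the points [x] such that
    [D x] meets the ball of radius [N]; by Baire, one of them has interior
    points in any given ball. *)
Lemma bounded_selection_dense x0 r0 : 0 < r0 ->
  exists x1 r1 N, [/\ `|x1 - x0| < r0, 0 < r1 &
    forall z, `|z - x1| < r1 -> exists2 v, D z v & `|v| <= N].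
Proof.
move=> r0_gt0.
pose E (N : nat) := [set z | exists2 v, D z v & `|v| <= N%:R].
have clE N : closed (E N).
  apply: sequentially_closed => u l uE ul.
  have /choice[v vP] i : exists v, D (u i) v /\ `|v| <= N%:R.
    by have [v ? ?] := uE i; exists v.
  have [U [UU oU]] := eventually_ultra.
  have [|b bC bN] := @ultra_bounded_cvg R U n v N%:R UU.
    by move=> i; have [] := vP i.
  exists b => //; apply: (@closed_graph_cvg _ _ D closedD U l b _ u v _ _ bC).
    by move=> i; have [] := vP i.
  by move=> A /ul; exact: oU.
apply: contrapT => H.
pose G N := ~` (E N) `|` ~` (closed_ball x0 (r0 / 2)).
have r2 : 0 < r0 / 2 by rewrite divr_gt0.
have odG N : open (G N) /\ dense (G N).
  split.
    by apply: openU; apply: closed_openC => //; exact: closed_ball_closed.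
  move=> A [y0 Ay0] openA.
  have [ob|nob] := pselect (closed_ball x0 (r0 / 2) y0); last first.
    by exists y0; split => //; right.
  have /nbhs_ballP[r1 r1_gt0 r1A] : nbhs y0 A by exact: open_nbhs_nbhs.
  apply: contrapT => HA; apply: H; exists y0, r1, N%:R; split => //.
    move: ob; rewrite closed_ballE // /closed_ball_ /= distrC => /le_lt_trans; apply.
    by rewrite ltr_pdivrMr // ltr_pMr // ltr1n.
  move=> z zo; apply: contrapT => nE; apply: HA; exists z; split; last by left.
  by apply: r1A; rewrite -ball_normE /ball_ /= distrC.
have /(_ (ball x0 (r0 / 2)) _ (ball_open _ _))[|y [yb yG]] := Baire odG.
  by exists x0; exact: ballxx.
have [v Dv] := D_neq0 y.
have [|] := yG (Num.bound `|v|) I; last by apply; exact: subset_closed_ball.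
apply; exists v => //; apply: ltW; exact: archi_boundP.
Qed.

Variable f : 'rV[R]_n -> R.
Hypothesis chainD : forall gamma, abs_continuous_on 0 1 gamma ->
    (f (gamma 1))%:E = ((f (gamma 0))%:E + chain_integral D gamma)%E.

Lemma chain_integral_ge (gamma Q : R -> 'rV[R]_n) (c : R) :
  (forall t : R, 0 < t < 1 -> derivable gamma t 1 /\ derive1 gamma t = Q t) ->
  {in `]0, 1[, forall t : R, {for t, continuous Q}} ->
  {in `]0, 1[, forall t : R, bounded_around D (gamma t)} ->
  0 <= c -> (forall t : R, 0 < t < 1 -> c <= support D (gamma t) (Q t)) ->
  (c%:E <= chain_integral D gamma)%E.
Proof.
move=> dg cQ bD c0 cs.
have [mS ->] := chain_integralE closedD D_neq0 compactD dg cQ bD.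
have -> : c%:E = (\int[@lebesgue_measure R]_(t in `]0%R, 1%R[) c%:E)%E.
  by rewrite integral_cst //= lebesgue_measure_itv /= lte_fin ltr01 -EFinB subr0 mule1.
by apply: ge0_le_integral => //; exact/measurable_EFinP.
Qed.

Lemma bounded_aroundS x r B y :
  (forall z a, `|z - x| < r -> D z a -> `|a| <= B) -> `|y - x| < r ->
  bounded_around D y.
Proof.
move=> DB yx; exists (r - `|y - x|), B; split; first by rewrite subr_gt0.
move=> z a zy; apply: DB; rewrite -(subrK y z) -addrA.
by apply: le_lt_trans (ler_normD _ _) _; rewrite -ltrBrDr.
Qed.

(** If every element of [D x] were longer than the Lipschitz constant [L], then
    along the least one, [c], all elements of the nearby values would have a
    slope larger than [L * |c|], and so would [f] on a short segment. *)
Lemma lipschitz_selection x r L : 0 < r -> 0 <= L ->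
  (forall y z, `|y - x| < r -> `|z - x| < r -> `|f y - f z| <= L * `|y - z|) ->
  bounded_around D x -> exists2 v, D x v & `|v| <= L.
Proof.
move=> r0 L0 fL bDx.
have [c Dc cmin] := min_norm_element (D_neq0 x) (@compactD x) (@convexD x).
exists c => //; rewrite leNgt; apply/negP => Lc.
have c0 : 0 < `|c| by exact: le_lt_trans Lc.
have kc : L * `|c| < dotp c c.
  rewrite -enorm_sq; apply: (@lt_le_trans _ _ (`|c| ^+ 2)).
    by rewrite expr2 ltr_pM2r.
  by rewrite ler_sqr ?nnegrE ?enorm_ge0 // norm_le_enorm.
pose k := (L * `|c| + dotp c c) / 2.
have [|r1 r1_gt0 r1D] := support_usc closedD (c := - k) (u := - c) bDx.
  by move=> v /cmin; rewrite dotpNr /k; lra.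
have [rb [B [rb_gt0 DB]]] := bDx.
pose rho := Num.min r (Num.min r1 rb).
have rho0 : 0 < rho by rewrite !lt_min r0 r1_gt0.
pose s := rho / (`|c| + `|c|).
have cc0 : 0 < `|c| + `|c| by rewrite addr_gt0.
have s0 : 0 < s by rewrite divr_gt0.
have sc : s * `|c| < rho.
  by rewrite /s mulrAC ltr_pdivrMr // ltr_pM2l // ltrDl.
pose gamma (t : R) := x + (t * s) *: c.
have gx t : 0 <= t -> t <= 1 -> `|gamma t - x| < rho.
  move=> t0 t1; rewrite /gamma addrAC subrr add0r normrZ ger0_norm; last first.
    by rewrite mulr_ge0 // ltW.
  by apply: le_lt_trans sc; rewrite ler_pM2r // ler_piMl // ltW.
have gB (t p q : R) : gamma p - gamma q - t *: (s *: c) = (p - q - t) *: (s *: c).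
  by rewrite /gamma !scalerBl opprD addrACA subrr add0r -!scalerA.
have gamma1 : gamma 1 = x + s *: c by rewrite /gamma mul1r.
have gamma0 : gamma 0 = x by rewrite /gamma mul0r scale0r addr0.
have acg : abs_continuous_on 0 1 gamma.
  apply: (@lipschitz_abs_continuous _ _ _ _ `|s *: c|) => p q _ pq _.
  have := gB 0 q p; rewrite scale0r !subr0 => ->.
  by rewrite normrZ ger0_norm ?subr_ge0 // mulrC.
have := chainD acg; rewrite gamma1 gamma0 => ch.
have : ((s * k)%:E <= chain_integral D gamma)%E.
  apply: (@chain_integral_ge gamma (fun=> s *: c)).
  - move=> t _; apply: first_order_expansion_derive => e e0.
    exists 1 => // t' _; rewrite gB subrr scale0r normr0.
    by rewrite mulr_ge0 // ltW.
  - by move=> t _; exact: cst_continuous.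
  - move=> t; rewrite in_itv /= => /andP[t0 t1].
    apply: bounded_aroundS DB _; apply: lt_le_trans (gx _ (ltW t0) (ltW t1)) _.
    by rewrite !ge_min lexx !orbT.
  - by rewrite mulr_ge0 ?ltW // /k; have := mulr_ge0 L0 (ltW c0); lra.
  - move=> t /andP[t0 t1]; have [v Dv] := D_neq0 (gamma t).
    apply: le_trans (le_support compactD (s *: c) Dv).
    rewrite dotpZl ler_pM2l // dotpC -lerN2 -dotpNr; apply/ltW/r1D; last first.
      by rewrite subrr normr0 ltW.
    exists (gamma t), v; split => //; last by rewrite subrr normr0 ltW.
    apply/ltW/(lt_le_trans (gx _ (ltW t0) (ltW t1))).
    by rewrite !ge_min lexx !orbT.
have -> : chain_integral D gamma = (f (x + s *: c) - f x)%:E.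
  move: ch; case: (chain_integral D gamma) => [y||] //= [->].
  by rewrite addrAC subrr add0r.
rewrite lee_fin => ge.
have le : `|f (x + s *: c) - f x| <= L * (s * `|c|).
  have := fL (x + s *: c) x; rewrite subrr normr0 addrAC subrr add0r.
  rewrite normrZ gtr0_norm //; apply => //.
  by apply: lt_le_trans sc _; rewrite ge_min lexx.
have : s * k <= s * (L * `|c|).
  rewrite [leRHS]mulrCA; apply: le_trans le; apply: le_trans (ler_norm _).
  exact: ge.
by rewrite ler_pM2l // /k; lra.
Qed.

Hypothesis lipf : locally_lipschitz f.

Lemma locally_lipschitzP x : exists r L, [/\ 0 < r, 0 <= L &
  forall y z, `|y - x| < r -> `|z - x| < r -> `|f y - f z| <= L * `|y - z|].
Proof.
have [r r0 [M [_ hM]]] := lipf x.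
exists r, (`|M| + 1); split => //.
move=> y z yx zx.
have /hM/(_ (y, z)) : M < `|M| + 1 by rewrite (le_lt_trans (ler_norm _)) // ltrDl.
by apply; split; rewrite -ball_normE /ball_ /= distrC.
Qed.

(** Near [x], the Lipschitz bound selects short elements at a dense set of
    points, hence everywhere by the closed graph, and such a selection bounds
    the convex values. *)
Lemma conservative_bounded_around x : bounded_around D x.
Proof.
have [r [L [r0 L0 fL]]] := locally_lipschitzP x.
apply: (anchored_bounded_around r0 (N := L)) => z zx.
pose rz := r - `|z - x|; have rz0 : 0 < rz by rewrite subr_gt0.
have zP i : exists p : 'rV[R]_n * 'rV[R]_n,
    [/\ `|p.1 - z| <= rz / i.+1%:R, D p.1 p.2 & `|p.2| <= L].
  have i0 : 0 < rz / i.+1%:R by rewrite divr_gt0.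
  have [y [ry [N [yz ry0 yN]]]] := bounded_selection_dense z i0.
  have yr : `|y - x| < r.
    rewrite -(subrK z y) -addrA; apply: le_lt_trans (ler_normD _ _) _.
    rewrite -ltrBrDr; apply: lt_le_trans yz _.
    by rewrite ler_pdivrMr // ler_peMr ?ler1n // ltW.
  have [|||v Dv vL] := @lipschitz_selection y (r - `|y - x|) L _ L0.
  - by rewrite subr_gt0.
  - move=> a b ay bY; apply: fL.
      rewrite -(subrK y a) -addrA; apply: le_lt_trans (ler_normD _ _) _.
      by rewrite -ltrBrDr.
    rewrite -(subrK y b) -addrA; apply: le_lt_trans (ler_normD _ _) _.
    by rewrite -ltrBrDr.
  - exact: anchored_bounded_around yN.
  - by exists (y, v); split => //; exact: ltW.
have {zP}[p pP] := choice zP.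
have [U [UU oU]] := eventually_ultra.
have [|b bC bL] := @ultra_bounded_cvg R U n (fun i => (p i).2) L UU.
  by move=> i; have [] := pP i.
exists b => //.
have zC : (p i).1 @[i --> U] --> z.
  have zi i : `|(p i).1 - z| <= rz / i.+1%:R by have [] := pP i.
  by move=> A /(cvg_dominated zi (cvg_scaled_harmonic _)); exact: oU.
by apply: (closed_graph_cvg closedD) zC bC => // i; have [] := pP i.
Qed.

End LocalBoundedness.

(** * Piecewise constant functions of time *)

Section StepFunctions.
Context {R : realType}.
Variable alpha : nat -> R.
Hypothesis alpha_gt0 : forall k, 0 < alpha k.
Notation mu := (@lebesgue_measure R).

Lemma itime0 : itime alpha 0 = 0.
Proof. by rewrite /itime big_ord0. Qed.

Lemma itimeS k : itime alpha k.+1 = itime alpha k + alpha k.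
Proof. by rewrite /itime big_ord_recr. Qed.

Lemma itime_lt k : itime alpha k < itime alpha k.+1.
Proof. by rewrite itimeS ltrDl. Qed.

Lemma itime_le : {homo itime alpha : j k / (j <= k)%N >-> j <= k}.
Proof.
apply: homo_leq => // [? ? ?|k]; first exact: le_trans.
exact/ltW/itime_lt.
Qed.

Lemma itime_ge0 i : 0 <= itime alpha i.
Proof. by rewrite -itime0 itime_le. Qed.

Lemma itime_lt_inv i j : itime alpha i < itime alpha j -> (i < j)%N.
Proof. by move=> ij; rewrite ltnNge; apply/negP => /itime_le; rewrite leNgt ij. Qed.

Lemma iindexE i t : itime alpha i <= t < itime alpha i.+1 -> iindex alpha t = i.
Proof.
move=> /andP[it ti]; rewrite /iindex; case: xgetP => [j _ /= /andP[jt tj]|/(_ i)].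
  apply/eqP; rewrite eqn_leq -ltnS (itime_lt_inv (le_lt_trans jt ti)) /=.
  by rewrite -ltnS (itime_lt_inv (le_lt_trans it tj)).
by rewrite /= it ti.
Qed.

Lemma itime_cell (i j : nat) t : itime alpha i <= t < itime alpha j ->
  exists k, [/\ (i <= k < j)%N & itime alpha k <= t < itime alpha k.+1].
Proof.
elim: j => [|j IH] /andP[it tj].
  by have := le_lt_trans it tj => /itime_lt_inv.
have [jt|tj'] := leP (itime alpha j) t.
  exists j; rewrite jt tj ltnSn andbT; split => //.
  by rewrite -ltnS; apply: itime_lt_inv; exact: le_lt_trans it tj.
have [|k [/andP[ik kj] kt]] := IH; first by rewrite it.
by exists k; split => //; rewrite ik ltnW.
Qed.

Lemma iindex_measurable (c : nat -> R) :
  measurable_fun setT (fun t => c (iindex alpha t)).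
Proof.
pose cell k := `[itime alpha k, itime alpha k.+1[%classic : set R.
have mfiber i : measurable [set t | iindex alpha t = i].
  have mcells : measurable (\bigcup_k cell k).
    by apply: bigcup_measurable => k _; exact: measurable_itv.
  rewrite (_ : [set t | _] = if i == 0%N then cell 0%N `|` ~` \bigcup_k cell k
                             else cell i); last first.
    apply/seteqP; split=> [t /= ti|t].
      have [[k kt]|nt] := pselect (exists k, cell k t).
        move: (kt); rewrite {1}/cell /= in_itv /= => /iindexE; rewrite ti => ik.
        by rewrite ik; case: ifP => [/eqP <-|_] //; left.
      have i0 : i = 0%N.
        rewrite -ti /iindex; case: xgetP => // k _ kt.
        by exfalso; apply: nt; exists k; rewrite /cell /= in_itv.
      by rewrite i0 eqxx; right => -[k _ kt]; apply: nt; exists k.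
    case: ifP => [/eqP ->|_]; last by rewrite /cell /= in_itv; exact: iindexE.
    move=> [|nt]; first by rewrite /cell /= in_itv; exact: iindexE.
    rewrite /= /iindex; case: xgetP => // k _ kt.
    by exfalso; apply: nt; exists k => //; rewrite /cell /= in_itv.
  case: ifP => _; last exact: measurable_itv.
  by apply: measurableU; [exact: measurable_itv|exact: measurableC].
move=> _ B mB; rewrite setTI.
rewrite (_ : _ @^-1` _ =
    \bigcup_i (if c i \in B then [set t | iindex alpha t = i] else set0)).
  by apply: bigcup_measurable => i _; case: ifP.
apply/seteqP; split => [t /= Bt|t [i _]].
  by exists (iindex alpha t) => //; rewrite mem_set.
by case: ifP => // /set_mem Bc /= it; rewrite it.
Qed.

Variables (c : nat -> R) (B : R).
Hypothesis cB : forall k, `|c k| <= B.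

Lemma step_integrable (a b : itv_bound R) : (mu [set` Interval a b] < +oo)%E ->
  mu.-integrable [set` Interval a b] (EFin \o (fun t => c (iindex alpha t))).
Proof.
move=> fin; apply: measurable_bounded_integrable => //.
  exact: measurable_funTS (iindex_measurable c).
exists B; split; first exact: num_real.
by move=> y By t _ /=; exact: le_trans (cB _) (ltW By).
Qed.

Lemma bounded_itv_measure (b0 b1 : bool) (s t : R) :
  (mu [set` Interval (BSide b0 s) (BSide b1 t)] < +oo)%E.
Proof. by rewrite lebesgue_measure_itv; case: ifP => _ //=; rewrite -EFinB ltry. Qed.

Lemma step_integral i t : itime alpha i <= t <= itime alpha i.+1 ->
  \int[mu]_(s in `[0, t]) c (iindex alpha s) =
  \sum_(j < i) alpha j * c j + (t - itime alpha i) * c i.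
Proof.
have cell_int k s : itime alpha k <= s <= itime alpha k.+1 ->
    \int[mu]_(r in `]itime alpha k, s]) c (iindex alpha r) =
    (s - itime alpha k) * c k.
  move=> /andP[ks sk].
  rewrite -Rintegral_itv_bndo_bndc; last exact: step_integrable (bounded_itv_measure _ _ _ _).
  rewrite (@eq_Rintegral _ _ _ _ _ (fun=> c k)); last first.
    move=> r; rewrite inE /= in_itv /= => /andP[kr rs].
    by congr c; apply: iindexE; rewrite (ltW kr) (lt_le_trans rs).
  rewrite Rintegral_cst //= lebesgue_measure_itv /= lte_fin.
  case: ltP => [_|sk']; first by rewrite -EFinB /= mulrC.
  by rewrite /= mulr0; have /eqP -> : s == itime alpha k; [rewrite eq_le sk'|
     rewrite subrr mul0r].
elim: i t => [|i IH] t /andP[it ti].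
  rewrite big_ord0 add0r itime0; have := cell_int 0%N t.
  rewrite it ti itime0 => /(_ isT) <-; rewrite Rintegral_itv_obnd_cbnd //.
  exact: step_integrable (bounded_itv_measure _ _ _ _).
have ii : itime alpha i <= itime alpha i.+1 <= itime alpha i.+1.
  by rewrite lexx ltW // itime_lt.
have := @Rintegral_itvB R (fun r => c (iindex alpha r)) (BLeft 0) (BRight t) (itime alpha i.+1).
move=> /(_ (step_integrable (bounded_itv_measure _ _ _ _))).
rewrite !bnd_simp itime_ge0 it => /(_ isT isT)/eqP.
rewrite subr_eq => /eqP ->.
have di : itime alpha i.+1 - itime alpha i = alpha i.
  by rewrite itimeS [LHS]addrC addKr.
by rewrite IH // cell_int ?it // big_ord_recr /= di [LHS]addrC.
Qed.

End StepFunctions.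

(** * Limits superior of integrals *)

Section ReverseFatou.
Context {R : realType}.
Local Notation mu := (@lebesgue_measure R).

(** This is Fatou's lemma for the nonnegative functions [C - G r]. Only an upper
    bound of the pointwise limit superior is assumed, because the support
    function is merely upper semicontinuous. *)
Lemma reverse_fatou (G : nat -> R -> R) (phi : R -> R) (C : R) :
  (forall r, measurable_fun setT (G r)) ->
  (forall r t, `|G r t| <= C) ->
  measurable_fun (`]0, 1[%classic : set R) phi ->
  (forall t, 0 < t < 1 -> `|phi t| <= C) ->
  (forall t, 0 < t < 1 -> forall e, 0 < e -> exists K, forall r, (K <= r)%N ->
     G r t <= phi t + e) ->
  forall e K, 0 < e -> exists2 r, (K <= r)%N &
    \int[mu]_(t in `]0, 1[) G r t <=
    \int[mu]_(t in `]0, 1[) phi t + e.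
Proof.
move=> mG GC mphi phiC Gphi e K e0.
pose I01 : set R := `]0, 1[%classic.
have mI : measurable I01 by exact: measurable_itv.
have fI : (mu I01 < +oo)%E by exact: bounded_itv_measure.
have intG r : mu.-integrable I01 (EFin \o G r).
  apply: measurable_bounded_integrable => //.
    exact: measurable_funTS (mG r).
  by exists C; split; [exact: num_real|move=> y Cy t _ /=; exact: le_trans (GC r t) (ltW Cy)].
have intphi : mu.-integrable I01 (EFin \o phi).
  apply: measurable_bounded_integrable => //.
  exists C; split; first exact: num_real.
  by move=> y Cy t /=; rewrite /I01 /= in_itv /= => /phiC /le_trans; apply; exact: ltW.
have intC : mu.-integrable I01 (EFin \o cst C).
  apply: measurable_bounded_integrable => //.
  by exists `|C|; split; [exact: num_real|move=> y Cy t _ /=; exact: ltW].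
have Cint (g : R -> R) : mu.-integrable I01 (EFin \o g) ->
    (\int[mu]_(t in I01) (C - g t)%:E = (C - \int[mu]_(t in I01) g t)%:E)%E.
  move=> ig; under eq_integral do rewrite EFinB.
  rewrite (@integralB_EFin _ _ R mu I01 (cst C) g mI intC ig).
  have -> : (\int[mu]_(x in I01) (cst C x)%:E = C%:E)%E.
    transitivity (C%:E * mu I01)%E; first exact: (integral_cst mu mI C%:E).
    by rewrite lebesgue_measure_itv /= lte_fin ltr01 -EFinB subr0 mule1.
  by rewrite EFinB /Rintegral fineK //; exact: integrable_fin_num.
pose F r t := (C - G r t)%:E.
have F0 r t : (0 <= F r t)%E.
  by rewrite lee_fin subr_ge0; exact: le_trans (ler_norm _) (GC r t).
have mF r : measurable_fun I01 (F r).
  apply/measurable_EFinP; apply: measurable_funB; first exact: measurable_cst.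
  exact: measurable_funTS (mG r).
have cvg_einfs (u : nat -> \bar R) : cvgn (einfs u).
  by apply/cvg_ex; eexists; apply: ereal_nondecreasing_cvgn; exact: nondecreasing_einfs.
apply: contrapT => H.
have big r : (K <= r)%N ->
    \int[mu]_(t in I01) phi t + e < \int[mu]_(t in I01) G r t.
  by move=> Kr; rewrite ltNge; apply/negP => le; apply: H; exists r.
have := @fatou _ _ R mu I01 mI F mF (fun r t _ => F0 r t).
apply/negP; rewrite -ltNge.
apply: (@le_lt_trans _ _ (C - \int[mu]_(t in I01) phi t - e)%:E).
  rewrite limn_einf_lim; apply: lime_le; first exact: cvg_einfs.
  apply: nearW => k; apply: (@le_trans _ _ (\int[mu]_(t in I01) F (maxn k K) t)%E).
    by apply: ereal_inf_lbound; exists (maxn k K) => //=; exact: leq_maxl.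
  rewrite /F Cint // lee_fin -addrA -opprD lerD2l lerN2.
  exact/ltW/big/leq_maxr.
apply: (@lt_le_trans _ _ (C - \int[mu]_(t in I01) phi t)%:E).
  by rewrite lte_fin ltrBlDr ltrDl.
rewrite -Cint //; apply: ge0_le_integral => //.
- move=> t; rewrite /I01 /= in_itv /= => t01; rewrite lee_fin subr_ge0.
  exact: le_trans (ler_norm _) (phiC t t01).
- apply/measurable_EFinP; apply: measurable_funB => //.
- apply: (emeasurable_fun_cvg (fun k t => einfs (F ^~ t) k)).
    by move=> k; exact: measurable_fun_einfs.
  by move=> t _; rewrite limn_einf_lim; exact: cvg_einfs.
move=> t; rewrite /I01 /= in_itv /= => t01; apply/lee_subgt0Pr => a a0.
rewrite limn_einf_lim; apply: lime_ge; first exact: cvg_einfs.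
have [k0 kG] := Gphi t t01 a a0; exists k0 => // k /= k0k.
apply: le_ereal_inf_tmp => _ [r /= kr <-].
by rewrite -EFinB lee_fin; have := kG r (leq_trans k0k kr); lra.
Qed.

End ReverseFatou.

Lemma bounded_on_balls {R : realType} {n : nat} (D : 'rV[R]_n -> set 'rV[R]_n) :
  (forall x, bounded_around D x) ->
  forall M, exists K, forall x v, `|x| <= M -> D x v -> `|v| <= K.
Proof.
move=> bD M; apply: contrapT => H.
have /choice[p pP] (i : nat) : exists p : 'rV[R]_n * 'rV[R]_n,
    [/\ `|p.1| <= M, D p.1 p.2 & i%:R < `|p.2|].
  apply: contrapT => Hi; apply: H; exists i%:R => x v xM Dxv.
  by rewrite leNgt; apply/negP => iv; apply: Hi; exists (x, v).
have [U [UU oU]] := eventually_ultra.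
have [|l lC _] := @ultra_bounded_cvg R U n (fun i => (p i).1) M UU.
  by move=> i; have [] := pP i.
have [r [B [r0 DB]]] := bD l.
have U1 : \forall i \near U, `|(p i).1 - l| < r.
  by move/cvgrPdist_lt : lC => /(_ _ r0); apply: filterS => i; rewrite distrC.
have U2 : \forall i \near U, B <= i%:R.
  by apply: oU; apply: nbhs_infty_ger.
have [i [i1 i2]] := filter_ex (filterI U1 U2).
have [_ Di ilt] := pP i; have := DB _ _ i1 Di.
by rewrite leNgt (le_lt_trans i2 ilt).
Qed.

(** * The chain rule along vanishing partitions *)

Section ChainRuleAlongPartitions.
Context {R : realType} {n : nat}.
Variable D : 'rV[R]_n -> set 'rV[R]_n.
Hypothesis closedD : closed [set p : 'rV[R]_n * 'rV[R]_n | D p.1 p.2].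
Hypothesis D_neq0 : forall x, D x !=set0.
Hypothesis compactD : forall x, compact (D x).
Hypothesis boundedD : forall x, bounded_around D x.
Variable f : 'rV[R]_n -> R.
Hypothesis contf : continuous f.
Hypothesis chainD : forall gamma, abs_continuous_on 0 1 gamma ->
    (f (gamma 1))%:E = ((f (gamma 0))%:E + chain_integral D gamma)%E.

Variables (N : nat -> nat) (al : nat -> nat -> R).
Variables (x q d : nat -> nat -> 'rV[R]_n) (B : R) (mesh del : nat -> R).
Hypothesis al_gt0 : forall i k, 0 < al i k.
Hypothesis al_sum : forall i, itime (al i) (N i) = 1.
Hypothesis xS : forall i k, (k < N i)%N -> x i k.+1 = x i k + al i k *: q i k.
Hypothesis xB : forall i k, `|x i k| <= B.
Hypothesis qB : forall i k, `|q i k| <= B.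
Hypothesis dB : forall i k, `|d i k| <= B.
Hypothesis al_mesh : forall i k, al i k <= mesh i.
Hypothesis mesh_cvg : mesh i @[i --> \oo] --> 0.
Hypothesis q_slow : forall e, 0 < e -> exists h I, [/\ 0 < h &
  forall i j l, (I <= i)%N -> (j <= l)%N -> (l <= N i)%N ->
    itime (al i) l - itime (al i) j <= h -> `|q i l - q i j| <= e].
Hypothesis d_near : forall i k, (k < N i)%N -> near_field D (del i) (x i k) (d i k).
Hypothesis del_cvg : del i @[i --> \oo] --> 0.

Let idx i t := iindex (al i) t.
Let X_ i t := x i (idx i t).
Let Q_ i t := q i (idx i t).

Let B0 : 0 <= B. Proof. exact: le_trans (xB 0 0). Qed.

Let mesh_ge0 i : 0 <= mesh i.
Proof. by apply: le_trans (al_mesh i 0); exact: ltW. Qed.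

Let idxP i t : 0 <= t <= 1 -> (idx i t <= N i)%N /\
  itime (al i) (idx i t) <= t < itime (al i) (idx i t).+1.
Proof.
move=> /andP[t0 t1].
have [|k [/andP[_ kN] kt]] := itime_cell (al_gt0 i) (i := 0) (j := (N i).+1) (t := t).
  by rewrite itime0 t0 (le_lt_trans t1) // -(al_sum i) itime_lt.
by rewrite /idx (iindexE (al_gt0 i) kt).
Qed.

Let idx_lt i t : 0 <= t < 1 -> (idx i t < N i)%N.
Proof.
move=> /andP[t0 t1]; have [|_ /andP[it _]] := idxP i (t := t).
  by rewrite t0 ltW.
by apply: (itime_lt_inv (al_gt0 i)); rewrite al_sum; exact: le_lt_trans t1.
Qed.

Let idx_le i s t : 0 <= s -> s <= t -> t <= 1 -> (idx i s <= idx i t)%N.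
Proof.
move=> s0 st t1.
have [_ /andP[is_ _]] := @idxP i s ltac:(by rewrite s0 (le_trans st)).
have [_ /andP[_ it]] := @idxP i t ltac:(by rewrite t1 (le_trans s0)).
by rewrite -ltnS; apply: (itime_lt_inv (al_gt0 i)); apply: le_lt_trans is_ (le_lt_trans st it).
Qed.

Let idx_time i s t : 0 <= s -> s <= t -> t <= 1 ->
  `|itime (al i) (idx i t) - itime (al i) (idx i s) - (t - s)| <= mesh i.
Proof.
move=> s0 st t1.
have [_ /andP[is_ si]] := @idxP i s ltac:(by rewrite s0 (le_trans st)).
have [_ /andP[it ti]] := @idxP i t ltac:(by rewrite t1 (le_trans s0)).
move: si ti; rewrite !itimeS => si ti.
have := al_mesh i (idx i s); have := al_mesh i (idx i t) => m1 m2.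
by rewrite ler_norml; apply/andP; split; lra.
Qed.

Let x_sum i a b : (a <= b)%N -> (b <= N i)%N ->
  x i b - x i a = \sum_(a <= j < b) al i j *: q i j.
Proof.
move=> ab bN; rewrite -telescope_sumr //; apply: eq_big_nat => j /andP[_ jb].
by rewrite xS ?(leq_trans jb) // addrAC subrr add0r.
Qed.

Let itime_sum i a b : (a <= b)%N ->
  itime (al i) b - itime (al i) a = \sum_(a <= j < b) al i j.
Proof.
move=> ab; rewrite -telescope_sumr //; apply: eq_big_nat => j _.
by rewrite itimeS addrAC subrr add0r.
Qed.

Let X_lip i s t : 0 <= s -> s <= t -> t <= 1 ->
  `|X_ i t - X_ i s| <= B * (t - s + mesh i).
Proof.
move=> s0 st t1; have tN : (idx i t <= N i)%N.
  by have [] := @idxP i t ltac:(by rewrite t1 (le_trans s0)).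
have := idx_time i s0 st t1; rewrite ler_norml => /andP[_ tm].
rewrite /X_ x_sum ?idx_le //; apply: le_trans (ler_norm_sum _ _ _) _.
apply: (@le_trans _ _ (B * (itime (al i) (idx i t) - itime (al i) (idx i s)))).
  rewrite itime_sum ?idx_le // mulr_sumr; apply: ler_sum => j _.
  by rewrite normrZ gtr0_norm // mulrC ler_wpM2r // ltW.
by rewrite ler_wpM2l //; lra.
Qed.

(** In the limit of finer partitions, [Q_] becomes equicontinuous and [X_]
    has first order expansions with coefficient [Q_] at a uniform rate. *)
Let modulus e : 0 < e -> exists h I, 0 < h /\ forall i, (I <= i)%N ->
  forall s t, 0 <= s -> s <= t -> t <= 1 -> t - s <= h ->
    `|Q_ i t - Q_ i s| <= e /\
    `|X_ i t - X_ i s - (t - s) *: Q_ i s| <= e * (t - s) + mesh i * (e + B).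
Proof.
move=> e0; have [h [I [h0 hq]]] := q_slow e0.
have [I2 _ hI2] : \forall i \near \oo, mesh i <= h / 2.
  have h2 : 0 < h / 2 by rewrite divr_gt0.
  move/cvgr0Pnorm_le : mesh_cvg => /(_ _ h2); apply: filterS => i.
  exact: le_trans (ler_norm _).
exists (h / 2), (maxn I I2); split; first by rewrite divr_gt0.
move=> i; rewrite geq_max => /andP[Ii /hI2 mi] s t s0 st t1 tsh.
have tN : (idx i t <= N i)%N.
  by have [] := @idxP i t ltac:(by rewrite t1 (le_trans s0)).
have st_ := idx_le i s0 st t1.
have tm := idx_time i s0 st t1.
move: (tm); rewrite ler_norml => /andP[tm1 tm2].
split; first by apply: hq => //; lra.
have -> : X_ i t - X_ i s - (t - s) *: Q_ i s =
    \sum_(idx i s <= j < idx i t) al i j *: (q i j - Q_ i s) +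
    (itime (al i) (idx i t) - itime (al i) (idx i s) - (t - s)) *: Q_ i s.
  rewrite [in RHS]scalerBl addrA; congr (_ - _).
  rewrite /X_ x_sum // itime_sum // scaler_suml -big_split /=.
  by apply: eq_bigr => j _; rewrite scalerBr subrK.
apply: le_trans (ler_normD _ _) _.
apply: (@le_trans _ _ ((itime (al i) (idx i t) - itime (al i) (idx i s)) * e + mesh i * B)).
  apply: lerD; last by rewrite normrZ ler_pM //; exact: qB.
  apply: le_trans (ler_norm_sum _ _ _) _.
  rewrite itime_sum // mulr_suml big_nat_cond [leRHS]big_nat_cond.
  apply: ler_sum => j /andP[/andP[sj jt] _].
  rewrite normrZ gtr0_norm // ler_wpM2l //; first exact: ltW.
  apply: hq => //; first by rewrite (leq_trans (ltnW jt)).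
  have := itime_le (al_gt0 i) (ltnW jt); lra.
have le : itime (al i) (idx i t) - itime (al i) (idx i s) <= t - s + mesh i by lra.
have := ler_wpM2r (ltW e0) le; lra.
Qed.

(** The step curves converge along an ultrafilter, and uniformly, to a curve [X]
    of class C1 with derivative [Q]; conservativity applies to [X]. Since [d]
    approaches the values of [D] along [X], the discrete work is pointwise at
    most the support function in the limit, and reverse Fatou bounds its
    integral. *)
Lemma partition_chain_le e : 0 < e -> exists i,
  \sum_(k < N i) al i k * dotp (q i k) (d i k) <=
  f (x i (N i)) - f (x i 0%N) + e.
Proof.
move=> e0; have [U [UU oU]] := eventually_ultra.
have /choice[X XP] t : exists l, X_ i t @[i --> U] --> l /\ `|l| <= B.
  have [|l lC lB] := @ultra_bounded_cvg R U n (X_ ^~ t) B UU; first by move=> i; exact: xB.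
  by exists l.
have /choice[Q QP] t : exists l, Q_ i t @[i --> U] --> l /\ `|l| <= B.
  have [|l lC lB] := @ultra_bounded_cvg R U n (Q_ ^~ t) B UU; first by move=> i; exact: qB.
  by exists l.
have lim_le (u : nat -> R) a b I : u i @[i --> U] --> a ->
    (forall i, (I <= i)%N -> u i <= b) -> a <= b.
  by move=> ua ub; apply: (cvgr_to_le ua); apply: oU; exists I.
have meshU : mesh i @[i --> U] --> 0 by move=> A /mesh_cvg; exact: oU.
have XL s t : 0 <= s -> s <= t -> t <= 1 -> `|X t - X s| <= B * (t - s).
  move=> s0 st t1.
  apply: (lim_le (fun i => `|X_ i t - X_ i s| - B * mesh i) _ _ 0%N); last first.
    by move=> i _; have := X_lip i s0 st t1; rewrite mulrDr; lra.
  rewrite -[X in _ --> X]subr0; apply: cvgB.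
    by apply: cvg_norm; apply: cvgB; [exact: (XP t).1|exact: (XP s).1].
  by rewrite -(mulr0 B); apply: cvgM => //; exact: cvg_cst.
have XQ a : 0 < a -> exists2 h, 0 < h & forall s t, 0 <= s -> s <= t -> t <= 1 ->
    t - s <= h -> `|Q t - Q s| <= a /\ `|X t - X s - (t - s) *: Q s| <= a * (t - s).
  move=> /modulus[h [I [h0 hI]]]; exists h => // s t s0 st t1 tsh; split.
    apply: (lim_le (fun i => `|Q_ i t - Q_ i s|) _ _ I).
      by apply: cvg_norm; apply: cvgB; [exact: (QP t).1|exact: (QP s).1].
    by move=> i Ii; have [] := hI i Ii s t s0 st t1 tsh.
  apply: (lim_le (fun i => `|X_ i t - X_ i s - (t - s) *: Q_ i s| - mesh i * (a + B)) _ _ I).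
    rewrite -[X in _ --> X]subr0; apply: cvgB.
      apply: cvg_norm; apply: cvgB.
        by apply: cvgB; [exact: (XP t).1|exact: (XP s).1].
      by apply: cvgZr; exact: (QP s).1.
    by rewrite -(mul0r (a + B)); apply: cvgM => //; exact: cvg_cst.
  by move=> i Ii; have [_] := hI i Ii s t s0 st t1 tsh; lra.
have dX t : 0 < t < 1 -> derivable X t 1 /\ derive1 X t = Q t.
  move=> /andP[t0 t1]; apply: first_order_expansion_derive => a a0.
  have a2 : 0 < a / 2 by rewrite divr_gt0.
  have [h h0 hX] := XQ _ a2.
  exists (Num.min h (Num.min t (1 - t))); first by rewrite !lt_min h0 t0 subr_gt0.
  move=> s; rewrite !lt_min => /andP[sh /andP[st s1]].
  have [ts|st'] := leP t s.
    move: sh st s1; rewrite !ger0_norm ?subr_ge0 // => sh st s1.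
    have [_] := hX t s (ltW t0) ts ltac:(lra) (ltW sh).
    move=> /le_trans; apply; rewrite ler_wpM2r ?subr_ge0 //; lra.
  move: sh st s1; rewrite distrC !ger0_norm ?subr_ge0 ?(ltW st') // => sh st s1.
  have [Qst Xst] := hX s t ltac:(lra) (ltW st') (ltW t1) (ltW sh).
  have -> : X s - X t - (s - t) *: Q t =
      - (X t - X s - (t - s) *: Q s) + (t - s) *: (Q t - Q s).
    by apply/rowP => i; rewrite !mxE; ring.
  apply: le_trans (ler_normD _ _) _; rewrite normrN normrZ ger0_norm ?subr_ge0 ?(ltW st') //.
  have := ler_wpM2l (_ : 0 <= t - s) Qst; rewrite subr_ge0 ltW // => /(_ isT).
  lra.
have cQ : {in `]0, 1[, forall t : R, {for t, continuous Q}}.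
  move=> t; rewrite in_itv /= => /andP[t0 t1]; apply/cvgrPdist_le => a a0.
  have [h h0 hX] := XQ _ a0.
  apply/nbhs_ballP; exists (Num.min h (Num.min t (1 - t))) => /=.
    by rewrite !lt_min h0 t0 subr_gt0.
  move=> s; rewrite /ball_ /= !lt_min => /andP[sh /andP[st s1]].
  have [ts|st'] := leP t s.
    move: sh st s1; rewrite distrC !ger0_norm ?subr_ge0 // => sh st s1.
    by have [+ _] := hX t s (ltW t0) ts ltac:(lra) (ltW sh); rewrite distrC.
  move: sh st s1; rewrite !ger0_norm ?subr_ge0 ?(ltW st') // => sh st s1.
  by have [] := hX s t ltac:(lra) (ltW st') (ltW t1) (ltW sh).
(* Ultralimits are only pointwise; closeness on a finite grid and
   equicontinuity make it uniform at some late index. *)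
have unif a I : 0 < a -> exists i, (I <= i)%N /\ forall t, 0 <= t <= 1 ->
    `|X_ i t - X t| <= a /\ `|Q_ i t - Q t| <= a.
  move=> a0; have a4 : 0 < a / 4 by rewrite divr_gt0.
  have [h1 h10 hX] := XQ _ a4; have [h2 [I2 [h20 hI2]]] := modulus a4.
  pose h := Num.min h1 (Num.min h2 (a / 4 / (B + 1))).
  have B1 : 0 < B + 1 by rewrite ltr_wpDl.
  have h0 : 0 < h by rewrite !lt_min h10 h20 divr_gt0.
  have hB : B * h <= a / 4.
    have : h <= a / 4 / (B + 1) by rewrite !ge_min lexx !orbT.
    rewrite ler_pdivlMr // => le; apply: le_trans le.
    by rewrite mulrC ler_wpM2l ?(ltW h0) // lerDl.
  pose M := (Num.bound h^-1).+1.
  have M0 : 0 < M%:R :> R by rewrite ltr0n.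
  have hM : M%:R^-1 <= h.
    rewrite invf_ple ?posrE //; apply: ltW; apply: lt_trans (archi_boundP _) _.
      by rewrite invr_ge0 ltW.
    by rewrite ltr_nat.
  have [I3 _ hI3] : \forall i \near \oo, mesh i <= a / 4 / (B + 1).
    have aB : 0 < a / 4 / (B + 1) by rewrite divr_gt0.
    move/cvgr0Pnorm_le : mesh_cvg => /(_ _ aB); apply: filterS => i.
    exact: le_trans (ler_norm _).
  have grid : \forall i \near U, forall g : 'I_M.+1,
      `|X_ i (g%:R / M%:R) - X (g%:R / M%:R)| <= a / 4 /\
      `|Q_ i (g%:R / M%:R) - Q (g%:R / M%:R)| <= a / 4.
    apply: filter_forall => g.
    have /cvgrPdist_le/(_ _ a4) gX := (XP (g%:R / M%:R)).1.
    have /cvgrPdist_le/(_ _ a4) gQ := (QP (g%:R / M%:R)).1.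
    by apply: filterS (filterI gX gQ) => i []; rewrite !(distrC _ (_ i _)).
  have late : \forall i \near U, (maxn I (maxn I2 I3) <= i)%N.
    by apply: oU; exists (maxn I (maxn I2 I3)).
  have [i [gridi]] := filter_ex (filterI grid late).
  rewrite !geq_max => /andP[Ii /andP[I2i /hI3 mi]].
  exists i; split => // t /andP[t0 t1].
  have /andP[gt tg] := truncn_itv (mulr_ge0 t0 (ltW M0)).
  set g := Num.trunc _ in gt tg.
  have gM : (g < M.+1)%N.
    by rewrite ltnS -(ler_nat R); apply: le_trans gt _; rewrite ler_piMl // ltW.
  have [gX gQ] := gridi (Ordinal gM); rewrite /= in gX gQ.
  set s := g%:R / M%:R in gX gQ.
  have s0 : 0 <= s by rewrite divr_ge0 // ltW.
  have st : s <= t by rewrite ler_pdivrMr.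
  have tsh : t - s <= h.
    apply: le_trans hM; rewrite lerBlDl -[M%:R^-1]mul1r /s -mulrDl.
    by rewrite ler_pdivlMr // natr1 ltW.
  have tsB : B * (t - s) <= a / 4 by apply: le_trans hB; rewrite ler_wpM2l.
  have mB : B * mesh i <= a / 4.
    move: mi; rewrite ler_pdivlMr // => le; apply: le_trans le.
    by rewrite mulrC ler_wpM2l // lerDl.
  split.
    have -> : X_ i t - X t = (X_ i t - X_ i s) + (X_ i s - X s) - (X t - X s).
      by apply/rowP => j; rewrite !mxE; ring.
    apply: le_trans (ler_normB _ _) _; have := ler_normD (X_ i t - X_ i s) (X_ i s - X s).
    by have := X_lip i s0 st t1; have := XL s t s0 st t1; lra.
  have -> : Q_ i t - Q t = (Q_ i t - Q_ i s) + (Q_ i s - Q s) - (Q t - Q s).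
    by apply/rowP => j; rewrite !mxE; ring.
  apply: le_trans (ler_normB _ _) _; have := ler_normD (Q_ i t - Q_ i s) (Q_ i s - Q s).
  have ts1 : t - s <= h1 by apply: le_trans tsh _; rewrite ge_min lexx.
  have ts2 : t - s <= h2 by apply: le_trans tsh _; rewrite !ge_min lexx orbT.
  by have [+ _] := hI2 i I2i s t s0 st t1 ts2; have [+ _] := hX s t s0 st t1 ts1; lra.
have /choice[i_ iP] (r : nat) : exists i, (r <= i)%N /\ forall t, 0 <= t <= 1 ->
    `|X_ i t - X t| <= r.+1%:R^-1 /\ `|Q_ i t - Q t| <= r.+1%:R^-1.
  by apply: unif; rewrite invr_gt0 ltr0n.
have small c : 0 < c -> \forall r \near \oo, (r.+1%:R^-1 : R) <= c.
  move=> c0; have /cvgr0Pnorm_le/(_ _ c0) := @cvg_harmonic R.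
  by apply: filterS => r; exact: le_trans (ler_norm _).
have delr : del (i_ r) @[r --> \oo] --> 0.
  apply: (@cvg_comp _ _ _ i_ del \oo \oo) => // A [r0 _ Ar0].
  by exists r0 => // r /= r0r; apply: Ar0; apply: leq_trans r0r (iP r).1.
have [K DK] := bounded_on_balls boundedD B.
pose C := n%:R * (B * (`|K| + B)).
have CP (u v : 'rV[R]_n) : `|u| <= B -> `|v| <= `|K| + B -> `|dotp u v| <= C.
  move=> uB vK; apply: le_trans (dotp_le _ _) _; rewrite ler_wpM2l //.
  exact: ler_pM.
pose G r t := dotp (Q_ (i_ r) t) (d (i_ r) (idx (i_ r) t)).
pose phi t := support D (X t) (Q t).
have [mphi chainE] : measurable_fun (`]0, 1[%classic : set R) phi /\
    chain_integral D X = (\int[@lebesgue_measure R]_(t in `]0%R, 1%R[) (phi t)%:E)%E.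
  by apply: chain_integralE => // t _; exact: boundedD.
have phiC t : 0 < t < 1 -> `|phi t| <= C.
  move=> _; have vC v : D (X t) v -> `|dotp (Q t) v| <= C.
    move=> Dv; apply: CP; first exact: (QP t).2.
    by apply: le_trans (DK _ _ (XP t).2 Dv) _; rewrite (le_trans (ler_norm _)) // lerDl.
  rewrite ler_norml; apply/andP; split.
    have [v Dv] := D_neq0 (X t); apply: le_trans (le_support compactD _ Dv).
    by have := vC v Dv; rewrite ler_norml => /andP[].
  by apply: support_le => // v /vC; exact: le_trans (ler_norm _).
have GC r t : `|G r t| <= C.
  by apply: CP; [exact: qB|apply: le_trans (dB _ _) _; rewrite lerDr].
have mG r : measurable_fun setT (G r).
  exact: (iindex_measurable (al_gt0 (i_ r)) (fun k => dotp (q (i_ r) k) (d (i_ r) k))).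
have Gphi t : 0 < t < 1 -> forall c, 0 < c -> exists K0, forall r, (K0 <= r)%N ->
    G r t <= phi t + c.
  move=> /andP[t0 t1] c c0.
  have [|rho rho0 rhoP] := support_usc closedD (c := phi t + c) (u := Q t) (boundedD (X t)).
    move=> v Dv; rewrite dotpC; apply: le_lt_trans (le_support compactD _ Dv) _.
    by rewrite ltrDl.
  have rho2 : 0 < rho / 2 by rewrite divr_gt0.
  have : \forall r \near \oo, r.+1%:R^-1 <= rho / 2 /\ del (i_ r) <= rho / 2.
    move/cvgr0Pnorm_le : delr => /(_ _ rho2) dr.
    apply: filterS (filterI (small _ rho2) dr) => r [r1 r2]; split => //.
    exact: le_trans (ler_norm _) r2.
  move=> [K0 _ hK0]; exists K0 => r /hK0[r1 r2].
  have [] := (iP r).2 t; first by rewrite !ltW.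
  have {}r1 : r.+1%:R^-1 <= rho / 2 := r1.
  have {}r2 : del (i_ r) <= rho / 2 := r2.
  move: (r.+1%:R^-1) r1 => y r1 Xr Qr.
  rewrite /G dotpC; apply/ltW/rhoP; last by lra.
  have nd : near_field D (del (i_ r)) (X_ (i_ r) t) (d (i_ r) (idx (i_ r) t)).
    by apply: d_near; apply: idx_lt; rewrite t1 ltW.
  have [z [w [zx Dzw dw]]] := near_fieldW Xr nd.
  by exists z, w; split => //; lra.
have acX : abs_continuous_on 0 1 X.
  by apply: (@lipschitz_abs_continuous _ _ _ _ B) => s t; exact: XL.
have intphi : \int[@lebesgue_measure R]_(t in `]0, 1[) phi t = f (X 1) - f (X 0).
  have := chainD acX; rewrite chainE /Rintegral.
  case: (\int[_]_(_ in _) _)%E => [y||] //= [->].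
  by rewrite [RHS]addrC addKr.
have idx1 i : idx i 1 = N i by apply: (iindexE (al_gt0 i)); rewrite itimeS al_sum lexx ltrDl al_gt0.
have idx0 i : idx i 0 = 0%N.
  by apply: (iindexE (al_gt0 i)); rewrite itimeS itime0 lexx add0r al_gt0.
have intG r : \int[@lebesgue_measure R]_(t in `]0, 1[) G r t =
    \sum_(k < N (i_ r)) al (i_ r) k * dotp (q (i_ r) k) (d (i_ r) k).
  have cB k : `|dotp (q (i_ r) k) (d (i_ r) k)| <= C.
    by apply: CP; [exact: qB|apply: le_trans (dB _ _) _; rewrite lerDr].
  have := step_integral (al_gt0 (i_ r)) cB (i := N (i_ r)) (t := 1).
  rewrite itimeS al_sum lexx lerDl ltW // => /(_ isT).
  rewrite subrr mul0r addr0 => <-; rewrite /Rintegral; congr fine.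
  rewrite [RHS]integral_itv_bndoo //; apply/measurable_EFinP.
  exact: measurable_funTS (mG r).
have Xcvg t : 0 <= t <= 1 -> f (X_ (i_ r) t) @[r --> \oo] --> f (X t).
  move=> t01; apply: (@cvg_comp _ _ _ (fun r => X_ (i_ r) t) f \oo (nbhs (X t))) => //.
    apply: (@cvg_dominated _ _ _ _ (fun r => r.+1%:R^-1)); last exact: cvg_harmonic.
    by move=> r; have [] := (iP r).2 t t01.
  exact: contf.
have e4 : 0 < e / 4 by rewrite divr_gt0.
have /Xcvg/cvgrPdist_le/(_ _ e4)[K1 _ hK1] : 0 <= (1 : R) <= 1 by rewrite ler01 lexx.
have /Xcvg/cvgrPdist_le/(_ _ e4)[K2 _ hK2] : 0 <= (0 : R) <= 1 by rewrite ler01 lexx.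
have [r] := reverse_fatou mG GC mphi phiC Gphi (maxn K1 K2) e4.
rewrite geq_max => /andP[/hK1 r1 /hK2 r2]; rewrite intG intphi => le.
exists (i_ r); move: r1 r2; rewrite /X_ idx1 idx0 !ler_norml => /andP[r1 r1'] /andP[r2 r2'].
lra.
Qed.

End ChainRuleAlongPartitions.

(** * The chain rule on windows of bounded duration *)

Section Tails.
Context {R : realType}.

(** The bound depends on the start of a window only, as a mesh size must. *)
Lemma cvg0_tail_bound (u : nat -> R) : u k @[k --> \oo] --> 0 ->
  exists ub : nat -> R, ub i @[i --> \oo] --> 0 /\
    forall i k, (i <= k)%N -> `|u k| <= ub i.
Proof.
move=> u0; have [B uB] : exists B, forall k, `|u k| <= B.
  have /cvg_seq_bounded[B [_ hB]] : cvgn u by apply/cvg_ex; exists 0.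
  by exists (`|B| + 1) => k; apply: hB => //; rewrite (le_lt_trans (ler_norm _)) // ltrDl.
pose ub i := sup [set `|u k| | k in [set k | (i <= k)%N]].
have ubP i k : (i <= k)%N -> `|u k| <= ub i.
  move=> ik; apply: ub_le_sup; last by exists k.
  by exists B => _ [j _ <-].
exists ub; split => //; apply/cvgr0Pnorm_le => e e0.
have /cvgr0Pnorm_le/(_ _ e0)[K _ hK] := u0.
exists K => // i /= Ki; rewrite ger0_norm ?(le_trans _ (ubP i i _)) //.
apply: ge_sup; first by exists `|u i|, i => /=.
by move=> _ [k /= ik <-]; apply: hK; exact: leq_trans ik.
Qed.

Lemma cvg0_eventually_le (u : nat -> R) e : u k @[k --> \oo] --> 0 -> 0 < e ->
  exists K, forall k, (K <= k)%N -> u k <= e.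
Proof.
move=> u0 e0; have /cvgr0Pnorm_le/(_ _ e0)[K _ hK] := u0.
by exists K => k /hK; exact: le_trans (ler_norm _).
Qed.

Lemma uniformly_continuous_on_balls n (f : 'rV[R]_n -> R) (B e : R) :
  continuous f -> 0 < e ->
  exists2 r, 0 < r & forall x y, `|x| <= B -> `|y| <= B -> `|x - y| <= r ->
    `|f x - f y| <= e.
Proof.
move=> cf e0; apply: contrapT => /forall2NP H.
have /choice[p pP] i : exists p : 'rV[R]_n * 'rV[R]_n,
    [/\ `|p.1| <= B, `|p.2| <= B, `|p.1 - p.2| <= i.+1%:R^-1 & e < `|f p.1 - f p.2|].
  have i0 : 0 < i.+1%:R^-1 :> R by rewrite invr_gt0 ltr0n.
  have [/(_ i0)//|Hi] := H i.+1%:R^-1.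
  apply: contrapT => Hp; apply: Hi => x y xB yB xy.
  by rewrite leNgt; apply/negP => lt; apply: Hp; exists (x, y).
have [U [UU oU]] := eventually_ultra.
have [|l lC _] := @ultra_bounded_cvg R U n (fun i => (p i).1) B UU.
  by move=> i; have [] := pP i.
have dC : (p i).1 - (p i).2 @[i --> U] --> (0 : 'rV[R]_n).
  have pi i : `|((p i).1 - (p i).2) - 0| <= i.+1%:R^-1 by rewrite subr0; have [] := pP i.
  by move=> A /(cvg_dominated pi (@cvg_harmonic R)); exact: oU.
have lC2 : (p i).2 @[i --> U] --> l.
  rewrite -[l]subr0; rewrite [X in X i @[i --> U]](_ : _ =
    fun i => (p i).1 - ((p i).1 - (p i).2)); last first.
    by apply/funext => i; rewrite opprB addrCA subrr addr0.
  exact: cvgB.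
have fC1 : f (p i).1 @[i --> U] --> f l by apply: (@cvg_comp _ _ _ _ f U (nbhs l)) => //; exact: cf.
have fC2 : f (p i).2 @[i --> U] --> f l by apply: (@cvg_comp _ _ _ _ f U (nbhs l)) => //; exact: cf.
have : e <= `|f l - f l|.
  apply: (@cvgr_to_ge _ U _ _ (fun i => `|f (p i).1 - f (p i).2|)).
    by apply: cvg_norm; exact: cvgB.
  by apply: nearW => i; have [_ _ _ /ltW] := pP i.
by rewrite subrr normr0 leNgt e0.
Qed.

End Tails.

Section ChainRuleOnWindows.
Context {R : realType} {n : nat}.
Variable D : 'rV[R]_n -> set 'rV[R]_n.
Hypothesis closedD : closed [set p : 'rV[R]_n * 'rV[R]_n | D p.1 p.2].
Hypothesis D_neq0 : forall x, D x !=set0.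
Hypothesis compactD : forall x, compact (D x).
Hypothesis boundedD : forall x, bounded_around D x.
Variable f : 'rV[R]_n -> R.
Hypothesis contf : continuous f.
Hypothesis chainD : forall gamma, abs_continuous_on 0 1 gamma ->
    (f (gamma 1))%:E = ((f (gamma 0))%:E + chain_integral D gamma)%E.

Variables (eta : nat -> R) (x q d : nat -> 'rV[R]_n) (B : R) (del : nat -> R).
Hypothesis eta_gt0 : forall k, 0 < eta k.
Hypothesis xS : forall k, x k.+1 = x k + eta k *: q k.
Hypothesis xB : forall k, `|x k| <= B.
Hypothesis qB : forall k, `|q k| <= B.
Hypothesis dB : forall k, `|d k| <= B.
Hypothesis q_slow : forall e, 0 < e -> exists h K, [/\ 0 < h &
  forall k l, (K <= k)%N -> (k <= l)%N ->
    itime eta l - itime eta k <= h -> `|q l - q k| <= e].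
Hypothesis d_near : forall k, near_field D (del k) (x k) (d k).

Let dwork k l : R := \sum_(k <= j < l) eta j * dotp (q j) (d j).

Let B0 : 0 <= B. Proof. exact: le_trans (xB 0). Qed.

Lemma window_sum k l : (k <= l)%N ->
  itime eta l - itime eta k = \sum_(k <= j < l) eta j.
Proof.
move=> ab; rewrite -telescope_sumr //; apply: eq_big_nat => j _.
by rewrite itimeS addrAC subrr add0r.
Qed.

Lemma window_increment k l : (k <= l)%N ->
  x l - x k = \sum_(k <= j < l) eta j *: q j.
Proof.
move=> ab; rewrite -telescope_sumr //; apply: eq_big_nat => j _.
by rewrite xS addrAC subrr add0r.
Qed.

Lemma window_increment_le k l : (k <= l)%N ->
  `|x l - x k| <= B * (itime eta l - itime eta k).
Proof.
move=> kl; rewrite window_increment // window_sum // mulr_sumr.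
apply: le_trans (ler_norm_sum _ _ _) _; apply: ler_sum => j _.
by rewrite normrZ gtr0_norm // mulrC ler_wpM2r // ltW.
Qed.

(** Short windows need continuity only; this keeps the durations of the windows
    rescaled below away from [0]. *)
Let small_window e : 0 < e -> exists2 tau0, 0 < tau0 & forall k l, (k <= l)%N ->
  itime eta l - itime eta k <= tau0 ->
  `|f (x l) - f (x k) - dwork k l| <= e.
Proof.
move=> e0; have e2 : 0 < e / 2 by rewrite divr_gt0.
have [r r0 fr] := uniformly_continuous_on_balls B contf e2.
pose C := n%:R * (B * B); have C0 : 0 <= C by rewrite mulr_ge0 // mulr_ge0.
have B1 : 0 < B + 1 by rewrite ltr_wpDl.
have C1 : 0 < C + 1 by rewrite ltr_wpDl.
exists (Num.min (r / (B + 1)) (e / 2 / (C + 1))).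
  by rewrite lt_min !divr_gt0.
move=> k l kl; set tau := itime eta l - itime eta k.
have tau0 : 0 <= tau by rewrite subr_ge0 itime_le.
rewrite le_min !ler_pdivlMr // => /andP[tr te].
apply: le_trans (ler_normB _ _) _.
have : `|f (x l) - f (x k)| <= e / 2.
  apply: fr => //; apply: le_trans (window_increment_le kl) _; rewrite -/tau; lra.
have : `|dwork k l| <= C * tau.
  rewrite /tau window_sum // mulr_sumr; apply: le_trans (ler_norm_sum _ _ _) _.
  apply: ler_sum => j _; rewrite normrM gtr0_norm // mulrC ler_wpM2r //; first exact: ltW.
  by apply: le_trans (dotp_le _ _) _; rewrite ler_wpM2l // ler_pM.
lra.
Qed.

Variable etab : nat -> R.
Hypothesis etabP : forall i k, (i <= k)%N -> `|eta k| <= etab i.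
Hypothesis etab_cvg : etab i @[i --> \oo] --> 0.
Variable delb : nat -> R.
Hypothesis delbP : forall i k, (i <= k)%N -> `|del k| <= delb i.
Hypothesis delb_cvg : delb i @[i --> \oo] --> 0.

Let eta_le i k : (i <= k)%N -> eta k <= etab i.
Proof. by move=> ik; exact: le_trans (ler_norm _) (etabP ik). Qed.

Let del_le i k : (i <= k)%N -> del k <= delb i.
Proof. by move=> ik; exact: le_trans (ler_norm _) (delbP ik). Qed.

Lemma near_field_le r s z w : r <= s -> near_field D r z w -> near_field D s z w.
Proof.
move=> rs [y [a [? ? ?]]]; exists y, a; split => //; exact: le_trans rs.
Qed.

(** Late windows violating the bound, rescaled to duration [1], would contradict
    [partition_chain_le]. *)
Let window_le T e : 0 < T -> 0 < e -> exists K, forall k l,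
  (K <= k)%N -> (k <= l)%N -> itime eta l - itime eta k <= T ->
  dwork k l <= f (x l) - f (x k) + e.
Proof.
move=> T0 e0; apply: contrapT => H.
have /choice[p pP] i : exists p : nat * nat, [/\ (i <= p.1)%N, (p.1 <= p.2)%N,
    itime eta p.2 - itime eta p.1 <= T & f (x p.2) - f (x p.1) + e < dwork p.1 p.2].
  apply: contrapT => Hi; apply: H; exists i => k l ik kl kT.
  by rewrite leNgt; apply/negP => lt; apply: Hi; exists (k, l).
have [tau0 tau0_gt0 htau0] := small_window e0.
pose tau i := itime eta (p i).2 - itime eta (p i).1.
have tau_ge i : tau0 < tau i.
  have [ik kl kT lt] := pP i; rewrite ltNge; apply/negP => /(htau0 _ _ kl).
  by rewrite ler_norml => /andP[+ _]; lra.
have tau_gt0 i : 0 < tau i by exact: lt_trans (tau_ge i).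
have tauT i : tau i <= T by have [] := pP i.
pose N i := ((p i).2 - (p i).1)%N.
have kN i : ((p i).1 + N i)%N = (p i).2 by rewrite subnKC //; have [] := pP i.
pose al i j := eta ((p i).1 + j)%N / tau i.
have al_time i j : itime (al i) j = (itime eta ((p i).1 + j) - itime eta (p i).1) / tau i.
  rewrite window_sum ?leq_addr // mulr_suml -{1}[(p i).1]add0n big_addn addKn.
  by rewrite big_mkord; apply: eq_bigr => r _; rewrite addnC.
have B0T : B <= B * (1 + T) by rewrite mulrDr mulr1 lerDl mulr_ge0 // ltW.
have [|||||||||||i] := @partition_chain_le R n D closedD D_neq0 compactD boundedD
    f contf chainD N al (fun i j => x ((p i).1 + j)%N)
    (fun i j => tau i *: q ((p i).1 + j)%N) (fun i j => d ((p i).1 + j)%N)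
    (B * (1 + T)) (fun i => etab i / tau0) delb _ _ _ _ _ _ _ _ _ _ _ e e0.
- by move=> i k; exact: divr_gt0 (eta_gt0 _) (tau_gt0 _).
- by move=> i; rewrite al_time kN -/(tau i) divff // gt_eqF.
- move=> i k _; rewrite addnS xS /al scalerA -mulrA mulVf ?mulr1 //.
  by rewrite gt_eqF.
- by move=> i k; exact: le_trans (xB _) B0T.
- move=> i k; rewrite normrZ gtr0_norm //; have := tauT i.
  move=> /(ler_pM (ltW (tau_gt0 i)) (normr_ge0 _))/(_ (qB ((p i).1 + k))) le.
  by apply: le_trans le _; rewrite mulrC ler_wpM2l // lerDr.
- by move=> i k; exact: le_trans (dB _) B0T.
- move=> i k; rewrite /al ler_pM ?invr_ge0 ?(ltW (eta_gt0 _)) ?(ltW (tau_gt0 _)) //.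
    by apply: eta_le; apply: leq_trans (leq_addr _ _); have [] := pP i.
  by rewrite lef_pV2 ?posrE // ltW.
- by rewrite -(mul0r tau0^-1); apply: cvgM => //; exact: cvg_cst.
- move=> a a0; have aT : 0 < a / T by rewrite divr_gt0.
  have [h [K [h0 hq]]] := q_slow aT.
  exists (h / T), K; split; first by rewrite divr_gt0.
  move=> i j l Ki jl lN; rewrite !al_time -mulrBl opprB addrA subrK => le.
  rewrite -scalerBr normrZ gtr0_norm //.
  have : `|q ((p i).1 + l)%N - q ((p i).1 + j)%N| <= a / T.
    apply: hq; [|by rewrite leq_add2l|].
      by apply: leq_trans Ki (leq_trans _ (leq_addr _ _)); have [] := pP i.
    move: le; rewrite ler_pdivrMr // => /le_trans; apply.
    by rewrite -[leRHS]mulr1 -mulrA ler_wpM2l ?(ltW h0) // mulrC ler_pdivrMr // mul1r.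
  move=> /(ler_pM (ltW (tau_gt0 i)) (normr_ge0 _) (tauT i))/le_trans; apply.
  by rewrite mulrC divfK // gt_eqF.
- move=> i k kN'; apply: near_field_le (d_near _); apply: del_le.
  by apply: leq_trans (leq_addr _ _); have [] := pP i.
- exact: delb_cvg.
rewrite kN addn0 leNgt => /negP; apply.
have [_ _ _ /lt_le_trans] := pP i; apply; rewrite le_eqVlt; apply/orP; left; apply/eqP.
rewrite /dwork -{1}[(p i).1]add0n big_addn big_mkord; apply: eq_bigr => j _.
by rewrite addnC dotpZl /al mulrA divfK // gt_eqF.
Qed.

(** Run through backwards, a window has the opposite work; the element selected
    at the start of a step is then used at its end, which costs one more step in
    the radius of [near_field]. *)
Let window_ge T e : 0 < T -> 0 < e -> exists K, forall k l,
  (K <= k)%N -> (k <= l)%N -> itime eta l - itime eta k <= T ->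
  f (x l) - f (x k) - e <= dwork k l.
Proof.
move=> T0 e0; apply: contrapT => H.
have /choice[p pP] i : exists p : nat * nat, [/\ (i <= p.1)%N, (p.1 <= p.2)%N,
    itime eta p.2 - itime eta p.1 <= T & dwork p.1 p.2 < f (x p.2) - f (x p.1) - e].
  apply: contrapT => Hi; apply: H; exists i => k l ik kl kT.
  by rewrite leNgt; apply/negP => lt; apply: Hi; exists (k, l).
have [tau0 tau0_gt0 htau0] := small_window e0.
pose tau i := itime eta (p i).2 - itime eta (p i).1.
have tau_ge i : tau0 < tau i.
  have [ik kl kT lt] := pP i; rewrite ltNge; apply/negP => /(htau0 _ _ kl).
  by rewrite ler_norml => /andP[_]; lra.
have tau_gt0 i : 0 < tau i by exact: lt_trans (tau_ge i).
have tauT i : tau i <= T by have [] := pP i.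
pose N i := ((p i).2 - (p i).1)%N.
have kN i : ((p i).1 + N i)%N = (p i).2 by rewrite subnKC //; have [] := pP i.
pose idx i j := maxn (p i).1 ((p i).2 - j.+1)%N.
have idx_ge i j : (i <= idx i j)%N.
  by apply: leq_trans (leq_maxl _ _); have [] := pP i.
have idxS i j : (j < N i)%N -> (idx i j).+1 = ((p i).2 - j)%N.
  move=> jN; rewrite /idx -(kN i) -addnBA // (maxn_idPr _) ?leq_addr //.
  by rewrite -addnS subnSK // addnBA // ltnW.
pose al i j := eta (idx i j) / tau i.
have al_time i j : (j <= N i)%N ->
    itime (al i) j = (itime eta (p i).2 - itime eta ((p i).2 - j)) / tau i.
  elim: j => [|j IH] jN; first by rewrite itime0 subn0 subrr mul0r.
  rewrite itimeS IH ?(ltnW jN) // /al -mulrDl -(idxS _ _ jN) itimeS; congr (_ / _).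
  have -> : ((p i).2 - j.+1 = idx i j)%N by rewrite subnS -(idxS _ _ jN).
  by rewrite opprD addrA subrK.
have B0T : B <= B * (1 + T) by rewrite mulrDr mulr1 lerDl mulr_ge0 // ltW.
have [|||||||||||i] := @partition_chain_le R n D closedD D_neq0 compactD boundedD
    f contf chainD N al (fun i j => x ((p i).2 - j)%N)
    (fun i j => - tau i *: q (idx i j)) (fun i j => d (idx i j))
    (B * (1 + T)) (fun i => etab i / tau0) (fun i => delb i + B * etab i)
    _ _ _ _ _ _ _ _ _ _ _ e e0.
- by move=> i k; exact: divr_gt0 (eta_gt0 _) (tau_gt0 _).
- by move=> i; rewrite al_time // -{2}(kN i) addnK -/(tau i) divff // gt_eqF.
- move=> i k kN'; rewrite -(idxS _ _ kN') xS /al scalerA mulrN -mulrA mulVf ?gt_eqF //.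
  by rewrite mulr1 scaleNr addrK subnS -(idxS _ _ kN').
- by move=> i k; exact: le_trans (xB _) B0T.
- move=> i k; rewrite scaleNr normrN normrZ gtr0_norm //; have := tauT i.
  move=> /(ler_pM (ltW (tau_gt0 i)) (normr_ge0 _))/(_ (qB (idx i k))) le.
  by apply: le_trans le _; rewrite mulrC ler_wpM2l // lerDr.
- by move=> i k; exact: le_trans (dB _) B0T.
- move=> i k; rewrite /al ler_pM ?invr_ge0 ?(ltW (eta_gt0 _)) ?(ltW (tau_gt0 _)) //.
    exact: eta_le.
  by rewrite lef_pV2 ?posrE // ltW.
- by rewrite -(mul0r tau0^-1); apply: cvgM => //; exact: cvg_cst.
- move=> a a0; have aT : 0 < a / T by rewrite divr_gt0.
  have [h [K [h0 hq]]] := q_slow aT; have h2 : 0 < h / 2 by rewrite divr_gt0.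
  have [K2 hK2] := cvg0_eventually_le etab_cvg h2.
  exists (h / 2 / T), (maxn K K2); split; first by rewrite divr_gt0.
  move=> i j l; rewrite geq_max => /andP[Ki K2i] jl lN.
  rewrite !al_time ?(leq_trans jl) // -mulrBl opprB [X in X / _]addrC subrKA => le.
  rewrite -scalerBr normrZ normrN gtr0_norm //.
  have : `|q (idx i l) - q (idx i j)| <= a / T.
    rewrite distrC; apply: hq; first exact: leq_trans Ki (idx_ge _ _).
      by rewrite /idx geq_max leq_maxl /= leq_max leq_sub2l ?orbT.
    have jlp : ((p i).2 - l <= (p i).2 - j)%N by rewrite leq_sub2l.
    have i1 : itime eta (idx i j) <= itime eta ((p i).2 - j).
      apply: itime_le => //; rewrite /idx geq_max leq_sub2l // andbT.
      by rewrite -(kN i) -addnBA ?(leq_trans jl) // leq_addr.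
    have i2 : itime eta ((p i).2 - l) <= itime eta (idx i l) + eta (idx i l).
      rewrite -itimeS; apply: itime_le => //; rewrite /idx.
      by apply: (@leq_trans ((p i).2 - l.+1).+1); [rewrite subnS leqSpred|rewrite ltnS leq_maxr].
    have i3 := eta_le (idx_ge i l); have i4 := hK2 i K2i.
    have : (itime eta ((p i).2 - j) - itime eta ((p i).2 - l)) <= h / 2.
      move: le; rewrite ler_pdivrMr // => /le_trans; apply.
      rewrite -[leRHS](divfK (lt0r_neq0 T0)).
      by rewrite ler_wpM2l // ltW // divr_gt0.
    lra.
  move=> /(ler_pM (ltW (tau_gt0 i)) (normr_ge0 _) (tauT i))/le_trans; apply.
  by rewrite mulrC divfK // gt_eqF.
- move=> i k kN'; rewrite -(idxS _ _ kN'); set j := idx i k.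
  have xj : `|x j - x j.+1| <= B * etab i.
    rewrite xS opprD addrA subrr add0r normrN normrZ gtr0_norm // mulrC.
    by rewrite ler_pM // ?(ltW (eta_gt0 _)) // eta_le // idx_ge.
  by apply: near_fieldW xj _; apply: near_field_le (d_near _); apply: del_le; exact: idx_ge.
- rewrite -[0]addr0; apply: cvgD => //; rewrite -[0](mulr0 B); apply: cvgM => //.
  exact: cvg_cst.
rewrite subn0 -{1}(kN i) addnK leNgt => /negP; apply.
have -> : \sum_(k < N i) al i k * dotp (- tau i *: q (idx i k)) (d (idx i k)) =
    - dwork (p i).1 (p i).2.
  rewrite /dwork big_nat_rev /= -{1}[(p i).1]add0n big_addn big_mkord -sumrN.
  apply: eq_bigr => j _; rewrite dotpZl /al mulNr mulrN mulrA divfK ?gt_eqF //.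
  have -> : ((p i).1 + (p i).2 - (j + (p i).1).+1 = idx i j)%N.
    rewrite [((p i).1 + _)%N]addnC -addSn subnDr.
    by rewrite subnS -(idxS _ _ (ltn_ord j)).
  by [].
by have [_ _ _] := pP i; lra.
Qed.

(** Whichever elements of [D] are selected, their work along a slowly turning
    trajectory is the increment of [f] up to a vanishing error: this is the form
    in which conservativity reaches the algorithm. *)
Lemma window_chain_rule T e : 0 < T -> 0 < e -> exists K, forall k l,
  (K <= k)%N -> (k <= l)%N -> itime eta l - itime eta k <= T ->
  `|f (x l) - f (x k) - \sum_(k <= j < l) eta j * dotp (q j) (d j)| <= e.
Proof.
move=> T0 e0; have [K1 h1] := window_le T0 e0; have [K2 h2] := window_ge T0 e0.
exists (maxn K1 K2) => k l; rewrite geq_max => /andP[K1k K2k] kl klT.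
have := h1 k l K1k kl klT; have := h2 k l K2k kl klT; rewrite /dwork => ? ?.
by rewrite ler_norml; apply/andP; split; lra.
Qed.

End ChainRuleOnWindows.

(** * One step of the preconditioned energy *)

Section ScalarPreconditioner.
Context {R : realType}.
Variable eps : R.
Hypothesis eps_gt0 : 0 < eps.

Definition scalar_precond (a : R) : R := (Num.max a 0 + eps) `^ (- 2^-1).

Let pos_part_gt0 a : 0 < Num.max a 0 + eps.
Proof. by rewrite ltr_wpDl // le_max lexx orbT. Qed.

Lemma scalar_precond_gt0 a : 0 < scalar_precond a.
Proof. exact: powR_gt0. Qed.

Lemma scalar_precond_sqr a : scalar_precond a ^+ 2 * (Num.max a 0 + eps) = 1.
Proof.
rewrite -powR_mulrn ?powR_ge0 // -powRrM mulNr mulVf // powR_inv1 ?ltW //.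
by rewrite mulVf // gt_eqF.
Qed.

Lemma scalar_precond_le a : scalar_precond a <= eps^-1 + 1.
Proof.
set h := scalar_precond a; have h0 : 0 < h := scalar_precond_gt0 a.
have : h ^+ 2 <= eps^-1.
  rewrite -[leRHS]mul1r -(scalar_precond_sqr a) -/h -mulrA ler_peMr ?sqr_ge0 //.
  by rewrite ler_pdivlMr // mul1r lerDr le_max lexx orbT.
by rewrite expr2; nra.
Qed.

Lemma scalar_precond_ge a C : 0 <= C -> a <= C ->
  (C + eps + 1)^-1 <= scalar_precond a.
Proof.
move=> C0 aC; set h := scalar_precond a; have h0 : 0 < h := scalar_precond_gt0 a.
have c1 : 0 < C + eps + 1 by have := eps_gt0; lra.
have : 1 <= h ^+ 2 * (C + eps).
  rewrite -(scalar_precond_sqr a) -/h ler_wpM2l ?sqr_ge0 // lerD2r.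
  by rewrite ge_max aC C0.
rewrite -div1r ler_pdivrMr // expr2 => hC.
rewrite leNgt; apply/negP => lt.
have h1 : h < 1 by nra.
nra.
Qed.

Lemma scalar_precond_lipschitz a b :
  `|scalar_precond a - scalar_precond b| <= (eps^-1 + 1) ^+ 3 * `|a - b|.
Proof.
wlog ab : a b / scalar_precond b <= scalar_precond a.
  move=> H; have [|/ltW] := leP (scalar_precond b) (scalar_precond a); first exact: H.
  by rewrite distrC (distrC a); exact: H.
rewrite ger0_norm ?subr_ge0 //.
have a0 := scalar_precond_gt0 a; have b0 := scalar_precond_gt0 b.
have a1 := scalar_precond_le a; have b1 := scalar_precond_le b.
have := scalar_precond_sqr a; have := scalar_precond_sqr b.
set u := scalar_precond a in ab a0 a1 *; set w := scalar_precond b in ab b0 b1 *.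
move: (eps^-1 + 1) a1 b1 => C a1 b1.
set s := Num.max a 0; set t := Num.max b 0 => wt us.
have ts : t - s <= `|a - b|.
  rewrite /s /t; have := ler_norm (b - a); rewrite distrC.
  by have [] := leP a 0; have [] := leP b 0; have := normr_ge0 (a - b); lra.
have e1 : (u - w) * (u + w) = u ^+ 2 * w ^+ 2 * (t - s).
  have : u ^+ 2 = u ^+ 2 * (w ^+ 2 * (t + eps)) by rewrite wt mulr1.
  have : w ^+ 2 = w ^+ 2 * (u ^+ 2 * (s + eps)) by rewrite us mulr1.
  rewrite !expr2; nra.
have uw : 0 <= u - w by rewrite subr_ge0.
have y0 : 0 <= `|a - b| := normr_ge0 _.
have e2 : (u - w) * u <= u * (u * w ^+ 2 * `|a - b|).
  apply: (@le_trans _ _ ((u - w) * (u + w))); first by rewrite ler_wpM2l // lerDl ltW.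
  have -> : u * (u * w ^+ 2 * `|a - b|) = u ^+ 2 * w ^+ 2 * `|a - b| by ring.
  by rewrite e1 ler_wpM2l // mulr_ge0 // sqr_ge0.
have {e2} : u - w <= u * w ^+ 2 * `|a - b| by rewrite mulrC ler_pM2l in e2.
move=> /le_trans; apply; rewrite ler_wpM2r // exprS ler_pM ?(ltW a0) ?sqr_ge0 //.
by rewrite ler_sqr ?nnegrE ?(ltW b0) // (le_trans (ltW b0)).
Qed.

(** The update pushes [v] at most geometrically towards [0], so the inverse
    square root grows at most like [(1 - s)^(-1/2)]. *)
Lemma scalar_precond_growth a a' s : 0 <= s -> s <= 2^-1 -> (1 - s) * a <= a' ->
  scalar_precond a' <= scalar_precond a * (1 + s / 2 + s ^+ 2).
Proof.
move=> s0 s1 aa'.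
have h0 := scalar_precond_gt0 a; have h0' := scalar_precond_gt0 a'.
have := scalar_precond_sqr a; have := scalar_precond_sqr a'.
set h := scalar_precond a in h0 *; set h' := scalar_precond a' in h0' *.
set t := Num.max a 0 + eps; set t' := Num.max a' 0 + eps => ht' ht.
have t0' : 0 < t' by exact: pos_part_gt0.
have t0 : 0 < t by exact: pos_part_gt0.
have tt' : (1 - s) * t <= t'.
  rewrite /t /t' mulrDr lerD //; last by have := eps_gt0; nra.
  by rewrite le_max; have [a0|a0] := leP a 0; rewrite ?mulr0 ?lexx ?orbT // aa'.
set c := 1 + s / 2 + s ^+ 2.
have c0 : 0 < c by rewrite /c; nra.
(* [c ^+ 2 * (1 - s) = 1 + s ^+ 2 * (5 / 4 - 5 / 4 * s - s ^+ 3)]. *)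
have c1 : 1 <= c ^+ 2 * (1 - s).
  have s2 : s ^+ 2 <= 1 by rewrite expr2; nra.
  have s3 : s ^+ 3 <= s by rewrite exprS; nra.
  have : 0 <= s ^+ 2 * (5 / 4 - 5 / 4 * s - s ^+ 3) by rewrite mulr_ge0 ?sqr_ge0 //; lra.
  rewrite /c; lra.
rewrite -(@ler_pXn2r _ 2) ?nnegrE ?mulr_ge0 ?(ltW h0) ?(ltW h0') ?(ltW c0) //.
rewrite -(ler_pM2r t0') ht' exprMn -mulrA.
apply: (@le_trans _ _ (h ^+ 2 * (c ^+ 2 * ((1 - s) * t)))); last first.
  by rewrite ler_wpM2l ?sqr_ge0 // ler_wpM2l ?sqr_ge0.
have -> : h ^+ 2 * (c ^+ 2 * ((1 - s) * t)) = (h ^+ 2 * t) * (c ^+ 2 * (1 - s)) by ring.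
by rewrite ht mul1r.
Qed.

End ScalarPreconditioner.

Section EnergyStep.
Context {R : realType}.

Lemma ler_norm_mul (a b c e : R) : `|a| <= c -> `|b| <= e -> `|a * b| <= c * e.
Proof. by move=> ac be; rewrite normrM; apply: ler_pM. Qed.

(** The drift [- tau1 * P] of a coordinate of the momentum beats the growth of
    the weight [h] because [tau2 <= 4 * tau1]. With the noise [S] removed from
    [P], everything else is an error of order [kappa * eta], except the exchange
    [q * Y] with the objective and the dissipation [sigma * q^2]. *)
Lemma energy_step (tau1 tau2 sigma A : R) : 0 < tau1 -> 0 < tau2 ->
  tau2 <= 4 * tau1 -> 0 < sigma -> 1 <= A ->
  exists2 C, 0 <= C & forall kappa eta theta h h' P S Y q,
    0 <= kappa -> kappa <= 1 -> 0 <= eta -> eta <= kappa -> `|S| <= kappa ->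
    `|theta - tau1 * eta| <= kappa * eta ->
    0 <= h -> h <= A -> `|P| <= A -> `|Y| <= A -> `|q| <= A ->
    `|q + h * P| <= A * kappa ->
    h' <= h * (1 + tau2 * eta / 2 + (tau2 * eta) ^+ 2) ->
    h' * (P - S - theta * (P - Y) + sigma * eta * q) ^+ 2 - h * (P - S) ^+ 2 <=
    2 * tau1 * (eta * (- (q * Y) - sigma / tau1 * q ^+ 2)) + C * kappa * eta.
Proof.
move=> t10 t20 t21 s0 A1; have t12 : 0 <= 2 * tau1 - tau2 / 2 by lra.
pose A2 := (tau1 + 1) * (A + A) + sigma * A.
pose A3 := A + 1 + A2.
exists (2 * (tau1 * (A * A) + sigma * (A * A) + A * A * (A + A) + A * A2) +
        A * (A2 * A2) + tau2 / 2 * (A * ((1 + A2) * (A3 + A))) +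
        tau2 ^+ 2 * (A * (A3 * A3))).
  by rewrite !(addr_ge0, mulr_ge0) //; lra.
move=> k eta theta h h' P S Y q k0 k1 e0 ek Sk thk h0 hA PA YA qA qh hh'.
have [e00|e_neq0] := eqVneq eta 0.
  have t0 : theta = 0.
    by apply/eqP; move: thk; rewrite e00 !mulr0 subr0 normr_le0.
  move: hh'; rewrite e00 t0 !(mulr0, mul0r, expr0n, addr0, subr0) /= mulr1 => hh'.
  by rewrite subr_le0 ler_wpM2r ?sqr_ge0.
have ep : 0 < eta by rewrite lt_def e_neq0.
pose t := theta / eta - tau1.
have et : theta = eta * (tau1 + t) by rewrite /t addrC subrK mulrC divfK.
have tk : `|t| <= k.
  rewrite -(ler_pM2r ep) -{1}(gtr0_norm ep) -normrM.
  by rewrite mulrC /t mulrBr mulrC divfK // (mulrC eta).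
pose a := - (tau1 + t) * (P - Y) + sigma * q.
pose w := q + h * P.
have nh : `|h| <= A by rewrite ger0_norm.
have nA : 0 <= A by lra.
have nPY : `|P - Y| <= A + A by apply: le_trans (ler_normB _ _) _; exact: lerD.
have na : `|a| <= A2.
  apply: le_trans (ler_normD _ _) _; apply: lerD.
    apply: ler_norm_mul nPY; rewrite normrN; apply: le_trans (ler_normD _ _) _.
    by rewrite gtr0_norm // lerD2l (le_trans tk).
  by apply: ler_norm_mul qA; rewrite gtr0_norm.
pose p' := P - S + eta * a.
have np' : `|p'| <= A3.
  apply: le_trans (ler_normD _ _) _; apply: lerD.
    by apply: le_trans (ler_normB _ _) _; apply: lerD => //; exact: le_trans k1.
  rewrite -[leRHS]mul1r; apply: ler_norm_mul na; rewrite ger0_norm //.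
  exact: le_trans k1.
have -> : P - S - theta * (P - Y) + sigma * eta * q = p'.
  by rewrite /p' /a et; ring.
have A20 : 0 <= A2 by exact: le_trans na.
have A30 : 0 <= A3 by exact: le_trans np'.
have npP : `|p' - P| <= k * (1 + A2).
  have -> : p' - P = - S + eta * a by rewrite /p'; ring.
  apply: le_trans (ler_normD _ _) _; rewrite [leRHS]mulrDr mulr1 normrN; apply: lerD => //.
  apply: ler_norm_mul na; by rewrite ger0_norm.
have npP2 : `|p' + P| <= A3 + A by apply: le_trans (ler_normD _ _) _; exact: lerD.
have E1 : h' * p' ^+ 2 <= h * (1 + tau2 * eta / 2 + (tau2 * eta) ^+ 2) * p' ^+ 2.
  by rewrite ler_wpM2r // sqr_ge0.
have b1 := ler_norm_mul qh YA.
have b2 := ler_norm_mul qh qA.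
have b3 := ler_norm_mul (ler_norm_mul nh PA) (ler_norm_mul tk nPY).
have b4 := ler_norm_mul nh (ler_norm_mul Sk na).
have b5 := ler_norm_mul nh (ler_norm_mul na na).
have b6 := ler_norm_mul nh (ler_norm_mul npP npP2).
have b7 := ler_norm_mul nh (ler_norm_mul np' np').
have hP : 0 <= (2 * tau1 - tau2 / 2) * (h * P ^+ 2).
  exact: mulr_ge0 t12 (mulr_ge0 h0 (sqr_ge0 _)).
(* The exact expansion: the exchange and dissipation terms, a square whose
   coefficient [2 * tau1 - tau2 / 2] is nonnegative, and a remainder each term
   of which has a factor of size [kappa]. *)
have id : h * (1 + tau2 * eta / 2 + (tau2 * eta) ^+ 2) * p' ^+ 2 - h * (P - S) ^+ 2 =
   2 * tau1 * (eta * (- (q * Y) - sigma / tau1 * q ^+ 2))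
   - eta * ((2 * tau1 - tau2 / 2) * (h * P ^+ 2))
   + eta * (2 * (tau1 * ((q + h * P) * Y) + sigma * ((q + h * P) * q)
             - h * P * (t * (P - Y)) - h * (S * a))
      + eta * (h * (a * a))
      + tau2 / 2 * (h * ((p' - P) * (p' + P)))
      + tau2 ^+ 2 * eta * (h * (p' * p'))).
  by rewrite /p' /a; field; rewrite gt_eqF.
apply: le_trans (_ : _ <= h * (1 + tau2 * eta / 2 + (tau2 * eta) ^+ 2) * p' ^+ 2 - h * (P - S) ^+ 2) _.
  by rewrite lerD2r.
rewrite id; have := mulr_ge0 e0 hP; set hp := eta * (_ * _) => hp0.
rewrite -[_ * k * eta]mulrC.
suff : 2 * (tau1 * ((q + h * P) * Y) + sigma * ((q + h * P) * q)
             - h * P * (t * (P - Y)) - h * (S * a))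
      + eta * (h * (a * a))
      + tau2 / 2 * (h * ((p' - P) * (p' + P)))
      + tau2 ^+ 2 * eta * (h * (p' * p')) <=
   (2 * (tau1 * (A * A) + sigma * (A * A) + A * A * (A + A) + A * A2) +
        A * (A2 * A2) + tau2 / 2 * (A * ((1 + A2) * (A3 + A))) +
        tau2 ^+ 2 * (A * (A3 * A3))) * k.
  move=> /(ler_wpM2l e0) le; move: le hp0; set X := eta * (_ + _); set Z := eta * (_ * k).
  set V := 2 * tau1 * _; lra.
have c1 : tau1 * ((q + h * P) * Y) <= tau1 * (A * k * A).
  by rewrite ler_wpM2l ?(ltW t10) // (le_trans (ler_norm _)).
have c2 : sigma * ((q + h * P) * q) <= sigma * (A * k * A).
  by rewrite ler_wpM2l ?(ltW s0) // (le_trans (ler_norm _)).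
have c3 : - (h * P * (t * (P - Y))) <= A * A * (k * (A + A)).
  by apply: le_trans b3; rewrite -normrN ler_norm.
have c4 : - (h * (S * a)) <= A * (k * A2) by apply: le_trans b4; rewrite -normrN ler_norm.
have c5 : eta * (h * (a * a)) <= k * (A * (A2 * A2)).
  apply: le_trans (ler_norm _) _; apply: ler_norm_mul b5; by rewrite ger0_norm.
have c6 : tau2 / 2 * (h * ((p' - P) * (p' + P))) <= tau2 / 2 * (A * (k * (1 + A2) * (A3 + A))).
  by rewrite ler_wpM2l ?divr_ge0 ?(ltW t20) // (le_trans (ler_norm _)).
have c7 : tau2 ^+ 2 * eta * (h * (p' * p')) <= tau2 ^+ 2 * k * (A * (A3 * A3)).
  apply: le_trans (ler_norm _) _; apply: ler_norm_mul b7.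
  have t22 : 0 <= tau2 ^+ 2 := sqr_ge0 _.
  by rewrite ger0_norm; [exact: ler_wpM2l|exact: mulr_ge0].
rewrite (_ : _ * k =
    2 * (tau1 * (A * k * A) + sigma * (A * k * A) + A * A * (k * (A + A)) +
         A * (k * A2)) + k * (A * (A2 * A2)) +
    tau2 / 2 * (A * (k * (1 + A2) * (A3 + A))) + tau2 ^+ 2 * k * (A * (A3 * A3)));
  last by ring.
apply: lerD c7; apply: lerD c6; apply: lerD c5; apply: ler_wpM2l => //.
exact: lerD (lerD (lerD c1 c2) c3) c4.
Qed.

End EnergyStep.

(** * The Lyapunov function along windows *)

Section LyapunovWindows.
Context {R : realType} {n : nat}.
Variables (sigma eps tau1 tau2 B : R) (eta theta : nat -> R).
Variables (x m v d xi w : nat -> 'rV[R]_n) (f : 'rV[R]_n -> R).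
Hypotheses (sigma_gt0 : 0 < sigma) (eps_gt0 : 0 < eps) (tau1_gt0 : 0 < tau1)
  (tau2_gt0 : 0 < tau2) (tau21 : tau2 <= 4 * tau1).
Hypotheses (eta_gt0 : forall k, 0 < eta k) (theta_gt0 : forall k, 0 < theta k).
Hypothesis eta_cvg : eta k @[k --> \oo] --> 0.
Hypothesis ratio_cvg : theta k / eta k @[k --> \oo] --> tau1.
Hypothesis mS : forall k,
  m k.+1 = (1 - theta k) *: m k + theta k *: (d k + xi k).
Hypothesis xS : forall k, x k.+1 = x k -
  eta k *: hadamard (preconditioner eps (v k.+1)) (m k.+1 + sigma *: x k).
Hypothesis vS : forall k, v k.+1 = v k - (tau2 * eta k) *: (v k - w k).
Hypothesis w_ge0 : forall k i, 0 <= w k 0 i.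
Hypotheses (xB : forall k, `|x k| <= B) (mB : forall k, `|m k| <= B)
  (dB : forall k, `|d k| <= B) (xiB : forall k, `|xi k| <= B)
  (wB : forall k, `|w k| <= B) (vB : forall k, `|v k| <= B).
Hypothesis noise : forall T e, 0 < T -> 0 < e -> exists K, forall k l,
  (K <= k)%N -> (k <= l)%N -> itime eta l - itime eta k <= T ->
  `|\sum_(k <= j < l) theta j *: xi j| <= e.

Definition velocity k : 'rV[R]_n :=
  - hadamard (preconditioner eps (v k.+1)) (m k.+1 + sigma *: x k).
Local Notation q := velocity.
Local Notation h k i := (scalar_precond eps (v k 0 i)).
Let p k := m k + sigma *: x k.

(** The regularized objective plus the energy of [m + sigma x] in the metric of
    the preconditioner. *)
Definition lyapunov k : R := f (x k) + sigma / 2 * dotp (x k) (x k) +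
  (2 * tau1)^-1 * \sum_(i < n) h k i * (p k 0 i) ^+ 2.

Let B0 : 0 <= B. Proof. exact: le_trans (xB 0). Qed.

Let Hm := eps^-1 + 1.
Let Hm_gt0 : 0 < Hm. Proof. by rewrite ltr_wpDl // invr_ge0 ltW. Qed.

Lemma velocity_coord k i :
  q k 0 i = - (h k.+1 i * (m k.+1 0 i + sigma * x k 0 i)).
Proof. by rewrite /velocity !mxE. Qed.

Lemma step_velocity k : x k.+1 = x k + eta k *: q k.
Proof. by rewrite xS /velocity scalerN. Qed.

Let h_le k i : `|h k i| <= Hm.
Proof. by rewrite gtr0_norm ?scalar_precond_gt0 // scalar_precond_le. Qed.

Let x_coord k i : `|x k 0 i| <= B. Proof. exact: le_trans (coord_le_norm _ _) (xB k). Qed.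
Let m_coord k i : `|m k 0 i| <= B. Proof. exact: le_trans (coord_le_norm _ _) (mB k). Qed.

Let mx_coord k l i : `|m k 0 i + sigma * x l 0 i| <= (1 + sigma) * B.
Proof.
apply: le_trans (ler_normD _ _) _; rewrite mulrDl mul1r; apply: lerD => //.
by apply: ler_norm_mul; [rewrite gtr0_norm|exact: x_coord].
Qed.

Let sB0 : 0 <= (1 + sigma) * B.
Proof. by rewrite mulr_ge0 // addr_ge0 // ltW. Qed.

Lemma velocity_bound k : `|q k| <= Hm * ((1 + sigma) * B).
Proof.
apply: norm_le_coord => [|i]; first by rewrite mulr_ge0 // ltW.
by rewrite velocity_coord normrN; exact: ler_norm_mul.
Qed.

Lemma theta_eta_eventually kappa : 0 < kappa -> exists K, forall k, (K <= k)%N ->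
  `|theta k - tau1 * eta k| <= kappa * eta k.
Proof.
move=> k0; have /cvgrPdist_le/(_ _ k0)[K _ hK] := ratio_cvg.
exists K => k /hK; rewrite distrC => le.
have e0 := eta_gt0 k; have en0 : eta k != 0 by rewrite gt_eqF.
have -> : theta k - tau1 * eta k = (theta k / eta k - tau1) * eta k.
  by rewrite mulrBl divfK.
by rewrite normrM (gtr0_norm e0) ler_wpM2r // ltW.
Qed.

Lemma theta_le_eventually : exists K, forall k, (K <= k)%N ->
  theta k <= (tau1 + 1) * eta k.
Proof.
have [K hK] := theta_eta_eventually ltr01.
by exists K => k /hK; rewrite ler_norml => /andP[_]; lra.
Qed.

Let eta_small e : 0 < e -> exists K, forall k, (K <= k)%N -> eta k <= e.
Proof. by move=> e0; exact: cvg0_eventually_le eta_cvg e0. Qed.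

Lemma window_variation_le (u : nat -> 'rV[R]_n) C K :
  (forall j, (K <= j)%N -> `|u j.+1 - u j| <= C * eta j) ->
  forall k l, (K <= k)%N -> (k <= l)%N ->
    `|u l - u k| <= C * (itime eta l - itime eta k).
Proof.
move=> uC k l Kk kl; rewrite window_sum // mulr_sumr -telescope_sumr //.
apply: le_trans (ler_norm_sum _ _ _) _.
rewrite big_nat_cond [leRHS]big_nat_cond; apply: ler_sum => j /andP[/andP[kj _] _].
by apply: uC; exact: leq_trans kj.
Qed.

Let v_step j : `|v j.+1 - v j| <= tau2 * (B + B) * eta j.
Proof.
rewrite vS addrAC subrr add0r normrN normrZ gtr0_norm ?mulr_gt0 //.
rewrite [leRHS]mulrAC; apply: ler_wpM2l; first by rewrite ltW // mulr_gt0.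
by apply: le_trans (ler_normB _ _) _; exact: lerD.
Qed.

Lemma momentum_step j : `|m j.+1 - m j| <= (B + B + B) * theta j.
Proof.
have -> : m j.+1 - m j = theta j *: (d j + xi j - m j).
  by rewrite mS; apply/rowP => i; rewrite !mxE; ring.
rewrite normrZ gtr0_norm // mulrC ler_wpM2r ?(ltW (theta_gt0 j)) //.
apply: le_trans (ler_normB _ _) _; apply: lerD => //.
by apply: le_trans (ler_normD _ _) _; exact: lerD.
Qed.

(** Up to the noise, the momentum moves at bounded speed; the noise accumulated
    over a window is small. *)
Lemma momentum_slow e : 0 < e -> exists t K, 0 < t /\
  forall k l, (K <= k)%N -> (k <= l)%N -> itime eta l - itime eta k <= t ->
    `|m l - m k| <= e.
Proof.
move=> e0; have e2 : 0 < e / 2 by rewrite divr_gt0.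
pose C := (B + B) * (tau1 + 1); have C0 : 0 <= C.
  by rewrite mulr_ge0 ?addr_ge0 // ltW.
have C1 : 0 < C + 1 by rewrite ltr_wpDl.
have [K1 h1] := theta_le_eventually.
have [K2 h2] := noise ltr01 e2.
exists (Num.min 1 (e / 2 / (C + 1))), (maxn K1 K2).
split; first by rewrite lt_min ltr01 divr_gt0.
move=> k l; rewrite geq_max => /andP[K1k K2k] kl.
rewrite le_min ler_pdivlMr // => /andP[t1 te].
have -> : m l - m k = (m l - \sum_(k <= j < l) theta j *: xi j - m k) +
    \sum_(k <= j < l) theta j *: xi j by rewrite addrAC subrK.
apply: le_trans (ler_normD _ _) _.
have t0 : 0 <= itime eta l - itime eta k by rewrite subr_ge0 itime_le.
have := h2 k l K2k kl t1.
suff : `|m l - \sum_(k <= j < l) theta j *: xi j - m k| <= C * (itime eta l - itime eta k).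
  by lra.
have uC j : (k <= j)%N -> `|(m j.+1 - \sum_(k <= r < j.+1) theta r *: xi r) -
    (m j - \sum_(k <= r < j) theta r *: xi r)| <= C * eta j.
  move=> kj; have -> : (m j.+1 - \sum_(k <= r < j.+1) theta r *: xi r) -
    (m j - \sum_(k <= r < j) theta r *: xi r) = theta j *: (d j - m j).
    by rewrite big_nat_recr //= mS; apply/rowP => i; rewrite !mxE; ring.
  rewrite normrZ gtr0_norm // /C -mulrA mulrC; apply: ler_pM => //.
  - exact: ltW.
  - by apply: le_trans (ler_normB _ _) _; exact: lerD.
  - by apply: h1; exact: leq_trans kj.
have := window_variation_le uC (leqnn k) kl.
by rewrite (big_geq (leqnn k)) subr0.
Qed.

(** The velocity is a Lipschitz function of [m], [x] and [v], each of which
    moves slowly. *)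
Lemma velocity_slow e : 0 < e -> exists t K, [/\ 0 < t &
  forall k l, (K <= k)%N -> (k <= l)%N -> itime eta l - itime eta k <= t ->
    `|q l - q k| <= e].
Proof.
move=> e0.
pose C1 := Hm ^+ 3 * (tau2 * (B + B)) * ((1 + sigma) * B).
pose C2 := Hm * (sigma * (Hm * ((1 + sigma) * B))).
have Hm0 := ltW Hm_gt0; have s0 := ltW sigma_gt0; have t20 := ltW tau2_gt0.
have C10 : 0 <= C1.
  by apply: mulr_ge0 sB0; rewrite mulr_ge0 ?exprn_ge0 // mulr_ge0 // addr_ge0.
have C20 : 0 <= C2 by do 3 (apply: mulr_ge0 => //).
have em : 0 < e / 3 / Hm by rewrite !divr_gt0.
have [t1 [K1 [t10 h1]]] := momentum_slow em.
pose C3 := C1 + C2 + 1; have C30 : 0 < C3 by rewrite /C3; lra.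
pose t := Num.min t1 (e / 3 / C3).
have t0 : 0 < t by rewrite lt_min t10 !divr_gt0.
have t2 : 0 < t / 2 by rewrite divr_gt0.
have [K2 h2] := eta_small t2.
exists (t / 2), (maxn K1 K2); split => // k l; rewrite geq_max => /andP[K1k K2k] kl tkl.
have tS : itime eta l.+1 - itime eta k.+1 <= t.
  rewrite !itimeS; have := h2 l (leq_trans K2k kl); have := eta_gt0 k; lra.
have tS1 : itime eta l.+1 - itime eta k.+1 <= t1 by apply: le_trans tS _; rewrite ge_min lexx.
have tk : itime eta l - itime eta k <= t by lra.
have tC : t * C3 <= e / 3 by rewrite -ler_pdivlMr // ge_min lexx orbT.
have mk := h1 k.+1 l.+1 (leq_trans K1k (leqnSn k)) kl tS1.
have vk := window_variation_le (fun j _ => v_step j) (leq0n k.+1) (kl : (k.+1 <= l.+1)%N).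
have xk : `|x l - x k| <= Hm * ((1 + sigma) * B) * (itime eta l - itime eta k).
  apply: (window_variation_le _ (leq0n k) kl) => j _.
  rewrite step_velocity addrAC subrr add0r normrZ gtr0_norm // mulrC.
  by rewrite ler_wpM2r ?(ltW (eta_gt0 j)) // velocity_bound.
apply: norm_le_coord => [|i]; first exact: ltW.
rewrite !mxE -!/(scalar_precond _ _).
set a := h l.+1 i; set b := h k.+1 i.
set y := m l.+1 0 i + sigma * x l 0 i; set z := m k.+1 0 i + sigma * x k 0 i.
have -> : - (a * y) - - (b * z) = - ((a - b) * y) - b * (y - z) by ring.
have ab : `|a - b| <= Hm ^+ 3 * (tau2 * (B + B) * t).
  apply: le_trans (scalar_precond_lipschitz eps_gt0 _ _) _.
  rewrite ler_wpM2l ?exprn_ge0 ?(ltW Hm_gt0) //.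
  have := coord_le_norm (v l.+1 - v k.+1) i; rewrite !mxE => /le_trans; apply.
  apply: le_trans vk _; rewrite ler_wpM2l // mulr_ge0 ?(ltW tau2_gt0) //; exact: addr_ge0.
have yz : `|y - z| <= e / 3 / Hm + sigma * (Hm * ((1 + sigma) * B) * t).
  have -> : y - z = (m l.+1 0 i - m k.+1 0 i) + sigma * (x l 0 i - x k 0 i).
    by rewrite /y /z; ring.
  apply: le_trans (ler_normD _ _) _; apply: lerD.
    by have := coord_le_norm (m l.+1 - m k.+1) i; rewrite !mxE => /le_trans; apply.
  apply: ler_norm_mul; first by rewrite gtr0_norm.
  have := coord_le_norm (x l - x k) i; rewrite !mxE => /le_trans; apply.
  by apply: le_trans xk _; rewrite ler_wpM2l // mulr_ge0 // ltW.
have n1 := ler_norm_mul ab (mx_coord l.+1 l i).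
have n2 := ler_norm_mul (h_le k.+1 i) yz.
apply: le_trans (ler_normB _ _) _; rewrite normrN.
apply: le_trans (lerD n1 n2) _.
have -> : Hm ^+ 3 * (tau2 * (B + B) * t) * ((1 + sigma) * B) = t * C1.
  by rewrite /C1; ring.
have -> : Hm * (e / 3 / Hm + sigma * (Hm * ((1 + sigma) * B) * t)) = e / 3 + t * C2.
  by rewrite /C2; field; rewrite gt_eqF.
move: tC; rewrite /C3 !mulrDr mulr1; move: (t * C1) (t * C2) => c1 c2; lra.
Qed.

(** The preconditioner is bounded away from [0] because [v] is bounded. *)
Lemma momentum_velocity_bound e : 0 < e -> exists K, forall k, (K <= k)%N ->
  `|m k + sigma *: x k| <= (B + eps + 1) * `|q k| + e.
Proof.
move=> e0; have [K1 h1] := theta_le_eventually.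
pose C := (B + B + B) * (tau1 + 1).
have C0 : 0 <= C by rewrite mulr_ge0 ?addr_ge0 // ltW.
have C1 : 0 < C + 1 by rewrite ltr_wpDl.
have eC : 0 < e / (C + 1) by rewrite divr_gt0.
have [K2 h2] := eta_small eC.
have B1 : 0 < B + eps + 1 by rewrite addr_gt0 // ltr_wpDl.
exists (maxn K1 K2) => k; rewrite geq_max => /andP[K1k K2k].
apply: norm_le_coord => [|i].
  by rewrite addr_ge0 ?(ltW e0) // mulr_ge0 // ltW.
have hk := scalar_precond_gt0 eps_gt0 (v k.+1 0 i).
have -> : (m k + sigma *: x k) 0 i = - (q k 0 i / h k.+1 i) - (m k.+1 - m k) 0 i.
  by rewrite velocity_coord !mxE; field; rewrite gt_eqF.
apply: le_trans (ler_normB _ _) _; rewrite normrN; apply: lerD.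
  rewrite mulrC; apply: ler_norm_mul; last exact: coord_le_norm.
  rewrite gtr0_norm ?invr_gt0 // -[leRHS]invrK lef_pV2 ?posrE ?invr_gt0 //.
  apply: scalar_precond_ge => //.
  exact: le_trans (ler_norm _) (le_trans (coord_le_norm _ _) (vB _)).
apply: le_trans (coord_le_norm _ _) (le_trans (momentum_step k) _).
have th := ler_wpM2l (_ : 0 <= B + B + B) (h1 k K1k).
apply: le_trans (th _) _; first by rewrite !addr_ge0.
rewrite mulrA -/C; have := h2 k K2k; rewrite ler_pdivlMr // => le; apply: le_trans le.
by rewrite mulrC ler_wpM2l ?(ltW (eta_gt0 k)) // lerDl.
Qed.

Lemma momentum_window_noise T e : 0 < T -> 0 < e -> exists K, forall k l,
  (K <= k)%N -> (k <= l)%N -> itime eta l - itime eta k <= T ->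
  `|m l - m k - \sum_(k <= j < l) theta j *: (d j - m j)| <= e.
Proof.
move=> T0 e0; have [K hK] := noise T0 e0; exists K => k l Kk kl kT.
have -> : m l - m k - \sum_(k <= j < l) theta j *: (d j - m j) =
    \sum_(k <= j < l) theta j *: xi j; last exact: hK.
rewrite -telescope_sumr // -sumrB; apply: eq_bigr => j _.
by rewrite mS; apply/rowP => i; rewrite !mxE; ring.
Qed.

Lemma lyapunov_objective k :
  `|lyapunov k - (f (x k) + sigma / 2 * dotp (x k) (x k))| <=
  (2 * tau1)^-1 * (n%:R * (Hm * ((1 + sigma) * B))) * `|m k + sigma *: x k|.
Proof.
have t2 : 0 < (2 * tau1)^-1 by rewrite invr_gt0 mulr_gt0.
rewrite /lyapunov addrAC subrr add0r normrM (gtr0_norm t2) -[leRHS]mulrA.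
apply: ler_wpM2l; first exact: ltW.
apply: le_trans (ler_norm_sum _ _ _) _; rewrite -2!mulrA.
have -> : n%:R * (Hm * ((1 + sigma) * B * `|m k + sigma *: x k|)) =
    \sum_(i < n) Hm * ((1 + sigma) * B * `|m k + sigma *: x k|).
  by rewrite sumr_const card_ord -[RHS]mulr_natl.
apply: ler_sum => i _; apply: ler_norm_mul => //; rewrite expr2.
by apply: ler_norm_mul; [rewrite /p !mxE mx_coord|exact: coord_le_norm].
Qed.

Hypothesis chain_rule : forall T e, 0 < T -> 0 < e -> exists K, forall k l,
  (K <= k)%N -> (k <= l)%N -> itime eta l - itime eta k <= T ->
  `|f (x l) - f (x k) - \sum_(k <= j < l) eta j * dotp (q j) (d j)| <= e.

Let Aq := Hm ^+ 3 * (tau2 * (B + B)) * ((1 + sigma) * B) +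
  Hm * ((B + B + B) * (tau1 + 1)).
Let A := 1 + Hm + (1 + sigma) * B + Hm * ((1 + sigma) * B) + Aq.

Let Aq0 : 0 <= Aq.
Proof.
have Hm0 := ltW Hm_gt0; have t20 := ltW tau2_gt0; have t10 := ltW tau1_gt0.
apply: addr_ge0; first by apply: mulr_ge0 sB0; rewrite mulr_ge0 ?exprn_ge0 // mulr_ge0 // addr_ge0.
by rewrite mulr_ge0 // mulr_ge0 // !addr_ge0.
Qed.

Let HsB0 : 0 <= Hm * ((1 + sigma) * B).
Proof. by apply: mulr_ge0 sB0; exact: ltW. Qed.

Let A_bounds : [/\ 1 <= A, Hm <= A, (1 + sigma) * B <= A,
  Hm * ((1 + sigma) * B) <= A & Aq <= A].
Proof.
rewrite /A; have := Hm_gt0; have := Aq0; have := HsB0; have := sB0.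
move: Aq Hm ((1 + sigma) * B) => a b c; move: (b * c) => bc.
by split; lra.
Qed.

(** The velocity is computed from the updated [m] and [v], the energy from the
    current ones; a single step changes them by a multiple of [eta k]. *)
Lemma velocity_momentum k kappa i : eta k <= kappa ->
  theta k <= (tau1 + 1) * eta k ->
  `|q k 0 i + h k i * p k 0 i| <= A * kappa.
Proof.
move=> ek tk; have e0 := eta_gt0 k.
have -> : q k 0 i + h k i * p k 0 i =
    (h k i - h k.+1 i) * p k 0 i - h k.+1 i * (m k.+1 0 i - m k 0 i).
  by rewrite velocity_coord /p !mxE; ring.
have hh : `|h k i - h k.+1 i| <= Hm ^+ 3 * (tau2 * (B + B) * eta k).
  apply: le_trans (scalar_precond_lipschitz eps_gt0 _ _) _.
  rewrite ler_wpM2l ?exprn_ge0 ?(ltW Hm_gt0) // distrC.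
  have := coord_le_norm (v k.+1 - v k) i; rewrite !mxE => /le_trans; apply.
  exact: v_step.
have mm : `|m k.+1 0 i - m k 0 i| <= (B + B + B) * ((tau1 + 1) * eta k).
  have := coord_le_norm (m k.+1 - m k) i; rewrite !mxE => /le_trans; apply.
  apply: le_trans (momentum_step k) _; rewrite ler_wpM2l // !addr_ge0 //.
have pk : `|p k 0 i| <= (1 + sigma) * B by rewrite /p !mxE mx_coord.
apply: le_trans (ler_normB _ _) _.
apply: le_trans (lerD (ler_norm_mul hh pk) (ler_norm_mul (h_le k.+1 i) mm)) _.
have -> : Hm ^+ 3 * (tau2 * (B + B) * eta k) * ((1 + sigma) * B) +
    Hm * ((B + B + B) * ((tau1 + 1) * eta k)) = Aq * eta k by rewrite /Aq; ring.
by have [_ _ _ _ AA] := A_bounds; apply: ler_pM => //; exact: ltW.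
Qed.

(** Sum [energy_step] with the noise accumulated since the beginning of the
    window, [S], subtracted from the momentum: the exchange terms [q * Y] cancel
    against the work of [d] on [f] and the change of [sigma / 2 * |x|^2]. *)
Lemma lyapunov_window T e : 0 < T -> 0 < e -> exists K, forall k l,
  (K <= k)%N -> (k <= l)%N -> itime eta l - itime eta k <= T ->
  lyapunov l - lyapunov k <=
    - (sigma / tau1 * \sum_(k <= j < l) eta j * dotp (q j) (q j)) + e.
Proof.
move=> T0 e0; have [A1 AH As Aqq _] := A_bounds.
have [C C0 stepC] := energy_step tau1_gt0 tau2_gt0 tau21 sigma_gt0 A1.
have A0 : 0 <= A by exact: le_trans A1.
pose C5 := sigma / 2 * (n%:R * (A * A)) + (2 * tau1)^-1 * (n%:R * C).
pose C6 := (2 * tau1)^-1 * (n%:R * (2 * (A * A))).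
have t2 : 0 < (2 * tau1)^-1 by rewrite invr_gt0 mulr_gt0.
have s2 : 0 < sigma / 2 by rewrite divr_gt0.
have C50 : 0 <= C5.
  by rewrite addr_ge0 // mulr_ge0 ?(ltW s2) ?(ltW t2) // mulr_ge0 // mulr_ge0.
have C60 : 0 <= C6 by rewrite mulr_ge0 ?(ltW t2) // mulr_ge0 // mulr_ge0 // mulr_ge0.
pose C7 := C5 * T + C6 + 1.
have C70 : 0 < C7 by rewrite ltr_wpDl // addr_ge0 // mulr_ge0 // ltW.
pose kappa := Num.min (Num.min 1 (2 * tau2)^-1) (e / 2 / C7).
have k0 : 0 < kappa by rewrite !lt_min ltr01 !divr_gt0 // invr_gt0 mulr_gt0.
have k1 : kappa <= 1 by rewrite !ge_min lexx.
have k2 : tau2 * kappa <= 2^-1.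
  have : kappa <= (2 * tau2)^-1 by rewrite !ge_min lexx orbT.
  rewrite -div1r ler_pdivlMr ?mulr_gt0 // => le.
  by rewrite -[2^-1]mul1r ler_pdivlMr //; lra.
have k3 : kappa * C7 <= e / 2 by rewrite -ler_pdivlMr // !ge_min lexx !orbT.
have [K1 h1] := theta_eta_eventually k0.
have [K2 h2] := theta_le_eventually.
have [K3 h3] := eta_small k0.
have [K4 h4] := noise T0 k0.
have e4 : 0 < e / 2 by rewrite divr_gt0.
have [K5 h5] := chain_rule T0 e4.
exists (maxn K1 (maxn K2 (maxn K3 (maxn K4 K5)))) => k l.
rewrite !geq_max => /and5P[K1k K2k K3k K4k K5k] kl tkl.
pose S j := \sum_(k <= r < j) theta r *: xi r.
have SS j : (k <= j)%N -> S j.+1 = S j + theta j *: xi j.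
  by move=> kj; rewrite /S big_nat_recr.
pose E j := \sum_(i < n) h j i * (p j 0 i - S j 0 i) ^+ 2.
pose Y j := d j + sigma *: x j.
have Sk j i : (k <= j)%N -> (j <= l)%N -> `|S j 0 i| <= kappa.
  move=> kj jl; apply: le_trans (coord_le_norm _ _) _; apply: h4 => //.
  apply: le_trans tkl; rewrite lerD2r; exact: itime_le.
have dd j i : `|d j 0 i| <= B by exact: le_trans (coord_le_norm _ _) (dB j).
have stepE j : (k <= j)%N -> (j < l)%N -> E j.+1 - E j <=
    2 * tau1 * (eta j * (- dotp (q j) (Y j) - sigma / tau1 * dotp (q j) (q j))) +
    n%:R * C * kappa * eta j.
  move=> kj jl; rewrite /E -sumrB.
  have -> : 2 * tau1 * (eta j * (- dotp (q j) (Y j) - sigma / tau1 * dotp (q j) (q j))) +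
      n%:R * C * kappa * eta j =
      \sum_(i < n) (2 * tau1 * (eta j * (- (q j 0 i * Y j 0 i) - sigma / tau1 * q j 0 i ^+ 2)) +
        C * kappa * eta j).
    rewrite big_split /=; congr (_ + _).
      rewrite -mulr_sumr -mulr_sumr sumrB sumrN -mulr_sumr.
      by congr (_ * (_ * (_ - _ * _))); apply: eq_bigr => i _; rewrite expr2.
    by rewrite sumr_const card_ord -[RHS]mulr_natl !mulrA.
  apply: ler_sum => i _.
  have -> : p j.+1 0 i - S j.+1 0 i = p j 0 i - S j 0 i -
      theta j * (p j 0 i - Y j 0 i) + sigma * eta j * q j 0 i.
    by rewrite SS // /p /Y step_velocity mS !mxE; ring.
  apply: stepC => //.
  - exact: ltW.
  - exact: ltW.
  - by apply: h3; exact: leq_trans kj.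
  - exact: Sk (ltnW jl).
  - by apply: h1; exact: leq_trans kj.
  - exact/ltW/scalar_precond_gt0.
  - by apply: le_trans (scalar_precond_le eps_gt0 _) AH.
  - by apply: le_trans As; rewrite /p !mxE mx_coord.
  - apply: le_trans As; rewrite /Y !mxE; apply: le_trans (ler_normD _ _) _.
    rewrite mulrDl mul1r; apply: lerD => //.
    by apply: ler_norm_mul; [rewrite gtr0_norm|exact: x_coord].
  - by apply: le_trans Aqq; apply: le_trans (coord_le_norm _ _) (velocity_bound j).
  - apply: velocity_momentum; first by apply: h3; exact: leq_trans kj.
    by apply: h2; exact: leq_trans kj.
  - have tj : 0 <= tau2 * eta j by rewrite mulr_ge0 // ltW.
    apply: (scalar_precond_growth eps_gt0 tj).
      apply: le_trans k2; rewrite ler_wpM2l ?(ltW tau2_gt0) // h3 //.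
      exact: leq_trans kj.
    rewrite vS !mxE; have := mulr_ge0 tj (w_ge0 j i); lra.
pose G j := sigma / 2 * dotp (x j) (x j) + (2 * tau1)^-1 * E j.
have stepG j : (k <= j)%N -> (j < l)%N -> G j.+1 - G j <=
    - (eta j * dotp (q j) (d j)) - sigma / tau1 * (eta j * dotp (q j) (q j)) +
    C5 * kappa * eta j.
  move=> kj jl; have sE := ler_wpM2l (ltW t2) (stepE j kj jl).
  have qq : dotp (q j) (q j) <= n%:R * (A * A).
    apply: le_trans (ler_norm _) (le_trans (dotp_le _ _) _).
    by rewrite ler_wpM2l // ler_pM // (le_trans (velocity_bound j)).
  have ee : eta j * (eta j * dotp (q j) (q j)) <= eta j * (kappa * (n%:R * (A * A))).
    rewrite ler_wpM2l ?(ltW (eta_gt0 j)) // ler_pM ?(ltW (eta_gt0 j)) ?dotp_ge0 //.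
    by apply: h3; exact: leq_trans kj.
  have sx := ler_wpM2l (ltW s2) ee.
  have xx : dotp (x j.+1) (x j.+1) - dotp (x j) (x j) =
      2 * (eta j * dotp (q j) (x j)) + eta j * (eta j * dotp (q j) (q j)).
    rewrite step_velocity !dotpDl !dotpDr !dotpZl !dotpZr (dotpC (x j) (q j)); ring.
  have -> : G j.+1 - G j = sigma / 2 * (dotp (x j.+1) (x j.+1) - dotp (x j) (x j)) +
      (2 * tau1)^-1 * (E j.+1 - E j) by rewrite /G; ring.
  rewrite xx mulrDr; apply: le_trans (lerD (lerD (lexx _) sx) sE) _.
  rewrite le_eqVlt; apply/orP; left; apply/eqP.
  by rewrite /C5 /Y dotpDr dotpZr; field; rewrite gt_eqF.
have sumG : G l - G k <= - (\sum_(k <= j < l) eta j * dotp (q j) (d j)) -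
    sigma / tau1 * (\sum_(k <= j < l) eta j * dotp (q j) (q j)) +
    C5 * kappa * (itime eta l - itime eta k).
  rewrite -telescope_sumr // window_sum // !mulr_sumr -sumrN -sumrB -big_split /=.
  rewrite big_nat_cond [leRHS]big_nat_cond; apply: ler_sum => j /andP[/andP[kj jl] _].
  exact: stepG.
have LG : lyapunov k = f (x k) + G k.
  rewrite /lyapunov /G -addrA; congr (_ + (_ + _ * _)); apply: eq_bigr => i _.
  by rewrite /S big_geq // [X in _ - X]mxE subr0.
have LGl : lyapunov l <= f (x l) + G l + C6 * kappa.
  rewrite /lyapunov /G -!addrA lerD2l lerD2l /C6 -mulrA -mulrDr ler_wpM2l ?(ltW t2) //.
  rewrite -lerBlDl /E -sumrB.
  have -> : n%:R * (2 * (A * A)) * kappa = \sum_(i < n) (2 * (A * A)) * kappa.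
    by rewrite sumr_const card_ord -[RHS]mulr_natl !mulrA.
  apply: ler_sum => i _; set P := p l 0 i; set s := S l 0 i.
  have -> : h l i * P ^+ 2 - h l i * (P - s) ^+ 2 =
      2 * (h l i * P * s) - h l i * s ^+ 2 by ring.
  have hs : 0 <= h l i * s ^+ 2 by rewrite mulr_ge0 ?sqr_ge0 ?(ltW (scalar_precond_gt0 eps_gt0 _)).
  have PA : `|P| <= A by apply: le_trans As; rewrite /P /p !mxE mx_coord.
  have hA := le_trans (h_le l i) AH.
  have := ler_norm_mul (ler_norm_mul hA PA) (Sk l i kl (leqnn l)).
  rewrite -/s => /(le_trans (ler_norm _)) le; lra.
have := h5 k l K5k kl tkl; rewrite ler_norml => /andP[_ hf].
have t0 : 0 <= itime eta l - itime eta k by rewrite subr_ge0 itime_le.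
have kT : C5 * kappa * (itime eta l - itime eta k) <= C5 * kappa * T.
  by rewrite ler_wpM2l // mulr_ge0 // ltW.
rewrite /C7 in k3; rewrite LG.
move: (\sum_(k <= j < l) eta j * dotp (q j) (d j)) hf sumG => W1.
move: (sigma / tau1 * _) => W2 hf sumG.
have := k0; lra.
Qed.

End LyapunovWindows.

(** * Descent, upcrossings and vanishing velocity *)

Section LyapunovDescent.
Context {R : realType} {n : nat}.
Variable D : 'rV[R]_n -> set 'rV[R]_n.
Hypothesis closedD : closed [set p : 'rV[R]_n * 'rV[R]_n | D p.1 p.2].
Hypothesis D_neq0 : forall x, D x !=set0.
Hypothesis compactD : forall x, compact (D x).
Hypothesis convexD : convex_valued D.
Hypothesis boundedD : forall x, bounded_around D x.
Variables (sigma tau1 B c G CE : R) (eta theta L : nat -> R).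
Variables (x q m d : nat -> 'rV[R]_n) (g : 'rV[R]_n -> R) (del : nat -> R).
Hypotheses (sigma_gt0 : 0 < sigma) (tau1_gt0 : 0 < tau1) (c_gt0 : 0 < c)
  (G_ge0 : 0 <= G) (CE_ge0 : 0 <= CE).
Hypothesis eta_gt0 : forall k, 0 < eta k.
Hypothesis eta_cvg : eta k @[k --> \oo] --> 0.
Hypothesis eta_sum : forall M, exists k, M <= itime eta k.
Hypothesis theta_eta : exists K, forall k, (K <= k)%N ->
  tau1 / 2 * eta k <= theta k <= (tau1 + 1) * eta k.
Hypothesis xS : forall k, x k.+1 = x k + eta k *: q k.
Hypotheses (xB : forall k, `|x k| <= B) (mB : forall k, `|m k| <= B).
Hypothesis q_slow : forall e, 0 < e -> exists t K, [/\ 0 < t &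
  forall k l, (K <= k)%N -> (k <= l)%N -> itime eta l - itime eta k <= t ->
    `|q l - q k| <= e].
Hypothesis momentum_velocity : forall e, 0 < e -> exists K, forall k, (K <= k)%N ->
  `|m k + sigma *: x k| <= G * `|q k| + e.
Hypothesis momentum_window : forall T e, 0 < T -> 0 < e -> exists K, forall k l,
  (K <= k)%N -> (k <= l)%N -> itime eta l - itime eta k <= T ->
  `|m l - m k - \sum_(k <= j < l) theta j *: (d j - m j)| <= e.
Hypothesis L_window : forall T e, 0 < T -> 0 < e -> exists K, forall k l,
  (K <= k)%N -> (k <= l)%N -> itime eta l - itime eta k <= T ->
  L l - L k <= - (c * \sum_(k <= j < l) eta j * dotp (q j) (q j)) + e.
Hypothesis L_g : forall k, `|L k - g (x k)| <= CE * `|m k + sigma *: x k|.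
Hypothesis L_bounded : exists M, forall k, `|L k| <= M.
Hypothesis contg : continuous g.
Hypothesis d_near : forall k, near_field D (del k) (x k) (d k).
Hypothesis del_cvg : del k @[k --> \oo] --> 0.

Let critical z := regularized_field sigma D z 0.
Hypothesis critical_values : [set g z | z in critical]° = set0.

Local Notation time := (itime eta).

Lemma first_index_after k T : 0 < T -> exists l, [/\ (k < l)%N,
  T <= time l - time k & forall j, (k <= j)%N -> (j < l)%N -> time j - time k < T].
Proof.
move=> T0; have [l0 hl0] := eta_sum (time k + T).
have exl : exists l, T <= time l - time k by exists l0; rewrite lerBrDl.
exists (ex_minn exl); case: ex_minnP => l Tl lmin; split => //.
  by apply: (itime_lt_inv eta_gt0); rewrite -subr_gt0; exact: lt_le_trans Tl.
by move=> j _ jl; rewrite ltNge; apply/negP => /lmin; rewrite leqNgt jl.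
Qed.

Let eta_small e : 0 < e -> exists K, forall k, (K <= k)%N -> eta k <= e.
Proof. by move=> e0; exact: cvg0_eventually_le eta_cvg e0. Qed.

Let sqnorm_le_dotp (u : 'rV[R]_n) : `|u| ^+ 2 <= dotp u u.
Proof. by rewrite -enorm_sq ler_sqr ?nnegrE ?enorm_ge0 // norm_le_enorm. Qed.

Lemma window_sum_ge0 k l : 0 <= \sum_(k <= j < l) eta j * dotp (q j) (q j).
Proof. by apply: sumr_ge0 => j _; rewrite mulr_ge0 ?dotp_ge0 // ltW. Qed.

(** A velocity of length [r] persists for a while, and dissipates. *)
Lemma fast_descent T r : 1 <= T -> 0 < r -> exists c' K, 0 < c' /\
  forall k l, (K <= k)%N -> (k <= l)%N -> 1 <= time l - time k ->
    time l - time k <= T -> r <= `|q k| -> L l <= L k - c'.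
Proof.
move=> T1 r0; have r2 : 0 < r / 2 by rewrite divr_gt0.
have [t [K1 [t0 h1]]] := q_slow r2.
pose s := Num.min t 1; have s0 : 0 < s by rewrite lt_min t0 ltr01.
pose c1 := c * (s * (r / 2) ^+ 2); have c10 : 0 < c1 by rewrite !mulr_gt0 // exprn_gt0.
have c12 : 0 < c1 / 2 by rewrite divr_gt0.
have [K2 h2] := L_window (lt_le_trans ltr01 T1) c12.
exists (c1 / 2), (maxn K1 K2); split => // k l; rewrite geq_max => /andP[K1k K2k].
move=> kl tkl1 tklT rk.
have [j1 [kj1 tj1 j1min]] := first_index_after k s0.
have j1l : (j1 <= l)%N.
  rewrite leqNgt; apply/negP => lj1; have := j1min l kl lj1.
  by rewrite ltNge (le_trans _ tkl1) // ge_min lexx orbT.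
have : c1 <= c * \sum_(k <= j < l) eta j * dotp (q j) (q j).
  rewrite /c1 ler_pM2l // (big_cat_nat (ltnW kj1) j1l) /=.
  rewrite -[leLHS]addr0; apply: lerD; last exact: window_sum_ge0.
  apply: (@le_trans _ _ ((time j1 - time k) * (r / 2) ^+ 2)).
    by rewrite ler_wpM2r // sqr_ge0.
  rewrite window_sum; last exact: ltnW.
  rewrite mulr_suml [leLHS]big_nat_cond [leRHS]big_nat_cond.
  apply: ler_sum => j /andP[/andP[kj jj1] _]; rewrite ler_wpM2l ?(ltW (eta_gt0 j)) //.
  apply: le_trans (sqnorm_le_dotp _); rewrite ler_sqr ?nnegrE ?(ltW r2) //.
  have tj : time j - time k <= t.
    by apply/ltW/(lt_le_trans (j1min j kj jj1)); rewrite ge_min lexx.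
  have := h1 k j K1k kj tj; have := lerB_dist (q k) (q j).
  by rewrite (distrC (q k)); lra.
have := h2 k l K2k kl tklT; lra.
Qed.

(** If [L] hardly decreased on a long window starting near a point [z] that is
    not critical, the state would hardly move, and the momentum, driven by
    elements of [D] near [z], would drift without bound in the direction
    separating [regularized_field sigma D z] from [0]. *)
Lemma noncritical_descent z : ~ critical z -> exists T r c' K,
  [/\ 1 <= T, 0 < r, 0 < c' & forall k l, (K <= k)%N -> (k <= l)%N ->
    T <= time l - time k -> time l - time k <= T + 1 -> `|x k - z| <= r ->
    L l <= L k - c'].
Proof.
move=> ncz; pose A := regularized_field sigma D z.
have A0 : A !=set0 by have [w Dw] := D_neq0 z; exists (w + sigma *: z), w.
have cA : compact A.
  apply: continuous_compact; last exact: compactD.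
  apply: continuous_subspaceT => w.
  exact: (@cvgD _ _ _ (nbhs w) _ id (fun=> sigma *: z) w (sigma *: z) (@cvg_id _ _) (cvg_cst _)).
have convA : convex_set (A : set (convex_lmodType 'rV[R]_n)).
  move=> _ _ t /set_mem[u Du <-] /set_mem[v Dv <-]; apply/mem_set.
  have Duv := set_mem (@convexD z u v t (mem_set Du) (mem_set Dv)).
  eexists; first exact: Duv.
  rewrite /conv /= !scalerDr addrACA -scalerDl.
  by rewrite unstable.add_onemK scale1r.
have [a Aa amin] := min_norm_element A0 cA convA.
have a_gt0 : 0 < `|a|.
  by rewrite normr_gt0; apply: contra_notN ncz => /eqP a0; rewrite /critical -a0.
pose rho := dotp a a.
have rho_gt0 : 0 < rho by apply: lt_le_trans (sqnorm_le_dotp a); rewrite exprn_gt0.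
have [|r1 r1_gt0 r1D] := support_usc closedD (c := sigma * dotp z a - 3 / 4 * rho)
    (u := - a) (boundedD z).
  move=> w Dw; have : rho <= dotp (w + sigma *: z) a by apply: amin; exists w.
  by rewrite dotpNr dotpDl dotpZl; lra.
pose na := n%:R * `|a|.
have na0 : 0 <= na by rewrite mulr_ge0.
have dota u : `|dotp u a| <= na * `|u| by apply: le_trans (dotp_le _ _) _; rewrite /na mulrAC mulrA.
have sna1 : 0 < sigma * na + 1 by rewrite ltr_wpDl // mulr_ge0 // ltW.
pose r := Num.min (r1 / 2) (rho / 4 / (sigma * na + 1)).
have r0 : 0 < r by rewrite lt_min !divr_gt0.
have rr1 : r <= r1 / 2 by rewrite ge_min lexx.
have rrho : sigma * (na * r) <= rho / 4.
  have : r <= rho / 4 / (sigma * na + 1) by rewrite ge_min lexx orbT.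
  by rewrite ler_pdivlMr // => le; apply: le_trans le; have := r0; lra.
have r12 : 0 < r1 / 2 by rewrite divr_gt0.
have [K0 h0] := cvg0_eventually_le del_cvg r12.
have da k : (K0 <= k)%N -> `|x k - z| <= r -> rho / 2 <= dotp (d k + sigma *: x k) a.
  move=> K0k xz.
  have nf : near_field D r1 z (d k).
    apply: near_field_le (near_fieldW xz (d_near k)).
    by have := h0 k K0k; lra.
  have := r1D _ (- a) nf; rewrite subrr normr0 dotpNr => /(_ (ltW r1_gt0)).
  have zx : `|sigma * dotp (x k - z) a| <= rho / 4.
    apply: le_trans rrho; rewrite normrM gtr0_norm // ler_wpM2l ?(ltW sigma_gt0) //.
    by apply: le_trans (dota _) _; rewrite ler_wpM2l.
  move: zx; rewrite dotpBl dotpDl dotpZl ler_norml => /andP[+ _]; lra.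
pose T := Num.max 1 ((2 * B * na + 2 * na + 1) * 4 / (tau1 * rho)).
have T1 : 1 <= T by rewrite le_max lexx.
have tr0 : 0 < tau1 * rho by rewrite mulr_gt0.
have Trho : 2 * B * na + 2 * na + 1 <= tau1 / 2 * T * (rho / 2).
  have : (2 * B * na + 2 * na + 1) * 4 / (tau1 * rho) <= T by rewrite le_max lexx orbT.
  rewrite ler_pdivrMr //; lra.
have T10 : 0 < T + 1 by lra.
have T20 : 0 < T + 2 by lra.
have G1 : 0 < G + 1 by rewrite ltr_wpDl.
have t11 : 0 < tau1 + 1 by rewrite addr_gt0.
pose e1 := (2 * (tau1 + 1) * (T + 1))^-1.
have e10 : 0 < e1 by rewrite invr_gt0 !mulr_gt0.
have e1P : (tau1 + 1) * (e1 * (T + 1)) = 1 / 2.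
  by rewrite /e1; field; rewrite gt_eqF //= gt_eqF // addr_gt0.
pose kap := Num.min (r / 2 / (T + 2)) (2 * (tau1 + 1) * (T + 2) * (G + 1))^-1.
have kap0 : 0 < kap.
  by rewrite lt_min !divr_gt0 // invr_gt0 !mulr_gt0.
have kapr : kap * (T + 2) <= r / 2 by rewrite -ler_pdivlMr // ge_min lexx.
have kapG : (tau1 + 1) * (G * (kap * (T + 2))) <= 1 / 2.
  have : kap <= (2 * (tau1 + 1) * (T + 2) * (G + 1))^-1 by rewrite ge_min lexx orbT.
  rewrite -div1r ler_pdivlMr; last by rewrite !mulr_gt0.
  have : 0 <= kap * ((tau1 + 1) * (T + 2)) by rewrite ltW // !mulr_gt0.
  lra.
pose c0 := kap ^+ 2; have c00 : 0 < c0 by rewrite exprn_gt0.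
have cc : 0 < c * c0 / 2 by rewrite divr_gt0 // mulr_gt0.
have [K1 h1] := L_window T10 cc.
have [K2 h2] := momentum_velocity e10.
have [K3 h3] := momentum_window T10 ltr01.
have [K4 h4] := theta_eta.
exists T, (r / 2), (c * c0 / 2), (maxn K0 (maxn K1 (maxn K2 (maxn K3 K4)))).
split => //; first by rewrite divr_gt0.
move=> k l; rewrite !geq_max => /and5P[K0k K1k K2k K3k K4k] kl Tkl tkl xkz.
suff : c0 <= \sum_(k <= j < l) eta j * dotp (q j) (q j).
  by move=> /(ler_wpM2l (ltW c_gt0)); have := h1 k l K1k kl tkl; lra.
rewrite leNgt; apply/negP => small.
have tsum : \sum_(k <= j < l) eta j = time l - time k by rewrite window_sum.
have sumq j : (k <= j)%N -> (j <= l)%N ->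
    \sum_(k <= i < j) eta i * `|q i| <= kap * (T + 2).
  move=> kj jl; apply: (@le_trans _ _ (\sum_(k <= i < l) eta i * `|q i|)).
    rewrite (big_cat_nat kj jl) /= lerDl; apply: sumr_ge0 => i _.
    by rewrite mulr_ge0 // ltW.
  apply: (@le_trans _ _ (\sum_(k <= i < l) (kap * eta i + (eta i * dotp (q i) (q i)) / kap))).
    apply: ler_sum => i _.
    have key : `|q i| <= kap + dotp (q i) (q i) / kap.
      rewrite -(ler_pM2r kap0) mulrDl divfK ?gt_eqF //.
      have := sqnorm_le_dotp (q i); rewrite expr2.
      move: (dotp _ _) `|q i| (kap) => D0 y kp le.
      have : 0 <= (y - kp) * (y - kp) by rewrite -expr2 sqr_ge0.
      have : 0 <= y * y by rewrite -expr2 sqr_ge0.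
      have : 0 <= kp * kp by rewrite -expr2 sqr_ge0.
      lra.
    apply: le_trans (ler_wpM2l (ltW (eta_gt0 i)) key) _.
    by rewrite mulrDr mulrA (mulrC (eta i) kap).
  rewrite big_split /= -mulr_sumr -mulr_suml tsum.
  have : \sum_(k <= i < l) eta i * dotp (q i) (q i) / kap <= kap.
    by rewrite -mulr_suml ler_pdivrMr // -expr2 ltW.
  rewrite -mulr_suml; have := ler_wpM2l (ltW kap0) tkl; lra.
have xz j : (k <= j)%N -> (j <= l)%N -> `|x j - z| <= r.
  move=> kj jl; rewrite -(subrK (x k) (x j)) -addrA.
  apply: le_trans (ler_normD _ _) _; rewrite (splitr r) lerD //.
  apply: le_trans kapr; apply: le_trans (sumq j kj jl).
  rewrite (window_increment xS) //; apply: le_trans (ler_norm_sum _ _ _) _.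
  by apply: ler_sum => i _; rewrite normrZ gtr0_norm.
have drift : tau1 / 2 * T * (rho / 2) - na <=
    dotp (\sum_(k <= j < l) theta j *: (d j - m j)) a.
  rewrite dotp_suml.
  apply: (@le_trans _ _ (\sum_(k <= j < l) (tau1 / 2 * eta j * (rho / 2) -
      (tau1 + 1) * na * (G * (eta j * `|q j|) + e1 * eta j)))).
    rewrite sumrB -mulr_suml -mulr_sumr -!mulr_sumr big_split /= -!mulr_sumr tsum.
    apply: lerB.
      rewrite ler_wpM2r ?divr_ge0 ?(ltW rho_gt0) // ler_wpM2l // divr_ge0 // ltW //.
    have := sumq l kl (leqnn l); set s := \sum_(k <= i < l) _ => sq.
    have t10 : 0 <= tau1 + 1 by rewrite addr_ge0 // ltW.
    have b1 := ler_wpM2l t10 (ler_wpM2l G_ge0 sq).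
    have b2 := ler_wpM2l t10 (ler_wpM2l (ltW e10) tkl).
    have b3 : (tau1 + 1) * (G * s) + (tau1 + 1) * (e1 * (time l - time k)) <= 1 by lra.
    have := ler_wpM2l na0 b3; move: (time l - time k) => tt; lra.
  rewrite [leLHS]big_nat_cond [leRHS]big_nat_cond; apply: ler_sum => j /andP[/andP[kj jl] _].
  rewrite dotpZl.
  have -> : d j - m j = (d j + sigma *: x j) - (m j + sigma *: x j).
    by rewrite opprD addrACA subrr addr0.
  rewrite dotpBl mulrBr.
  have /andP[th1 th2] := h4 j (leq_trans K4k kj).
  have et := eta_gt0 j.
  have th0 : 0 <= theta j by apply: le_trans th1; rewrite mulr_ge0 ?divr_ge0 ?(ltW et) // ltW.
  apply: lerB.
    apply: ler_pM => //; first by rewrite mulr_ge0 ?divr_ge0 ?(ltW et) // ltW.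
      by rewrite divr_ge0 // ltW.
    by apply: da; [exact: leq_trans kj|exact: xz (ltnW jl)].
  have pa : dotp (m j + sigma *: x j) a <= na * (G * `|q j| + e1).
    apply: le_trans (ler_norm _) (le_trans (dota _) _).
    by rewrite ler_wpM2l // h2 // (leq_trans K2k).
  apply: (@le_trans _ _ (theta j * (na * (G * `|q j| + e1)))); first by rewrite ler_wpM2l.
  apply: (@le_trans _ _ ((tau1 + 1) * eta j * (na * (G * `|q j| + e1)))); last by lra.
  by rewrite ler_wpM2r // mulr_ge0 // addr_ge0 ?mulr_ge0 // ltW.
have mm : `|dotp (m l - m k) a| <= na * (B + B).
  apply: le_trans (dota _) _; rewrite ler_wpM2l //.
  by apply: le_trans (ler_normB _ _) _; exact: lerD.
have ns : `|dotp (m l - m k - \sum_(k <= j < l) theta j *: (d j - m j)) a| <= na * 1.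
  by apply: le_trans (dota _) _; rewrite ler_wpM2l // h3.
rewrite dotpBl mulr1 in ns.
move: (dotp (m l - m k) a) (dotp (\sum_(k <= j < l) _) a) mm ns drift => y1 y2.
rewrite !ler_norml => /andP[_ mm] /andP[ns _] drift; lra.
Qed.

Let L_growth T e : 0 < T -> 0 < e -> exists K, forall k l,
  (K <= k)%N -> (k <= l)%N -> time l - time k <= T -> L l - L k <= e.
Proof.
move=> T0 e0; have [K hK] := L_window T0 e0; exists K => k l Kk kl kT.
apply: le_trans (hK k l Kk kl kT) _; rewrite gerDr oppr_le0.
by apply: mulr_ge0 (window_sum_ge0 _ _); exact: ltW.
Qed.

Lemma noncritical_value_between u w : u < w ->
  exists a, [/\ u < a, a < w & forall z, critical z -> g z != a].
Proof.
move=> uw; apply: contrapT => H.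
suff : [set g z | z in critical]° ((u + w) / 2) by rewrite critical_values.
have : \forall a \near ((u + w) / 2), `]u, w[%classic a.
  apply: open_nbhs_nbhs; split; first exact: interval_open.
  by rewrite /= in_itv /=; apply/andP; split; lra.
apply: filterS => a; rewrite /= in_itv /= => /andP[ua aw].
apply: contrapT => na; apply: H; exists a; split => // z cz.
by apply/eqP => ga; apply: na; exists z.
Qed.

(** Take for [s] the step after the last passage below [a]: a single late step
    raises [L] by little. *)
Lemma upcrossing_start a b N : a < b ->
  (forall N, exists2 k, (N <= k)%N & L k < a) ->
  (forall N, exists2 k, (N <= k)%N & b <= L k) ->
  exists s l, [/\ (N <= s)%N, (s <= l)%N, L s < a + N.+1%:R^-1, b <= L l &
    forall j, (s <= j)%N -> (j <= l)%N -> a <= L j].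
Proof.
move=> ab La Lb; have N0 : 0 < N.+1%:R^-1 :> R by rewrite invr_gt0 ltr0n.
have [K1 h1] := L_growth ltr01 N0.
have [K2 h2] := eta_small ltr01.
have [k kK Lk] := La (maxn N (maxn K1 K2)).
have [l kl Ll] := Lb k.
pose P j := (j <= l)%N && (L j < a).
have exP : exists j, P j by exists k; rewrite /P kl Lk.
have [j /andP[jl Lj] jmax] := ex_maxnP exP (fun j Pj => proj1 (andP Pj)).
have kj : (k <= j)%N by apply: jmax; rewrite /P kl Lk.
move: (leq_trans kK kj); rewrite !geq_max => /and3P[Nj K1j K2j].
have jl' : (j < l)%N.
  by rewrite ltn_neqAle jl andbT; apply: contraTneq Lj => ->; rewrite -leNgt (le_trans (ltW ab)).
exists j.+1, l; split => //; first exact: leqW.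
  have := h1 j j.+1 K1j (leqnSn j); rewrite itimeS [X in X <= 1 -> _]addrC addKr.
  by move=> /(_ (h2 j K2j)); move: (N.+1%:R^-1) => y; lra.
move=> i ji il; rewrite leNgt; apply/negP => Li.
by have := jmax i; rewrite /P il Li => /(_ isT); rewrite leqNgt ji.
Qed.

(** Late upcrossings of a level [a] that is not a critical value start from
    states that are either fast or close to a point that is not critical; the
    Lyapunov function then falls below [a] before it can reach [b]. *)
Lemma no_upcrossing a b : a < b -> (forall z, critical z -> g z != a) ->
  (forall N, exists2 k, (N <= k)%N & L k < a) ->
  (forall N, exists2 k, (N <= k)%N & b <= L k) -> False.
Proof.
move=> ab nca La Lb.
have /choice[s sP] N := upcrossing_start N ab La Lb.
have [U [UU oU]] := eventually_ultra.
have [|z zC _] := @ultra_bounded_cvg R U n (fun i => x (s i)) B UU.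
  by move=> i; exact: xB.
have s_ge i : (i <= s i)%N by have [l []] := sP i.
have as_ i : a <= L (s i).
  by have [l [_ sl _ _ Lj]] := sP i; exact: Lj.
have descent : exists T c' K, [/\ 1 <= T, 0 < c' &
    \forall i \near U, (K <= s i)%N -> forall l, (s i <= l)%N ->
      T <= time l - time (s i) -> time l - time (s i) <= T + 1 ->
      L l <= L (s i) - c'].
  have [cz|] := pselect (critical z); last first.
    move=> /noncritical_descent[T [r [c' [K [T1 r0 c'0 H]]]]]; exists T, c', K; split => //.
    have /cvgrPdist_le/(_ _ r0) := zC; apply: filterS => i xz Ki l sl t1 t2.
    by apply: H => //; rewrite distrC.
  pose rho := `|g z - a|.
  have rho0 : 0 < rho by rewrite normr_gt0 subr_eq0 nca.
  have rho4 : 0 < rho / 4 by rewrite divr_gt0.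
  have gz : \forall i \near U, `|g z - g (x (s i))| <= rho / 4.
    have gC : g (x (s i)) @[i --> U] --> g z.
      by apply: (@cvg_comp _ _ _ (fun i => x (s i)) g U (nbhs z)) => //; exact: contg.
    by move/cvgrPdist_le : gC; exact.
  have CE1 : 0 < CE + 1 by rewrite ltr_wpDl.
  have G1 : 0 < G + 1 by rewrite ltr_wpDl.
  pose r := rho / 4 / (CE + 1) / (G + 1).
  have r0 : 0 < r by rewrite !divr_gt0.
  have rP : CE * (G * r + r) <= rho / 4.
    have -> : G * r + r = rho / 4 / (CE + 1).
      by rewrite -[X in _ + X]mul1r -mulrDl mulrC /r divfK // gt_eqF.
    rewrite mulrCA -[leRHS]mulr1 ler_wpM2l ?(ltW rho4) //.
    by rewrite ler_pdivrMr // mul1r lerDl.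
  have [K1 h1] := momentum_velocity r0.
  have two1 : 1 <= 2 :> R by rewrite ler1n.
  have [c' [K2 [c'0 h2]]] := fast_descent two1 r0.
  exists 1, c', (maxn K1 K2); split => //.
  have small : \forall i \near U, (i.+1%:R^-1 : R) <= rho / 4.
    have /cvgr0Pnorm_le/(_ _ rho4) := @cvg_harmonic R => H; apply: oU.
    by apply: filterS H => i; exact: le_trans (ler_norm _).
  apply: filterS (filterI gz small) => i [gi ei]; rewrite geq_max => /andP[K1i K2i].
  move=> l sl t1 t2; apply: (h2 _ _ K2i sl t1); first by rewrite -[2]/(1 + 1).
  rewrite leNgt; apply/negP => qr.
  have pr : CE * `|m (s i) + sigma *: x (s i)| <= rho / 4.
    apply: le_trans rP; rewrite ler_wpM2l //; apply: le_trans (h1 _ K1i) _.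
    by rewrite lerD2r ler_wpM2l // ltW.
  have Lg := le_trans (L_g (s i)) pr.
  have [l' [_ _ La' _ _]] := sP i; have := as_ i => La0.
  have : rho <= 3 * (rho / 4).
    rewrite {1}/rho.
    have -> : g z - a = (g z - g (x (s i))) - (L (s i) - g (x (s i))) + (L (s i) - a) by ring.
    apply: le_trans (ler_normD _ _) _.
    have := ler_normB (g z - g (x (s i))) (L (s i) - g (x (s i))).
    have : `|L (s i) - a| <= rho / 4.
      rewrite ger0_norm ?subr_ge0 // lerBlDl; apply: le_trans (ltW La') _.
      by rewrite lerD2l; exact: ei.
    lra.
  by move: rho0; lra.
have [T [c' [K [T1 c'0 H]]]] := descent.
have T10 : 0 < T + 1 by lra.
have b3 : 0 < (b - a) / 3 by rewrite divr_gt0 // subr_gt0.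
have [K1 h1] := L_growth T10 b3.
have [K2 h2] := eta_small ltr01.
pose e := Num.min (c' / 2) ((b - a) / 3).
have e0 : 0 < e by rewrite lt_min divr_gt0.
have small : \forall i \near U, (i.+1%:R^-1 : R) <= e.
  have /cvgr0Pnorm_le/(_ _ e0) := @cvg_harmonic R => H'; apply: oU.
  by apply: filterS H' => i; exact: le_trans (ler_norm _).
have late : \forall i \near U, (maxn K (maxn K1 K2) <= i)%N.
  by apply: oU; exists (maxn K (maxn K1 K2)).
have [i [Hi [ei]]] := filter_ex (filterI H (filterI small late)).
rewrite !geq_max => /and3P[Ki K1i K2i].
have {}Ki := leq_trans Ki (s_ge i); have {}K1i := leq_trans K1i (s_ge i).
have {}K2i := leq_trans K2i (s_ge i).
have [l [_ sl Ls Ll Lj]] := sP i.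
have {}ei : i.+1%:R^-1 <= e := ei.
have e1 : e <= c' / 2 by rewrite ge_min lexx.
have e2 : e <= (b - a) / 3 by rewrite ge_min lexx orbT.
move: (i.+1%:R^-1) ei Ls => y ei Ls.
have [tl|tl] := leP (time l - time (s i)) (T + 1).
  by have := h1 _ _ K1i sl tl; lra.
have T0 : 0 < T by lra.
have [l' [sl' Tl' l'min]] := first_index_after (s i) T0.
have tl' : time l' - time (s i) <= T + 1.
  case: l' sl' Tl' l'min => // l' sl' Tl' l'min.
  have := l'min l' sl' (ltnSn l'); have := h2 l' (leq_trans K2i sl'); rewrite itimeS; lra.
have ll' : (l' <= l)%N.
  rewrite leqNgt; apply/negP => ll'; have := l'min l sl ll'; lra.
have := Hi Ki l' (ltnW sl') Tl' tl'; have := Lj l' (ltnW sl') ll'; lra.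
Qed.

(** If the velocity did not vanish, [L] would drop by a fixed amount infinitely
    often from values close to its limit superior, hence would upcross some
    noncritical value just below the limit superior infinitely often. *)
Lemma velocity_cvg0 r : 0 < r -> exists K, forall k, (K <= k)%N -> `|q k| < r.
Proof.
move=> r0; apply: contrapT => H.
have io N : exists2 k, (N <= k)%N & r <= `|q k|.
  apply: contrapT => HN; apply: H; exists N => k Nk; rewrite ltNge.
  by apply/negP => rk; apply: HN; exists k.
have two1 : 1 <= 2 :> R by rewrite ler1n.
have [c' [K [c'0 hK]]] := fast_descent two1 r0.
have [K1 h1] := eta_small ltr01.
have [M LM] := L_bounded.
pose S := [set y | forall N, exists2 k, (N <= k)%N & y <= L k].
have supS : has_sup S.
  split.
    by exists (- M) => N; exists N => //; have := LM N; rewrite ler_norml => /andP[].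
  exists M => y /(_ 0%N)[k _ yk]; apply: le_trans yk _.
  by have := LM k; rewrite ler_norml => /andP[].
pose A := sup S; have c4 : 0 < c' / 4 by rewrite divr_gt0.
have [y Sy Ay] := sup_adherent c4 supS.
have upper : exists N, forall k, (N <= k)%N -> L k < A + c' / 4.
  apply: contrapT => HN.
  have : S (A + c' / 4).
    move=> N; apply: contrapT => HN'; apply: HN; exists N => k Nk.
    by rewrite ltNge; apply/negP => le; apply: HN'; exists k.
  by move=> /(ub_le_sup supS.2); rewrite -/A gerDl leNgt c4.
have [N0 hN0] := upper.
have [a [a1 a2 nca]] : exists a, [/\ A - 3 / 4 * c' < a, A - c' / 2 < A - c' / 4 /\ a < A - c' / 2 &
    forall z, critical z -> g z != a].
  have [|a [? ? ?]] := @noncritical_value_between (A - 3 / 4 * c') (A - c' / 2); first by lra.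
  by exists a; split => //; split => //; lra.
apply: (@no_upcrossing a (A - c' / 4)) => //; first by lra.
- move=> N; have [k] := io (maxn N (maxn K (maxn K1 N0))).
  rewrite !geq_max => /and4P[Nk Kk K1k N0k] rk.
  have [l [kl Tl lmin]] := first_index_after k ltr01.
  have tl : time l - time k <= 2.
    case: l kl Tl lmin => // l kl Tl lmin.
    have := lmin l kl (ltnSn l); have := h1 l (leq_trans K1k kl); rewrite itimeS; lra.
  exists l; first exact: leq_trans Nk (ltnW kl).
  by have := hK k l Kk (ltnW kl) Tl tl rk; have := hN0 k N0k; lra.
- move=> N; have [k Nk yk] := Sy N; exists k => //.
  by apply: le_trans yk; rewrite /A; exact: ltW.
Qed.

End LyapunovDescent.

(** * Orthogonality to a sub-sigma-algebra *)

Section SubSigmaAlgebra.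
Context {d : measure_display} {Omega : measurableType d} {R : realType}.
Variable G : set (set Omega).
Hypothesis sigmaG : sigma_algebra setT G.

Lemma sub_measurableP (X : Omega -> R) : sub_measurable G X <->
  measurable_fun (setT : set (g_sigma_algebraType G)) (X : g_sigma_algebraType G -> R).
Proof.
have mG : @measurable _ (g_sigma_algebraType G) = G by exact: sigma_algebra_id.
split=> [GX _ B mB|mX B mB]; first by rewrite setTI mG; exact: GX.
by have := mX measurableT B mB; rewrite setTI mG.
Qed.

Lemma sub_measurableD (X Y : Omega -> R) : sub_measurable G X ->
  sub_measurable G Y -> sub_measurable G (fun w => X w + Y w).
Proof.
by move=> /sub_measurableP mX /sub_measurableP mY; apply/sub_measurableP;
   exact: measurable_funD.
Qed.

Lemma sub_measurable_comp (phi : R -> R) (X : Omega -> R) :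
  measurable_fun setT phi -> sub_measurable G X ->
  sub_measurable G (fun w => phi (X w)).
Proof.
move=> mphi /sub_measurableP mX; apply/sub_measurableP.
exact: (measurableT_comp mphi mX).
Qed.

Lemma sub_measurable_cst (c : R) : sub_measurable G (fun=> c).
Proof. by apply/sub_measurableP; exact: measurable_cst. Qed.

Lemma sub_measurable_scale (c : R) (X : Omega -> R) : sub_measurable G X ->
  sub_measurable G (fun w => c * X w).
Proof.
by apply: (@sub_measurable_comp (fun y => c * y)); exact: mulrl_measurable.
Qed.

Hypothesis measG : G `<=` measurable.

Lemma sub_measurable_measurable (X : Omega -> R) :
  sub_measurable G X -> measurable_fun setT X.
Proof. by move=> GX _ B mB; rewrite setTI; exact/measG/GX. Qed.

End SubSigmaAlgebra.

Section Orthogonality.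
Context {d : measure_display} {Omega : measurableType d} {R : realType}.
Variable P : probability Omega R.

Lemma bounded_integrable (X : Omega -> R) (C : R) : measurable_fun setT X ->
  (forall w, `|X w| <= C) -> P.-integrable setT (EFin \o X).
Proof.
move=> mX XC; apply: measurable_bounded_integrable => //.
  by rewrite (le_lt_trans (probability_le1 P measurableT)) // ltry.
exists C; split; first exact: num_real.
by move=> y Cy w _ /=; exact: le_trans (XC w) (ltW Cy).
Qed.

Lemma bounded_Rintegral_le (X : Omega -> R) (C : R) : measurable_fun setT X ->
  (forall w, `|X w| <= C) -> `|\int[P]_w X w| <= C.
Proof.
move=> mX XC; have iX := bounded_integrable mX XC.
apply: le_trans (le_normr_Rintegral measurableT iX) _.
have -> : C = \int[P]_(w in setT) C.
  by rewrite Rintegral_cst //= probability_setT /= mulr1.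
apply: le_Rintegral => //.
  apply: (@bounded_integrable _ C) => [|w]; last by rewrite normr_id.
  exact: measurableT_comp.
by apply: (@bounded_integrable _ `|C|).
Qed.

Variable G : set (set Omega).
Hypothesis measG : G `<=` measurable.

(** A bounded [G]-measurable factor is uniformly approximated by its
    discretizations, which are constant on finitely many sets of [G]. *)
Lemma orthogonal_sub_measurable (Y Z : Omega -> R) (C M : R) :
  sub_measurable G Y -> (forall w, `|Y w| <= C) ->
  measurable_fun setT Z -> (forall w, `|Z w| <= M) ->
  (forall A, G A -> \int[P]_(w in A) Z w = 0) ->
  \int[P]_w (Y w * Z w) = 0.
Proof.
move=> GY YC mZ ZM Zorth.
have mY : measurable_fun setT Y by exact: (sub_measurable_measurable measG).
have C0 : 0 <= C by exact: le_trans (YC point).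
have M0 : 0 <= M by exact: le_trans (ZM point).
have mYZ : measurable_fun setT (fun w => Y w * Z w) by exact: measurable_funM.
have iYZ : P.-integrable setT (EFin \o (fun w => Y w * Z w)).
  by apply: (@bounded_integrable _ (C * M)) => // w; exact: ler_norm_mul.
suff small N : `|\int[P]_w (Y w * Z w)| <= M / N.+1%:R.
  apply/eqP; rewrite -normr_le0.
  apply: (@cvgr_to_ge _ \oo _ _ (fun N => M / N.+1%:R)).
    exact: cvg_scaled_harmonic.
  by apply: nearW => N; exact: small.
have N0 : 0 < N.+1%:R :> R by rewrite ltr0n.
pose t w := Num.trunc ((Y w + C) * N.+1%:R).
have YC0 w : 0 <= (Y w + C) * N.+1%:R.
  by rewrite mulr_ge0 // ?(ltW N0) //; have := YC w; rewrite ler_norml => /andP[]; lra.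
have tP w : (t w)%:R <= (Y w + C) * N.+1%:R < (t w).+1%:R by exact: truncn_itv.
pose J := (Num.trunc ((C + C) * N.+1%:R)).+1.
have tJ w : (t w < J)%N.
  rewrite -(ltr_nat R); have /andP[tw _] := tP w; apply: le_lt_trans tw _.
  have /andP[_] := truncn_itv (mulr_ge0 (addr_ge0 C0 C0) (ltW N0)).
  apply: le_lt_trans; rewrite ler_wpM2r ?(ltW N0) // lerD2r.
  exact: le_trans (ler_norm _) (YC w).
pose A j := [set w | t w = j].
have GA j : G (A j).
  have -> : A j = Y @^-1` `[j%:R / N.+1%:R - C, j.+1%:R / N.+1%:R - C[%classic.
    apply/seteqP; split=> w; rewrite /A /= in_itv /= lerBlDr ltrBrDr
      ler_pdivrMr // ltr_pdivlMr //.
      by move=> <-; exact: tP.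
    by move=> jY; apply: truncn_def.
  by apply: GY; exact: measurable_itv.
pose V s w := \sum_(j <- s) (j%:R / N.+1%:R - C) * (Z \_ (A j)) w.
have mZA j : measurable_fun setT (Z \_ (A j)).
  apply/(measurable_restrictT _ (measG (GA j))).
  exact: measurable_funS mZ.
have iZA j (c : R) : P.-integrable setT (EFin \o (fun w => c * (Z \_ (A j)) w)).
  apply: (@bounded_integrable _ (`|c| * M)) => [|w].
    by apply: measurable_funM => //; exact: mZA.
  apply: ler_norm_mul => //; rewrite /patch; case: ifP => // _.
  by rewrite normr0.
have VP s : P.-integrable setT (EFin \o V s) /\ \int[P]_w V s w = 0.
  elim: s => [|j s [is_ s0]].
    have -> : V [::] = cst 0 by apply/funext => w; rewrite /V big_nil.
    split; first by apply: (@bounded_integrable _ 0) => // w; rewrite normr0.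
    by rewrite Rintegral_cst // mul0r.
  have -> : V (j :: s) = (fun w => (j%:R / N.+1%:R - C) * (Z \_ (A j)) w + V s w).
    by apply/funext => w; rewrite /V big_cons.
  split; first by have := integrableD measurableT (iZA j _) is_; exact.
  rewrite RintegralD // s0 addr0 RintegralZl //; last first.
    by have := iZA j 1; under eq_fun do rewrite mul1r.
  by rewrite -Rintegral_mkcond Zorth // mulr0.
have Vt w : V (iota 0 J) w = ((t w)%:R / N.+1%:R - C) * Z w.
  have tin : t w \in iota 0 J by rewrite mem_iota /= add0n tJ.
  rewrite /V (bigD1_seq (t w)) ?iota_uniq //= big1_seq ?addr0.
    by rewrite /patch mem_set.
  move=> j /andP[jt _]; rewrite /patch ifF ?mulr0 //.
  by apply/negbTE; apply: contra jt => /set_mem <-.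
have [iV V0] := VP (iota 0 J).
have -> : \int[P]_w (Y w * Z w) = \int[P]_w (Y w * Z w - V (iota 0 J) w).
  by rewrite RintegralB // V0 subr0.
apply: bounded_Rintegral_le => [|w].
  by apply: measurable_funB => //; apply/measurable_EFinP; exact: (measurable_int P).
rewrite Vt -mulrBl mulrC; apply: ler_norm_mul => //.
have /andP[t1 t2] := tP w.
rewrite ger0_norm; last first.
  by rewrite opprB addrA subr_ge0 ler_pdivrMr.
rewrite opprB addrA lerBlDr -(ler_pM2r N0) [leRHS]mulrDl mulVf ?divfK ?gt_eqF //.
by rewrite [leRHS]addrC natr1 ltW.
Qed.

End Orthogonality.

(** * Exponential concentration of the noise *)

Section Concentration.
Context {d : measure_display} {Omega : measurableType d} {R : realType}.
Variables (P : probability Omega R) (F : nat -> set (set Omega)).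
Hypothesis hF : filtration F.
Variables (Z : nat -> Omega -> R) (M : R) (theta : nat -> R).
Hypothesis M_ge0 : 0 <= M.
Hypothesis ZF : forall k, sub_measurable (F k) (Z k).
Hypothesis ZM : forall k w, `|Z k w| <= M.
Hypothesis Zorth : forall k A, F k A -> \int[P]_(w in A) Z k.+1 w = 0.
Hypothesis theta_gt0 : forall k, 0 < theta k.

Local Notation time := (itime theta).

Definition noise_sum k l w : R := \sum_(k <= j < l) theta j * Z j.+1 w.
Local Notation S := noise_sum.

Let sigmaF k : sigma_algebra setT (F k). Proof. by have [] := hF. Qed.
Let measF k : F k `<=` measurable. Proof. by have [_ mF _] := hF; exact: mF. Qed.

Lemma noise_sumS k l w : (k <= l)%N -> S k l.+1 w = S k l w + theta l * Z l.+1 w.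
Proof. by move=> kl; rewrite /S big_nat_recr. Qed.

Lemma noise_sum_sub_measurable k l : (k <= l)%N -> sub_measurable (F l) (S k l).
Proof.
elim: l => [|l IH] kl.
  have -> : S k 0 = fun=> 0 by apply/funext => w; rewrite /S big_geq.
  exact: sub_measurable_cst (sigmaF 0) 0.
move: kl; rewrite leq_eqVlt => /predU1P[->|kl].
  have -> : S l.+1 l.+1 = fun=> 0 by apply/funext => w; rewrite /S big_geq.
  exact: sub_measurable_cst (sigmaF l.+1) 0.
have -> : S k l.+1 = fun w => S k l w + theta l * Z l.+1 w.
  by apply/funext => w; rewrite noise_sumS.
apply: (sub_measurableD (sigmaF l.+1)); last first.
  by apply: (sub_measurable_scale (sigmaF l.+1)); exact: ZF.
move=> B mB; have [_ _ Fle] := hF; apply: (Fle l l.+1 (leqnSn l)).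
exact: IH.
Qed.

Lemma noise_sum_le k l w : (k <= l)%N -> `|S k l w| <= M * (time l - time k).
Proof.
move=> kl; rewrite window_sum // mulr_sumr; apply: le_trans (ler_norm_sum _ _ _) _.
by apply: ler_sum => j _; rewrite normrM gtr0_norm // mulrC ler_wpM2r // ltW.
Qed.

Lemma noise_sum_measurable k l : (k <= l)%N -> measurable_fun setT (S k l).
Proof.
move=> kl; apply: (sub_measurable_measurable (@measF l)).
exact: noise_sum_sub_measurable.
Qed.

Lemma expR_le_quadratic (t : R) : `|t| <= 2^-1 -> expR t <= 1 + t + 2 * t ^+ 2.
Proof.
rewrite ler_norml => /andP[t1 t2].
have p0 : 0 < 1 - t by lra.
have ge := expR_ge1Dx (- t).
have : expR t <= (1 - t)^-1.
  rewrite -[t in expR t]opprK expRN lef_pV2 ?posrE ?expR_gt0 //.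
move=> /le_trans; apply; rewrite -div1r ler_pdivrMr //.
have : 0 <= t ^+ 2 * (1 - 2 * t) by rewrite mulr_ge0 ?sqr_ge0 //; lra.
lra.
Qed.

Let expS_le k l (lam : R) w : (k <= l)%N ->
  `|expR (lam * S k l w)| <= expR (`|lam| * (M * (time l - time k))).
Proof.
move=> kl; rewrite gtr0_norm ?expR_gt0 // ler_expR.
apply: le_trans (ler_norm _) _; apply: ler_norm_mul => //.
exact: noise_sum_le.
Qed.

Let mexpS k l (lam : R) : (k <= l)%N ->
  measurable_fun setT (fun w => expR (lam * S k l w)).
Proof.
move=> kl; apply: measurableT_comp; first exact: measurable_expR.
by apply: measurable_funM => //; exact: noise_sum_measurable.
Qed.

(** In each step the linear term of the exponential integrates to [0] against
    the past, and the quadratic one contributes a variance. *)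
Lemma exponential_moment k (lam : R) :
  (forall j, (k <= j)%N -> `|lam| * (theta j * M) <= 2^-1) ->
  forall l, (k <= l)%N -> \int[P]_w expR (lam * S k l w) <=
    expR (\sum_(k <= j < l) 2 * (lam * (theta j * M)) ^+ 2).
Proof.
move=> lamM; elim=> [|l IH] kl; [|move: kl; rewrite leq_eqVlt => /predU1P[->|kl]].
- have -> : (fun w => expR (lam * S k 0 w)) = cst 1.
    by apply/funext => w; rewrite /S big_geq // mulr0 expR0.
  by rewrite Rintegral_cst //= probability_setT mulr1 big_geq // expR0.
- have -> : (fun w => expR (lam * S l.+1 l.+1 w)) = cst 1.
    by apply/funext => w; rewrite /S big_geq // mulr0 expR0.
  by rewrite Rintegral_cst //= probability_setT mulr1 big_geq // expR0.
have {}kl : (k <= l)%N by rewrite -ltnS.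
pose a := lam * (theta l * M).
pose X w := expR (lam * S k l w).
have mX : measurable_fun setT X by exact: mexpS.
have iX : P.-integrable setT (EFin \o X).
  by apply: (bounded_integrable P mX) => w; exact: expS_le.
have mZ : measurable_fun setT (Z l.+1).
  by apply: (sub_measurable_measurable (@measF l.+1)); exact: ZF.
have iXZ : P.-integrable setT (EFin \o (fun w => X w * Z l.+1 w)).
  apply: (@bounded_integrable _ _ _ _ _ (expR (`|lam| * (M * (time l - time k))) * M)).
    exact: measurable_funM.
  by move=> w; apply: ler_norm_mul => //; exact: expS_le.
have XZ0 : \int[P]_w (X w * Z l.+1 w) = 0.
  apply: (orthogonal_sub_measurable (@measF l) (C := expR (`|lam| * (M * (time l - time k)))) (M := M)) => //.
  - apply: (@sub_measurable_comp _ _ _ _ (sigmaF l) (fun y => expR (lam * y))).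
      apply: measurableT_comp; first exact: measurable_expR.
      exact: mulrl_measurable.
    exact: noise_sum_sub_measurable.
  - by move=> w; exact: expS_le.
  - by move=> A; exact: Zorth.
have step w : expR (lam * S k l.+1 w) <=
    (1 + 2 * a ^+ 2) * X w + lam * theta l * (X w * Z l.+1 w).
  rewrite noise_sumS // mulrDr expRD -/(X w).
  have X0 : 0 < X w by exact: expR_gt0.
  pose t := lam * (theta l * Z l.+1 w).
  have ta : `|t| <= `|lam| * (theta l * M).
    by apply: ler_norm_mul => //; apply: ler_norm_mul => //; rewrite gtr0_norm.
  have := expR_le_quadratic (le_trans ta (lamM l kl)).
  have t2 : t ^+ 2 <= a ^+ 2.
    rewrite -(real_normK (num_real t)) -(real_normK (num_real a)).
    rewrite ler_sqr ?nnegrE //; apply: le_trans ta _.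
    by rewrite /a normrM [X in _ <= _ * X]ger0_norm // mulr_ge0 // ltW.
  rewrite -/t => et; apply: (@le_trans _ _ (X w * (1 + t + 2 * a ^+ 2))).
    rewrite ler_wpM2l ?(ltW X0) //; lra.
  by rewrite le_eqVlt; apply/orP; left; apply/eqP; rewrite /t; ring.
have iS : P.-integrable setT (EFin \o (fun w => expR (lam * S k l.+1 w))).
  by apply: (bounded_integrable P (mexpS _ (leqW kl))) => w; exact: expS_le (leqW kl).
have i1 : P.-integrable setT (EFin \o (fun w => (1 + 2 * a ^+ 2) * X w)).
  by have := integrableZl measurableT (1 + 2 * a ^+ 2) iX; exact.
have i2 : P.-integrable setT (EFin \o (fun w => lam * theta l * (X w * Z l.+1 w))).
  by have := integrableZl measurableT (lam * theta l) iXZ; exact.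
have i12 : P.-integrable setT (EFin \o (fun w => (1 + 2 * a ^+ 2) * X w + lam * theta l * (X w * Z l.+1 w))).
  by have := integrableD measurableT i1 i2; exact.
apply: le_trans (le_Rintegral measurableT iS i12 (fun w _ => step w)) _.
rewrite RintegralD // RintegralZl // RintegralZl // XZ0 mulr0 addr0.
rewrite big_nat_recr //= -/a [leRHS]expRD mulrC.
apply: ler_pM.
- by apply: Rintegral_ge0 => w _; exact: expR_ge0.
- by rewrite addr_ge0 // mulr_ge0 // sqr_ge0.
- exact: IH.
- exact: expR_ge1Dx.
Qed.

Lemma exponential_tail k l (lam a : R) : (k <= l)%N ->
  (forall j, (k <= j)%N -> `|lam| * (theta j * M) <= 2^-1) ->
  fine (P [set w | a <= lam * S k l w]) <=
    expR (\sum_(k <= j < l) 2 * (lam * (theta j * M)) ^+ 2 - a).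
Proof.
move=> kl lamM; set A := [set w | _].
have mA : measurable A.
  have -> : A = (fun w => lam * S k l w) @^-1` `[a, +oo[%classic.
    by apply/seteqP; split=> w; rewrite /A /= in_itv /= andbT.
  rewrite -[X in measurable X]setTI.
  by apply: (measurable_funM (measurable_cst lam) (noise_sum_measurable kl)) => //; exact: measurable_itv.
have iX : P.-integrable setT (EFin \o (fun w => expR (lam * S k l w))).
  by apply: (bounded_integrable P (mexpS _ kl)) => w; exact: expS_le.
have : expR a * fine (P A) <= \int[P]_w expR (lam * S k l w).
  rewrite -(Rintegral_cst P mA) Rintegral_mkcond; apply: le_Rintegral => //.
    apply: (@bounded_integrable _ _ _ _ _ (expR a)).
      by apply/(measurable_restrictT _ mA); exact: measurable_cst.
    move=> w; rewrite /patch; case: ifP => _; last by rewrite normr0 expR_ge0.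
    by rewrite gtr0_norm ?expR_gt0.
  move=> w _; rewrite /patch; case: ifP => [/set_mem|_]; last exact: expR_ge0.
  by rewrite /A /= ler_expR.
move=> /le_trans/(_ (exponential_moment lamM kl)) le.
rewrite expRD expRN mulrC ler_pdivlMl ?expR_gt0 //.
Qed.

Hypothesis theta_log : theta k * ln k%:R @[k --> \oo] --> (0 : R).
Hypothesis theta_cvg : theta k @[k --> \oo] --> 0.
Hypothesis theta_sum : forall y, exists k, y <= itime theta k.

(** With the parameter [4 / e * ln k], the level [e] contributes [- 4 * ln k] to
    the exponent, and the variance at most [ln k] once [theta j * ln j] is
    small. *)
Lemma noise_sum_tail (l : nat -> nat) (T e : R) : (forall k, (k <= l k)%N) ->
  (forall k, time (l k) - time k <= T) -> 0 < e ->
  exists K, forall k, (K <= k)%N ->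
    fine (P [set w | e <= `|S k (l k) w|]) <= 2 / k%:R ^+ 2.
Proof.
move=> kl lT e0; have T0 : 0 <= T.
  by apply: le_trans (lT 0%N); rewrite subr_ge0 itime_le.
pose C := 32 * M ^+ 2 * T / e ^+ 2 + 8 * M / e + 1.
have C0 : 0 < C.
  rewrite ltr_wpDl // addr_ge0 // divr_ge0 ?sqr_ge0 ?(ltW e0) //.
    by rewrite !mulr_ge0 // sqr_ge0.
  by rewrite mulr_ge0.
pose c := C^-1; have c0 : 0 < c by rewrite invr_gt0.
have cC : c * C = 1 by rewrite mulVf // gt_eqF.
have x0 : 0 <= 32 * M ^+ 2 * T / e ^+ 2.
  by rewrite divr_ge0 ?sqr_ge0 // !mulr_ge0 // sqr_ge0.
have y0 : 0 <= 8 * M / e by rewrite divr_ge0 ?mulr_ge0 // ltW.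
have XC : 32 * M ^+ 2 * T / e ^+ 2 <= C.
  by rewrite /C -addrA lerDl addr_ge0.
have YC : 8 * M / e <= C by rewrite /C -addrA addrCA lerDl addr_ge0.
have c1 : c * (32 * M ^+ 2 * T / e ^+ 2) <= 1.
  by rewrite -[leRHS]cC ler_wpM2l // ltW.
have c2 : c * (8 * M / e) <= 1 by rewrite -[leRHS]cC ler_wpM2l // ltW.
have [K hK] := cvg0_eventually_le theta_log c0.
exists (maxn K 2) => k; rewrite geq_max => /andP[Kk k2].
have kR : 1 < k%:R :> R by rewrite ltr1n.
have lnk : 0 < ln k%:R :> R by rewrite ln_gt0.
pose lam := 4 / e * ln k%:R.
have lam0 : 0 < lam by rewrite mulr_gt0 // divr_gt0.
have th j : (k <= j)%N -> theta j * lam <= 4 / e * c.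
  move=> kj; rewrite mulrCA ler_wpM2l ?divr_ge0 ?(ltW e0) //.
  apply: le_trans (hK j (leq_trans Kk kj)); rewrite ler_wpM2l ?(ltW (theta_gt0 j)) //.
  by rewrite ler_ln ?posrE ?ltr0n ?ler_nat // ?(leq_trans _ kj) // ltnW.
have lamM j : (k <= j)%N -> lam * (theta j * M) <= 2^-1.
  move=> kj; have := ler_wpM2r M_ge0 (th j kj).
  have -> : 4 / e * c * M = c * (8 * M / e) / 2 by field; rewrite gt_eqF.
  rewrite mulrAC mulrC; lra.
have V0 : 0 <= 2 * M ^+ 2 * lam by rewrite mulr_ge0 ?(ltW lam0) // mulr_ge0 // sqr_ge0.
have var : \sum_(k <= j < l k) 2 * (lam * (theta j * M)) ^+ 2 <= ln k%:R.
  apply: (@le_trans _ _ (\sum_(k <= j < l k) 2 * M ^+ 2 * lam * (4 / e * c) * theta j)).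
    rewrite [leLHS]big_nat_cond [leRHS]big_nat_cond; apply: ler_sum => j /andP[/andP[kj _] _].
    have -> : 2 * (lam * (theta j * M)) ^+ 2 = 2 * M ^+ 2 * lam * (theta j * lam) * theta j by ring.
    apply: ler_wpM2r; first exact: ltW.
    by apply: ler_wpM2l; [exact: V0|exact: th].
  rewrite -mulr_sumr -window_sum //.
  apply: (@le_trans _ _ (2 * M ^+ 2 * lam * (4 / e * c) * T)).
    by rewrite ler_wpM2l // mulr_ge0 // mulr_ge0 ?(ltW c0) // divr_ge0 // ltW.
  have -> : 2 * M ^+ 2 * lam * (4 / e * c) * T = c * (32 * M ^+ 2 * T / e ^+ 2) * ln k%:R.
    by rewrite /lam; field; rewrite gt_eqF.
  by rewrite -[leRHS]mul1r ler_wpM2r // ltW.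
have tail s : `|s| = lam -> fine (P [set w | lam * e <= s * S k (l k) w]) <= 1 / k%:R ^+ 2.
  move=> sl; apply: le_trans.
    apply: (@exponential_tail k (l k) s (lam * e) (kl k)).
    by move=> j kj; rewrite sl; exact: lamM.
  have -> : \sum_(k <= j < l k) 2 * (s * (theta j * M)) ^+ 2 =
      \sum_(k <= j < l k) 2 * (lam * (theta j * M)) ^+ 2.
    have ss : s ^+ 2 = lam ^+ 2 by rewrite -sl real_normK // num_real.
    apply: eq_bigr => j _.
    have -> : 2 * (s * (theta j * M)) ^+ 2 = 2 * (s ^+ 2 * (theta j * M) ^+ 2) by ring.
    by rewrite ss; ring.
  have -> : 1 / k%:R ^+ 2 = expR (- (2 * ln k%:R)) :> R.
    by rewrite expRN expRM_natl lnK ?posrE ?ltr0n ?div1r // ltnW.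
  have -> : lam * e = 4 * ln k%:R by rewrite /lam mulrAC divfK // gt_eqF.
  by rewrite ler_expR; move: var lnk; move: (\sum_(k <= j < l k) _) (ln k%:R) => y z; lra.
have nl : `|- lam| = lam by rewrite normrN gtr0_norm.
have := tail lam (gtr0_norm lam0); have := tail (- lam) nl.
set A1 := [set w | _ <= - lam * _]; set A2 := [set w | _] => h1 h2.
have mSk : measurable_fun setT (S k (l k)) by apply: noise_sum_measurable.
have mA (s : R) : measurable [set w | lam * e <= s * S k (l k) w].
  have -> : [set w | lam * e <= s * S k (l k) w] =
      setT `&` (fun w => s * S k (l k) w) @^-1` `[lam * e, +oo[%classic.
    by rewrite setTI; apply/seteqP; split=> w; rewrite /= in_itv /= andbT.
  by apply: (measurable_funM (measurable_cst s) mSk) => //; exact: measurable_itv.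
have mA12 : measurable (A1 `|` A2) by apply: measurableU; exact: mA.
have sub : [set w | e <= `|S k (l k) w|] = A1 `|` A2.
  apply/seteqP; split=> w /=; rewrite /A1 /A2 /= mulNr -mulrN !ler_pM2l // ler_normr.
    by move=> /orP[]; [right|left].
  by move=> [->|->]; rewrite ?orbT.
rewrite sub; apply: (@le_trans _ _ (fine (P A1) + fine (P A2))).
  have mA1 : measurable A1 := mA (- lam); have mA2 : measurable A2 := mA lam.
  rewrite -lee_fin EFinD !fineK ?fin_num_measure //.
  exact: measureU2.
lra.
Qed.

(** Borel-Cantelli, the tails [2 / k ^+ 2] being summable. *)
Lemma noise_sum_ae_small (l : nat -> nat) (T e : R) : (forall k, (k <= l k)%N) ->
  (forall k, time (l k) - time k <= T) -> 0 < e ->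
  {ae P, forall w, exists K, forall k, (K <= k)%N -> `|S k (l k) w| < e}.
Proof.
move=> kl lT e0; have [K hK] := noise_sum_tail kl lT e0.
pose N := maxn K 2.
pose A i := [set w | e <= `|S (i + N)%N (l (i + N)%N) w|].
have mA i : measurable (A i).
  have -> : A i = setT `&` (fun w => `|S (i + N)%N (l (i + N)%N) w|) @^-1` `[e, +oo[%classic.
    by rewrite setTI; apply/seteqP; split=> w; rewrite /= in_itv /= andbT.
  have mS : measurable_fun setT (S (i + N)%N (l (i + N)%N)).
    by apply: noise_sum_measurable.
  by apply: (measurableT_comp (@normr_measurable R setT) mS) => //; exact: measurable_itv.
have sumA : (\sum_(0 <= n <oo) P (A n) < +oo)%E.
  apply: (@le_lt_trans _ _ 2%:E); last exact: ltry.
  apply: lime_le; first by apply: is_cvg_nneseries => ? _ _; exact: measure_ge0.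
  apply: nearW => n.
  apply: (@le_trans _ _ (\sum_(0 <= i < n) (2 * (i.+1%:R^-1 - i.+2%:R^-1))%:E)%E).
    apply: lee_sum => i _; rewrite -(fineK (fin_num_measure P _ (mA i))) lee_fin.
    apply: le_trans (hK (i + N)%N _) _; first by rewrite (leq_trans (leq_maxl K 2)) // leq_addl.
    rewrite ler_wpM2l //.
    have i1 : 0 < i.+1%:R :> R by rewrite ltr0n.
    have i2 : 0 < i.+2%:R :> R by rewrite ltr0n.
    have -> : i.+1%:R^-1 - i.+2%:R^-1 = (i.+1%:R * i.+2%:R)^-1 :> R.
      rewrite -[i.+2%:R]natr1 in i2 *; move: (i.+1%:R) i1 i2 => a a1 a2.
      by field; rewrite !gt_eqF.
    rewrite lef_pV2 ?posrE ?exprn_gt0 ?mulr_gt0 // ?ltr0n ?addn_gt0.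
      rewrite expr2; apply: ler_pM => //; rewrite ler_nat.
        by rewrite -addn1 leq_add2l (leq_trans _ (leq_maxr K 2)).
      by rewrite -addn2 leq_add2l leq_maxr.
    by rewrite (leq_trans _ (leq_maxr K 2)) ?orbT.
  rewrite sumEFin lee_fin -mulr_sumr.
  have -> : \sum_(0 <= i < n) (i.+1%:R^-1 - i.+2%:R^-1) = 1 - n.+1%:R^-1 :> R.
    elim: n => [|n IH]; first by rewrite big_geq // invr1 subrr.
    by rewrite big_nat_recr //= IH addrA subrK.
  have : 0 < n.+1%:R^-1 :> R by rewrite invr_gt0 ltr0n.
  move: (n.+1%:R^-1) => y; lra.
have := lim_sup_set_cvg0 mA sumA => null.
exists (lim_sup_set A); split => //.
  apply: bigcap_measurable => // j _; apply: bigcup_measurable => i _; exact: mA.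
move=> w nw j _; apply: contrapT => H; apply: nw.
exists (j + N)%N => k jk; rewrite ltNge; apply/negP => ek; apply: H.
have Nk : (N <= k)%N by apply: leq_trans jk; rewrite leq_addl.
exists (k - N)%N; first by rewrite /= leq_subRL // addnC.
by rewrite /A /= subnK.
Qed.

Lemma last_index_within (s : R) : 0 <= s -> exists l : nat -> nat, forall k,
  [/\ (k <= l k)%N, time (l k) - time k <= s & s < time (l k).+1 - time k].
Proof.
move=> s0; suff H k : exists l : nat,
    [/\ (k <= l)%N, time l - time k <= s & s < time l.+1 - time k].
  by have /choice[l lP] := H; exists l.
have [l0 hl0] := theta_sum (time k + s + 1).
have exl : exists l, s < time l.+1 - time k.
  by exists l0; have := itime_lt theta_gt0 l0; lra.
exists (ex_minn exl); case: ex_minnP => l sl lmin; split => //.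
  rewrite -ltnS; apply: (itime_lt_inv theta_gt0); lra.
case: l sl lmin => [|l] sl lmin.
  by rewrite itime0; have := itime_ge0 theta_gt0 k; lra.
by rewrite leNgt; apply/negP => /lmin; rewrite ltnn.
Qed.

(** Sums over short pieces being small because the noise is bounded, finitely
    many end points per starting index control all windows of bounded
    duration. *)
Lemma noise_windows_vanish :
  {ae P, forall w, forall T e, 0 < T -> 0 < e -> exists K, forall k l,
    (K <= k)%N -> (k <= l)%N -> time l - time k <= T -> `|S k l w| <= e}.
Proof.
have s_ge0 (q r : nat) : 0 <= q%:R / r.+1%:R :> R by rewrite divr_ge0.
have /choice[L LP] (qr : nat * nat) := last_index_within (s_ge0 qr.1 qr.2).
have all : {ae P, forall w, forall q r i : nat, exists K, forall k, (K <= k)%N ->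
    `|S k (L (q, r) k) w| < i.+1%:R^-1}.
  apply: ae_foralln => q; apply: ae_foralln => r; apply: ae_foralln => i.
  apply: (@noise_sum_ae_small _ (q%:R / r.+1%:R)).
  - by move=> k; have [] := LP (q, r) k.
  - by move=> k; have [] := LP (q, r) k.
  - by rewrite invr_gt0 ltr0n.
apply: filterS all => w small T e T0 e0.
have M1 : 0 < M + 1 by rewrite ltr_wpDl.
have e4 : 0 < e / 4 / (M + 1) by rewrite !divr_gt0.
have invlt (y : R) : 0 < y -> exists r : nat, r.+1%:R^-1 <= y.
  move=> yy0; exists (Num.bound y^-1); rewrite invf_ple ?posrE ?ltr0n //.
  apply/ltW/(lt_trans (archi_boundP _)); first by rewrite invr_ge0 ltW.
  by rewrite ltr_nat.
have [r hr] := invlt _ e4.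
have e2 : 0 < e / 2 by rewrite divr_gt0.
have [i hi] := invlt _ e2.
pose J := (Num.trunc (T * r.+1%:R)).+1.
have [K1 h1] : exists K, forall q k, (q < J)%N -> (K <= k)%N ->
    `|S k (L (q, r) k) w| < i.+1%:R^-1.
  elim: J => [|J [K IH]]; first by exists 0%N.
  have [K' h'] := small J r i; exists (maxn K K') => q k.
  rewrite ltnS leq_eqVlt geq_max => /predU1P[->|qJ] /andP[Kk K'k]; first exact: h'.
  exact: IH.
have r0 : 0 < r.+1%:R :> R by rewrite ltr0n.
have ri : 0 < r.+1%:R^-1 :> R by rewrite invr_gt0.
have [K2 h2] := cvg0_eventually_le theta_cvg ri.
exists (maxn K1 K2) => k l; rewrite geq_max => /andP[K1k K2k] kl tT.
have t0 : 0 <= time l - time k by rewrite subr_ge0 itime_le.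
have /andP[qt tq] := truncn_itv (mulr_ge0 t0 (ltW r0)).
set q := Num.trunc _ in qt tq.
have qJ : (q < J)%N.
  rewrite -(ltr_nat R); apply: le_lt_trans qt _.
  have /andP[_] := truncn_itv (mulr_ge0 (ltW T0) (ltW r0)).
  by apply: le_lt_trans; rewrite ler_wpM2r // ltW.
have [kL tL Lt] := LP (q, r) k; rewrite /= in tL Lt.
set l' := L (q, r) k in kL tL Lt.
have ql : q%:R / r.+1%:R <= time l - time k by rewrite ler_pdivrMr.
have lq : time l - time k <= q%:R / r.+1%:R + r.+1%:R^-1.
  have -> : q%:R / r.+1%:R + r.+1%:R^-1 = (q%:R + 1) / r.+1%:R :> R.
    by rewrite mulrDl mul1r.
  by rewrite ler_pdivlMr // natr1 ltW.
have l'l : (l' <= l)%N.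
  rewrite -ltnS; apply: (itime_lt_inv theta_gt0).
  apply: le_lt_trans (itime_lt theta_gt0 l); rewrite -(lerD2r (- time k)).
  exact: le_trans tL ql.
have th := h2 l' (leq_trans K2k kL).
have tll : time l - time l' <= 2 * r.+1%:R^-1.
  move: Lt lq th; rewrite itimeS; move: (q%:R / r.+1%:R) => a.
  by move: (r.+1%:R^-1) => b; lra.
have -> : S k l w = S k l' w + S l' l w by rewrite /noise_sum (big_cat_nat kL l'l).
apply: le_trans (ler_normD _ _) _.
have b1 := h1 q k qJ K1k.
have b2 := noise_sum_le w l'l.
have b3 : M * (time l - time l') <= M * (2 * r.+1%:R^-1) by rewrite ler_wpM2l.
have b4 : M * (2 * r.+1%:R^-1) <= e / 2.
  have : r.+1%:R^-1 * (M + 1) <= e / 4 by rewrite -ler_pdivlMr.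
  move: (r.+1%:R^-1) ri => y yy0 le; have := mulr_ge0 M_ge0 (ltW yy0); lra.
rewrite -/l' in b1.
move: (i.+1%:R^-1) hi b1 (M * (2 * r.+1%:R^-1)) b3 b4 => a ha b1 b b3 b4; lra.
Qed.

End Concentration.

(** * Boundedness and step sizes *)

Section Preparations.
Context {R : realType} {n : nat}.
Implicit Types (D : 'rV[R]_n -> set 'rV[R]_n) (x w : 'rV[R]_n).

Lemma expansion_near_field D delta e x w : 0 < e ->
  expansion D delta x w -> near_field D (delta + e) x w.
Proof.
move=> e0 [z zx dist]; have : (set_dist w (D z) < (delta + e)%:E)%E.
  by apply: le_lt_trans dist _; rewrite lte_fin ltrDl.
move=> /ereal_inf_lt[_ [a Dza <-]]; rewrite lte_fin => /ltW wa.
exists z, a; split => //; last exact: le_trans (norm_le_enorm _) wa.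
by apply: le_trans (norm_le_enorm _) (le_trans zx _); rewrite lerDl ltW.
Qed.

Lemma eventually_bounded (V : normedZmodType R) (u : nat -> V) :
  (exists C K, forall k, (K <= k)%N -> `|u k| <= C) ->
  exists C, forall k, `|u k| <= C.
Proof.
move=> [C [K CK]]; exists (`|C| + \sum_(i < K) `|u i|) => k.
have [Kk|kK] := leqP K k.
  by rewrite ler_wpDr ?sumr_ge0 // (le_trans (CK k Kk)) // ler_norm.
by rewrite ler_wpDl // (bigD1 (Ordinal kK)) //= lerDl sumr_ge0.
Qed.

(** Once the weights are below [1], each step is a convex combination, which
    stays in any ball containing the current iterate and the averaged terms. *)
Lemma averaged_bounded (s : nat -> R) (u w : nat -> 'rV[R]_n) C :
  (forall k, 0 <= s k) -> s k @[k --> \oo] --> 0 ->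
  (forall k, u k.+1 = (1 - s k) *: u k + s k *: w k) ->
  (forall k, `|w k| <= C) -> exists C', forall k, `|u k| <= C'.
Proof.
move=> s0 scvg uS wC; have [K sK] := cvg0_eventually_le scvg (ltr01 : (0 : R) < 1).
apply: eventually_bounded; exists (Num.max C `|u K|), K => k /subnK <-.
move: (k - K)%N => j; elim: j => [|j IH]; first by rewrite add0n le_max lexx orbT.
rewrite addSn uS; set M := Num.max C _ in IH *; set l := (j + K)%N in IH *.
have s1 : s l <= 1 by apply: sK; rewrite leq_addl.
apply: le_trans (ler_normD _ _) _; rewrite !normrZ (ger0_norm (s0 _)).
rewrite ger0_norm ?subr_ge0 //.
have h1 : (1 - s l) * `|u l| <= (1 - s l) * M by rewrite ler_wpM2l // subr_ge0.
have h2 : s l * `|w l| <= s l * M by rewrite ler_wpM2l // le_max wC.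
apply: le_trans (lerD h1 h2) _; rewrite -mulrDl.
by rewrite subrK mul1r.
Qed.

Lemma locally_bounded_on_balls (V : normedZmodType R)
    (h : 'rV[R]_n -> 'rV[R]_n -> V) :
  (forall p : 'rV[R]_n * 'rV[R]_n, exists C,
     \forall q \near p, `|h q.1 q.2| <= C) ->
  forall M, exists C, forall a b, `|a| <= M -> `|b| <= M -> `|h a b| <= C.
Proof.
move=> bh M; apply: contrapT => H.
have /choice[p pP] (i : nat) : exists p : 'rV[R]_n * 'rV[R]_n,
    [/\ `|p.1| <= M, `|p.2| <= M & i%:R < `|h p.1 p.2|].
  apply: contrapT => Hi; apply: H; exists i%:R => a b aM bM.
  by rewrite leNgt; apply/negP => ih; apply: Hi; exists (a, b).
have [U [UU oU]] := eventually_ultra.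
have [|a aC _] := @ultra_bounded_cvg R U n (fun i => (p i).1) M UU.
  by move=> i; have [] := pP i.
have [|b bC _] := @ultra_bounded_cvg R U n (fun i => (p i).2) M UU.
  by move=> i; have [] := pP i.
have [C hC] := bh (a, b).
have U1 : \forall i \near U, `|h (p i).1 (p i).2| <= C.
  exact: (cvg_pair aC bC hC).
have U2 : \forall i \near U, C <= i%:R by apply: oU; apply: nbhs_infty_ger.
have [i [i1 i2]] := filter_ex (filterI U1 U2).
have [_ _ ilt] := pP i.
by have := lt_le_trans ilt (le_trans i1 i2); rewrite ltxx.
Qed.

Lemma continuous_bounded_on_balls (g : 'rV[R]_n -> R) : continuous g ->
  forall M, exists C, forall a, `|a| <= M -> `|g a| <= C.
Proof.
move=> cg M; have [[a b]|C hC] := @locally_bounded_on_balls R (fun a _ => g a) _ M.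
  exists (`|g a| + 1).
  have /cvgrPdist_le/(_ 1 ltr01) : g q.1 @[q --> (a, b)] --> g a.
    by apply: (@cvg_comp _ _ _ fst g _ (nbhs a)); [exact: cvg_fst|exact: cg].
  apply: filterS => q; rewrite distrC => le.
  by rewrite -(subrK (g a) (g q.1)) addrC; apply: le_trans (ler_normD _ _) (lerD _ le).
by exists C => a aM; exact: (hC a a aM aM).
Qed.

Lemma locally_lipschitz_continuous (f : 'rV[R]_n -> R) :
  locally_lipschitz f -> continuous f.
Proof.
move=> lf x; have [r [L [r0 L0 fL]]] := locally_lipschitzP lf x.
have /cvgrPdist_lt near_x : y @[y --> x] --> x by exact: cvg_id.
apply/(@cvgrPdist_le _ _ _ (nbhs x)) => e e0; have L1 : 0 < L + 1 by rewrite ltr_wpDl.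
have eL : 0 < e / (L + 1) by rewrite divr_gt0.
apply: filterS2 (near_x r r0) (near_x _ eL) => y xy /ltW xye.
have yx : `|y - x| < r by rewrite distrC.
apply: le_trans (fL x y _ yx) _; first by rewrite subrr normr0.
apply: le_trans (ler_wpM2l L0 xye) _.
by rewrite mulrCA ler_piMr ?(ltW e0) // ler_pdivrMr // mul1r lerDl.
Qed.

Lemma regularized_dotp (sigma : R) (f : 'rV[R]_n -> R) x :
  regularized sigma f x = f x + sigma / 2 * dotp x x.
Proof. by rewrite /regularized enorm_sq. Qed.

Lemma regularized_continuous (sigma : R) (f : 'rV[R]_n -> R) : continuous f ->
  continuous (fun x => f x + sigma / 2 * dotp x x).
Proof.
move=> cf x; have fx : f y @[y --> x] --> f x by exact: cf.
have dx : dotp y y @[y --> x] --> dotp x x by exact: (@dotp_cvg R n _ (nbhs x) id id x x).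
exact: (cvgD fx (cvgM (cvg_cst _) dx)).
Qed.

End Preparations.

Section StepSizes.
Context {R : realType}.
Variables (eta theta : nat -> R) (tau1 : R).
Hypotheses (eta_gt0 : forall k, 0 < eta k) (theta_gt0 : forall k, 0 < theta k).
Hypothesis tau1_gt0 : 0 < tau1.
Hypothesis ratio_cvg : theta k / eta k @[k --> \oo] --> tau1.

Lemma divergent_itime : (\sum_(0 <= k <oo) (theta k)%:E = +oo)%E ->
  forall y, exists k, y <= itime theta k.
Proof.
move=> sum y; apply: contrapT => /forallNP H.
have : (\sum_(0 <= k <oo) (theta k)%:E <= y%:E)%E.
  apply: lime_le; first by apply: is_cvg_nneseries => k _ _; rewrite lee_fin ltW.
  apply: nearW => k; rewrite sumEFin lee_fin big_mkord.
  by rewrite ltW // ltNge; apply/negP/H.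
by rewrite sum leye_eq.
Qed.

Lemma log_scaled_cvg0 : theta k * ln k%:R @[k --> \oo] --> (0 : R) ->
  theta k @[k --> \oo] --> 0.
Proof.
move=> tl; apply: (squeeze_cvgr _ (cvg_cst 0) tl).
near=> k; rewrite (ltW (theta_gt0 k)) /= ler_peMr ?(ltW (theta_gt0 k)) //.
rewrite -[leLHS](@expRK R) ler_ln ?posrE ?expR_gt0 //; last first.
  by near: k; exists 1%N => // k /= k1; rewrite ltr0n.
by near: k; exact: nbhs_infty_ger.
Unshelve. all: by end_near. Qed.

Lemma theta_eta_comparable : exists K, forall k, (K <= k)%N ->
  tau1 / 2 * eta k <= theta k <= (tau1 + 1) * eta k.
Proof.
have t2 : 0 < Num.min (tau1 / 2) 1 by rewrite lt_min divr_gt0 //= ltr01.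
have [K hK] := theta_eta_eventually eta_gt0 ratio_cvg t2; exists K => k /hK.
have e0 := eta_gt0 k.
have m1 : Num.min (tau1 / 2) 1 * eta k <= tau1 / 2 * eta k.
  by rewrite ler_wpM2r ?(ltW e0) // ge_min lexx.
have m2 : Num.min (tau1 / 2) 1 * eta k <= eta k.
  by rewrite ler_piMl ?(ltW e0) // ge_min lexx orbT.
rewrite ler_norml; move: m1 m2; move: (Num.min _ _ * eta k) => c m1 m2 /andP[h1 h2].
by apply/andP; split; lra.
Qed.

Lemma eta_cvg0 : theta k @[k --> \oo] --> 0 -> eta k @[k --> \oo] --> 0.
Proof.
move=> tc; have [K hK] := theta_eta_comparable.
have tc' : 2 / tau1 * theta k @[k --> \oo] --> 0.
  by rewrite -(mulr0 (2 / tau1)); apply: cvgM tc; exact: cvg_cst.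
apply: (squeeze_cvgr _ (cvg_cst 0) tc'); exists K => // k /= /hK/andP[h _].
rewrite (ltW (eta_gt0 k)) /= mulrAC ler_pdivlMr //; lra.
Qed.

Lemma itime_theta_le : exists K, forall k l, (K <= k)%N -> (k <= l)%N ->
  itime theta l - itime theta k <= (tau1 + 1) * (itime eta l - itime eta k).
Proof.
have [K hK] := theta_eta_comparable; exists K => k l Kk kl.
rewrite !window_sum // mulr_sumr big_nat_cond [leRHS]big_nat_cond.
apply: ler_sum => j /andP[/andP[kj _] _].
by have /andP[] := hK j (leq_trans Kk kj).
Qed.

Lemma eta_divergent : (forall y, exists k, y <= itime theta k) ->
  forall y, exists k, y <= itime eta k.
Proof.
move=> th y; have [K hK] := itime_theta_le.
have t1 : 0 < tau1 + 1 by rewrite addr_gt0.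
have [k yk] := th (itime theta K + (tau1 + 1) * `|y|).
exists (maxn k K); have Kk := leq_maxr k K.
have le := hK K _ (leqnn _) Kk.
have : itime theta k <= itime theta (maxn k K).
  by apply: itime_le theta_gt0 _ _ _; exact: leq_maxl.
have := itime_ge0 eta_gt0 K => e0 tk.
have : (tau1 + 1) * `|y| <= (tau1 + 1) * (itime eta (maxn k K) - itime eta K) by lra.
rewrite ler_pM2l // => le'; apply: le_trans (ler_norm y) _; lra.
Qed.

Lemma noise_change_of_time (V : normedZmodType R) (S : nat -> nat -> V) :
  (forall T e, 0 < T -> 0 < e -> exists K, forall k l,
    (K <= k)%N -> (k <= l)%N -> itime theta l - itime theta k <= T ->
    `|S k l| <= e) ->
  forall T e, 0 < T -> 0 < e -> exists K, forall k l,
    (K <= k)%N -> (k <= l)%N -> itime eta l - itime eta k <= T ->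
    `|S k l| <= e.
Proof.
move=> H T e T0 e0; have t1 : 0 < tau1 + 1 by rewrite addr_gt0.
have [K1 h1] := itime_theta_le.
have [|K2 h2] := H ((tau1 + 1) * T) e _ e0; first exact: mulr_gt0.
exists (maxn K1 K2) => k l; rewrite geq_max => /andP[K1k K2k] kl kT.
by apply: h2 => //; apply: le_trans (h1 k l K1k kl) _; rewrite ler_pM2l.
Qed.

End StepSizes.

(** * Perturbed Euler schemes *)

Section PerturbedEuler.
Context {R : realType} {n : nat}.
Variable E : 'rV[R]_n -> set 'rV[R]_n.
Variables (alpha rho : nat -> R) (y a u : nat -> 'rV[R]_n) (C : R).
Hypothesis alpha_gt0 : forall k, 0 < alpha k.
Hypothesis alpha_cvg : alpha k @[k --> \oo] --> 0.
Hypothesis alpha_sum : forall z, exists k, z <= itime alpha k.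
Hypothesis yS : forall k, y k.+1 = y k + alpha k *: (a k + u k).
Hypotheses (bC : forall k, `|a k + u k| <= C) (uC : forall k, `|u k| <= C).
Hypotheses (a_near : forall k, near_field E (rho k) (y k) (a k))
  (rho_cvg : rho k @[k --> \oo] --> 0).
Hypothesis noise : forall T e, 0 < T -> 0 < e -> exists K, forall k l,
  (K <= k)%N -> (k <= l)%N -> itime alpha l - itime alpha k <= T ->
  `|\sum_(k <= j < l) alpha j *: u j| <= e.

Local Notation mu := (@lebesgue_measure R).
Local Notation time := (itime alpha).
Local Notation gamma := (interpolated_process alpha y).
Local Notation index := (iindex alpha).

Let C0 : 0 <= C. Proof. exact: le_trans (uC 0). Qed.

Lemma cell_after K t : time K <= t -> exists k,
  [/\ (K <= k)%N, index t = k & time k <= t < time k.+1].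
Proof.
move=> Kt; have [j jt] := alpha_sum (t + 1).
have tj : t < time j by apply: lt_le_trans jt; rewrite ltrDl.
have [|k [/andP[Kk _] tk]] := @itime_cell _ _ alpha_gt0 K j t; first by rewrite Kt.
by exists k; split => //; exact: iindexE.
Qed.

Let cell t : 0 <= t -> exists k, index t = k /\ time k <= t < time k.+1.
Proof.
by move=> t0; have [|k [_ ? ?]] := @cell_after 0 t; [rewrite itime0|exists k].
Qed.

Lemma interpolated_in_cell k t : time k <= t <= time k.+1 ->
  gamma t = y k + (t - time k) *: (a k + u k).
Proof.
have inc j : y j.+1 - y j = alpha j *: (a j + u j) by rewrite yS addrC addKr.
rewrite [_ <= time k.+1]le_eqVlt => /andP[kt /orP[/eqP ->|tk]].
  rewrite /interpolated_process (@iindexE _ _ alpha_gt0 k.+1); last first.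
    by rewrite lexx itime_lt.
  by rewrite subrr mul0r scale0r addr0 itimeS (addrC (time k)) addrK yS.
rewrite /interpolated_process (@iindexE _ _ alpha_gt0 k) ?kt ?tk //.
by rewrite inc scalerA divfK // gt_eqF.
Qed.

Let in_cell_lipschitz k s t : time k <= s -> s <= t -> t <= time k.+1 ->
  `|gamma t - gamma s| <= C * (t - s).
Proof.
move=> ks st tk; rewrite !(@interpolated_in_cell k); last 2 first.
- by rewrite ks (le_trans st).
- by rewrite (le_trans ks).
have -> : y k + (t - time k) *: (a k + u k) - (y k + (s - time k) *: (a k + u k)) =
    (t - s) *: (a k + u k) by apply/rowP => i; rewrite !mxE; ring.
by rewrite normrZ ger0_norm ?subr_ge0 // mulrC ler_wpM2r // subr_ge0.
Qed.

Let at_node k : gamma (time k) = y k.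
Proof.
rewrite (@interpolated_in_cell k) ?lexx ?(ltW (itime_lt _ _)) //.
by rewrite subrr scale0r addr0.
Qed.

Lemma interpolated_lipschitz s t : 0 <= s -> s <= t ->
  `|gamma t - gamma s| <= C * (t - s).
Proof.
move=> s0 st; have [i [_ /andP[is1 si]]] := cell s0.
have [|j [ij _ /andP[jt tj]]] := @cell_after i t; first exact: le_trans is1 st.
have [ij1|ij1] := eqVneq i j.
  by subst j; apply: (@in_cell_lipschitz i) => //; exact: ltW.
have {ij1}ij : (i.+1 <= j)%N by rewrite ltn_neqAle ij1.
have -> : gamma t - gamma s = (gamma t - gamma (time j)) + (y j - y i.+1) +
    (gamma (time i.+1) - gamma s).
  by rewrite !at_node; apply/rowP => k; rewrite !mxE; ring.
have -> : C * (t - s) = C * (t - time j) + C * (time j - time i.+1) +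
    C * (time i.+1 - s) by ring.
apply: le_trans (ler_normD _ _) (lerD (le_trans (ler_normD _ _) (lerD _ _)) _).
- by apply: (@in_cell_lipschitz j) => //; exact: ltW.
- exact: (window_increment_le alpha_gt0 yS bC ij).
- by apply: (@in_cell_lipschitz i) => //; exact: ltW.
Qed.

Lemma interpolated_derive t : 0 <= t -> ~ range time t ->
  derivable gamma t 1 /\ derive1 gamma t = a (index t) + u (index t).
Proof.
move=> t0 nt; have [k [-> /andP[kt tk]]] := cell t0.
have {}kt : time k < t.
  by rewrite lt_neqAle kt andbT; apply/eqP => kt'; apply: nt; exists k.
apply: first_order_expansion_derive => e e0.
exists (Num.min (t - time k) (time k.+1 - t)).
  by rewrite lt_min !subr_gt0 kt tk.
move=> s; rewrite lt_min => /andP[h1 h2].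
have /andP[s1 s2] : time k <= s <= time k.+1.
  move: h1 h2; rewrite !ltr_norml => /andP[h1 _] /andP[_ h2].
  by apply/andP; split; lra.
rewrite !(@interpolated_in_cell k) ?s1 ?s2 ?(ltW kt) ?(ltW tk) //.
have -> : y k + (s - time k) *: (a k + u k) - (y k + (t - time k) *: (a k + u k)) -
    (s - t) *: (a k + u k) = 0 by apply/rowP => i; rewrite !mxE; ring.
by rewrite normr0 mulr_ge0 // ltW.
Qed.

Let noise_path t : 'rV[R]_n := u (index t).
Let radius t : R := n%:R * (rho (index t) + C * alpha (index t)).

Lemma vintegral_step s t i : 0 <= s -> s <= t ->
  vintegral noise_path s t 0 i =
  \int[mu]_(r in `[0, t]) noise_path r 0 i - \int[mu]_(r in `[0, s]) noise_path r 0 i.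
Proof.
move=> s0 st; have ucB k : `|u k 0 i| <= C by exact: le_trans (coord_le_norm _ _) (uC k).
have int (b0 b1 : bool) (p q : R) : mu.-integrable [set` Interval (BSide b0 p) (BSide b1 q)]
    (EFin \o (fun r => noise_path r 0 i)).
  exact: (step_integrable alpha_gt0 ucB (bounded_itv_measure _ _ _ _)).
rewrite mxE -Rintegral_itv_obnd_cbnd; last exact: int.
by rewrite -[LHS](@Rintegral_itvB _ _ (BLeft 0)) ?bnd_simp //; exact: int.
Qed.

(** The integral is the discrete sum between the cells of the end points, up to
    two incomplete cells. *)
Lemma vintegral_bound s t i j e : 0 <= s -> s <= t ->
  time i <= s < time i.+1 -> time j <= t < time j.+1 -> (i <= j)%N ->
  `|\sum_(i <= k < j) alpha k *: u k| <= e ->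
  `|vintegral noise_path s t| <= e + C * alpha i + C * alpha j.
Proof.
move=> s0 st /andP[is1 si] /andP[jt tj] ij win.
have e0 : 0 <= e by exact: le_trans win.
have Ca k : 0 <= C * alpha k by rewrite mulr_ge0 // ltW.
apply: norm_le_coord => [|r]; first by rewrite !addr_ge0.
have ucB k : `|u k 0 r| <= C by exact: le_trans (coord_le_norm _ _) (uC k).
rewrite vintegral_step //.
rewrite (@step_integral _ _ alpha_gt0 (fun k => u k 0 r) C ucB i s); last first.
  by rewrite is1 ltW.
rewrite (@step_integral _ _ alpha_gt0 (fun k => u k 0 r) C ucB j t); last first.
  by rewrite jt ltW.
rewrite -!(big_mkord xpredT (fun k => alpha k * u k 0 r)) (big_cat_nat _ ij) //=.
set S1 := \sum_(0 <= _ < i) _; set S2 := \sum_(i <= _ < j) _.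
have -> : S1 + S2 + (t - time j) * u j 0 r - (S1 + (s - time i) * u i 0 r) =
    S2 + - ((s - time i) * u i 0 r) + (t - time j) * u j 0 r by ring.
have part k z : time k <= z -> z < time k.+1 -> `|(z - time k) * u k 0 r| <= C * alpha k.
  move=> kz zk; rewrite mulrC; apply: ler_norm_mul => //.
  rewrite ger0_norm ?subr_ge0 //; move: zk; rewrite itimeS; lra.
apply: le_trans (ler_normD _ _) (lerD (le_trans (ler_normD _ _) (lerD _ _)) _).
- apply: le_trans _ win; have := coord_le_norm (\sum_(i <= k < j) alpha k *: u k) r.
  by rewrite summxE; under eq_bigr do rewrite mxE.
- by rewrite normrN; exact: part.
- exact: part.
Qed.

Let index_eventually K : exists t0, forall t, t0 <= t -> (K <= index t)%N /\ 0 <= t.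
Proof.
exists (time K) => t Kt; have [k [Kk -> _]] := cell_after Kt.
by split => //; apply: le_trans Kt; exact: itime_ge0.
Qed.

Lemma index_comp_cvg0 (c : nat -> R) : c k @[k --> \oo] --> 0 ->
  c (index t) @[t --> +oo] --> 0.
Proof.
move=> cc; apply/cvgrPdist_le => e e0.
have /cvgrPdist_le/(_ e e0)[K _ hK] := cc.
have [t0 h0] := index_eventually K.
apply: filterS (nbhs_pinfty_ge (num_real t0)) => t t0t.
by have [/hK] := h0 t t0t.
Qed.

(** On the cell [k] the derivative is [a k + u k]. Removing the perturbation
    leaves [a k], which is close to a value of [E] near [y k], and [gamma] stays
    within a multiple of [alpha k] of [y k]. *)
Lemma interpolated_perturbed_solution : perturbed_solution E gamma.
Proof.
split=> [T T0|].
  by apply: (@lipschitz_abs_continuous _ _ 0 T C) => s t s0 st _; exact: interpolated_lipschitz.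
have cvgCa : C * alpha k @[k --> \oo] --> 0.
  by rewrite -(mulr0 C); apply: cvgM alpha_cvg; exact: cvg_cst.
exists noise_path, radius; split.
- move=> T i T0; have ucB k : `|u k 0 i| <= C by exact: le_trans (coord_le_norm _ _) (uC k).
  exact: (step_integrable alpha_gt0 ucB (bounded_itv_measure _ _ _ _)).
- move=> T T0.
  have small e : 0 < e -> exists t0, forall t, t0 <= t ->
      (0 <= ereal_sup [set (enorm (vintegral noise_path t (t + l)))%:E | l in `[0%R, T]] <= e%:E)%E.
    move=> e0; have e3 : 0 < e / (n%:R + 1) / 3 by rewrite !divr_gt0 // ltr_wpDl.
    have T1 : 0 < T + 1 by rewrite addr_gt0.
    have [K1 h1] := noise T1 e3.
    have [K2 h2] := cvg0_eventually_le cvgCa e3.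
    have [K3 h3] := cvg0_eventually_le alpha_cvg (ltr01 : (0 : R) < 1).
    have [t0 ht0] := index_eventually (maxn K1 (maxn K2 K3)); exists t0 => t t0t.
    have [] := ht0 t t0t; rewrite !geq_max => /and3P[K1t K2t K3t] tge0.
    have [i [it ti]] := cell tge0; rewrite it in K1t K2t K3t.
    apply/andP; split.
      apply: le_trans (ereal_sup_ubound _); last first.
        by exists 0 => //=; rewrite in_itv /= lexx ltW.
      by rewrite lee_fin enorm_ge0.
    apply: ge_ereal_sup => z [l /=]; rewrite in_itv /= => /andP[l0 lT] <-.
    have tl : t <= t + l by rewrite lerDl.
    have [j [jtl tj]] := cell (le_trans tge0 tl).
    have ij : (i <= j)%N.
      have [|k [ik k1 _]] := @cell_after i (t + l); last by rewrite -jtl k1.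
      by case/andP: ti => it' _; exact: le_trans tl.
    have win : `|\sum_(i <= k < j) alpha k *: u k| <= e / (n%:R + 1) / 3.
      apply: h1 => //; have := h3 i K3t; case/andP: ti => _; rewrite itimeS.
      by case/andP: tj => tj _; lra.
    have vb := vintegral_bound tge0 tl ti tj ij win.
    have h2i := h2 i K2t; have h2j := h2 j (leq_trans K2t ij).
    rewrite lee_fin; apply: le_trans (enorm_le_norm _) _.
    apply: (@le_trans _ _ (n%:R * (e / (n%:R + 1)))).
      by rewrite ler_wpM2l //; apply: le_trans vb _; lra.
    by rewrite mulrCA ler_piMr ?(ltW e0) // ler_pdivrMr ?ltr_wpDl // mul1r lerDl.
  apply/fine_cvgP; split.
    have [t0 h0] := small 1 ltr01.
    apply: filterS (nbhs_pinfty_ge (num_real t0)) => t /h0/andP[ge0 le1].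
    by rewrite ge0_fin_numE // (le_lt_trans le1) // ltry.
  apply/cvgrPdist_le => e e0; have [t0 h0] := small e e0.
  apply: filterS (nbhs_pinfty_ge (num_real t0)) => t /h0/andP[ge0 le1].
  rewrite sub0r normrN /= ger0_norm ?fine_ge0 //.
  by rewrite -lee_fin fineK // ge0_fin_numE // (le_lt_trans le1) // ltry.
- apply: (@index_comp_cvg0 (fun k => n%:R * (rho k + C * alpha k))).
  rewrite -(mulr0 n%:R); apply: cvgM; first exact: cvg_cst.
  by rewrite -[X in _ --> X](addr0 0); exact: cvgD.
have null : mu.-negligible (range time).
  have cnt : countable (range time) by exact: card_image_le.
  exists (range time); split => //; last exact: countable_lebesgue_measure0.
  exact: countable_measurable.
apply: negligibleS null => t /= nt; apply: contrapT => tn; apply: nt => t0.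
have [der ->] := interpolated_derive t0 tn; split => //.
rewrite addrK /radius; have [k [-> /andP[kt tk]]] := cell t0.
have [z [w [zy Ezw aw]]] := a_near k.
have gy : `|y k - gamma t| <= C * alpha k.
  rewrite (@interpolated_in_cell k) ?kt ?(ltW tk) // opprD addrA subrr add0r normrN normrZ.
  rewrite ger0_norm ?subr_ge0 // mulrC; apply: ler_pM => //; first by rewrite subr_ge0.
  by move: tk; rewrite itimeS; lra.
have rk : rho k <= rho k + C * alpha k by rewrite lerDl mulr_ge0 // ltW.
exists z.
  apply: le_trans (enorm_le_norm _) _; rewrite ler_wpM2l // -(subrK (y k) z) -addrA.
  exact: le_trans (ler_normD _ _) (lerD zy gy).
apply: (@le_trans _ _ (enorm (a k - w))%:E).
  by apply: ereal_inf_lbound; exists w.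
rewrite lee_fin; apply: le_trans (enorm_le_norm _) _.
by rewrite ler_wpM2l // (le_trans aw).
Qed.

End PerturbedEuler.

(** * Analysis of a single trajectory *)

Section PathAnalysis.
Context {R : realType} {n : nat}.
Variables (sigma eps tau1 tau2 Mx Mxi : R) (f : 'rV[R]_n -> R).
Variables (D : 'rV[R]_n -> set 'rV[R]_n) (W : 'rV[R]_n -> 'rV[R]_n -> 'rV[R]_n).
Variables (eta theta delta : nat -> R) (x m v d xi : nat -> 'rV[R]_n).
Hypotheses (sigma_gt0 : 0 < sigma) (eps_gt0 : 0 < eps) (tau1_gt0 : 0 < tau1)
  (tau2_gt0 : 0 < tau2) (tau21 : tau2 <= 4 * tau1).
Hypotheses (lipf : locally_lipschitz f) (fD : admits_conservative_field f D)
  (convexD : convex_valued D).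
Hypothesis critical_values : [set regularized sigma f z |
  z in [set z | regularized_field sigma D z 0]]° = set0.
Hypothesis W_ge0 : forall a b i, 0 <= W a b 0 i.
Hypothesis W_bounded : forall p : 'rV[R]_n * 'rV[R]_n,
  bounded_near (fun q => W q.1 q.2) (nbhs p).
Hypotheses (eta_gt0 : forall k, 0 < eta k) (theta_gt0 : forall k, 0 < theta k).
Hypothesis theta_cvg : theta k @[k --> \oo] --> 0.
Hypothesis theta_sum : forall y, exists k, y <= itime theta k.
Hypothesis ratio_cvg : theta k / eta k @[k --> \oo] --> tau1.
Hypothesis mS : forall k,
  m k.+1 = (1 - theta k) *: m k + theta k *: (d k + xi k).
Hypothesis xS : forall k, x k.+1 = x k -
  eta k *: hadamard (preconditioner eps (v k.+1)) (m k.+1 + sigma *: x k).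
Hypothesis vS : forall k,
  v k.+1 = v k - (tau2 * eta k) *: (v k - W (d k + xi k) (m k.+1)).
Hypotheses (xB : forall k, `|x k| <= Mx) (xiB : forall k, `|xi k| <= Mxi).
Hypotheses (delta_cvg : delta k @[k --> \oo] --> 0)
  (d_expansion : forall k, expansion D (delta k) (x k) (d k)).
Hypothesis noise : forall T e, 0 < T -> 0 < e -> exists K, forall k l,
  (K <= k)%N -> (k <= l)%N -> itime theta l - itime theta k <= T ->
  `|\sum_(k <= j < l) theta j *: xi j| <= e.

(** A positive vanishing slack turns the Euclidean infimum distance into an
    attained distance for the sup norm. *)
Definition slack k : R := delta k + k.+1%:R^-1.
Local Notation del := slack.

Lemma slack_cvg0 : del k @[k --> \oo] --> 0.
Proof. by rewrite -[X in _ --> X](addr0 0); apply: cvgD delta_cvg _; exact: cvg_harmonic. Qed.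

Lemma subgradient_near k : near_field D (del k) (x k) (d k).
Proof. by apply: expansion_near_field (d_expansion k); rewrite invr_gt0. Qed.

Let closedD : closed [set p : 'rV[R]_n * 'rV[R]_n | D p.1 p.2].
Proof. by case: fD => -[]. Qed.
Let D_neq0 z : D z !=set0. Proof. by case: fD => -[]. Qed.
Let compactD z : compact (D z). Proof. by case: fD => -[]. Qed.
Let boundedD z : bounded_around D z.
Proof. exact: (conservative_bounded_around closedD D_neq0 compactD convexD fD.2 lipf z). Qed.

Lemma subgradient_bounded : exists C, forall k, `|d k| <= C.
Proof.
have [K1 h1] := cvg0_eventually_le slack_cvg0 (ltr01 : (0 : R) < 1).
have [C hC] := bounded_on_balls boundedD (Mx + 1).
apply: eventually_bounded; exists (C + 1), K1 => k /h1 del1.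
have [z [a [zx Dza da]]] := subgradient_near k.
have az : `|a| <= C.
  apply: hC Dza; rewrite -(subrK (x k) z) addrC; apply: le_trans (ler_normD _ _) _.
  by apply: lerD => //; exact: le_trans zx del1.
rewrite -(subrK a (d k)) addrC; apply: le_trans (ler_normD _ _) _.
by apply: lerD => //; exact: le_trans da del1.
Qed.

Lemma momentum_bounded : exists C, forall k, `|m k| <= C.
Proof.
have [C hC] := subgradient_bounded.
apply: (averaged_bounded (C := C + Mxi) _ theta_cvg mS) => k; first exact: ltW.
by apply: le_trans (ler_normD _ _) _; apply: lerD.
Qed.

Lemma second_moment_input_bounded : exists C, forall k,
  `|W (d k + xi k) (m k.+1)| <= C.
Proof.
have [Cd hd] := subgradient_bounded; have [Cm hm] := momentum_bounded.
have [p|C hC] := @locally_bounded_on_balls R n _ W _ (Cd + Mxi + Cm).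
  have [C [_ hC]] := W_bounded p; exists (C + 1); apply: hC; by rewrite ltrDl.
have C0 u c : `|u : 'rV[R]_n| <= c -> 0 <= c by exact: le_trans.
exists C => k; apply: hC.
  apply: le_trans (ler_normD _ _) _; apply: le_trans (lerD (hd k) (xiB k)) _.
  by rewrite lerDl; exact: C0 (hm 0).
apply: le_trans (hm k.+1) _; rewrite lerDr addr_ge0 //.
  exact: C0 (hd 0).
exact: C0 (xiB 0).
Qed.

Let eta_cvg : eta k @[k --> \oo] --> 0.
Proof. exact: eta_cvg0 ratio_cvg theta_cvg. Qed.

Lemma second_moment_bounded : exists C, forall k, `|v k| <= C.
Proof.
have [C hC] := second_moment_input_bounded.
apply: (@averaged_bounded _ _ (fun k => tau2 * eta k) v _ C _ _ _ hC).
- by move=> k; rewrite mulr_ge0 // ltW.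
- by rewrite -(mulr0 tau2); apply: cvgM eta_cvg; exact: cvg_cst.
- by move=> k; rewrite vS; apply/rowP => i; rewrite !mxE; ring.
Qed.

(** The Lyapunov function decreases along windows and cannot upcross noncritical
    values, so the velocity vanishes, and the momentum then balances
    [sigma x]. *)
Theorem momentum_tracks_position r : 0 < r -> exists K, forall k, (K <= k)%N ->
  `|m k + sigma *: x k| <= r.
Proof.
move=> r0.
have [Cd hd] := subgradient_bounded; have [Cm hm] := momentum_bounded.
have [Cw hw] := second_moment_input_bounded.
have [Cv hv] := second_moment_bounded.
pose B := `|Mx| + `|Mxi| + `|Cd| + `|Cm| + `|Cw| + `|Cv|.
have n0 y : 0 <= `|y : R| by [].
have B0 : 0 <= B by rewrite !addr_ge0.
have le_B (c : R) : `|c| <= B -> forall u : 'rV[R]_n, `|u| <= c -> `|u| <= B.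
  by move=> cB u uc; exact: le_trans uc (le_trans (ler_norm c) cB).
have bnd : [/\ `|Mx| <= B, `|Mxi| <= B, `|Cd| <= B & [/\ `|Cm| <= B, `|Cw| <= B & `|Cv| <= B]].
  have := n0 Mx; have := n0 Mxi; have := n0 Cd; have := n0 Cm; have := n0 Cw.
  by have := n0 Cv; rewrite /B; split; [..|split]; lra.
case: bnd => bx bxi bd [bm bw bv].
have xB' k := le_B _ bx _ (xB k); have xiB' k := le_B _ bxi _ (xiB k).
have dB' k := le_B _ bd _ (hd k); have mB' k := le_B _ bm _ (hm k).
have wB' k := le_B _ bw _ (hw k); have vB' k := le_B _ bv _ (hv k).
have noise_eta T e : 0 < T -> 0 < e -> exists K, forall k l,
    (K <= k)%N -> (k <= l)%N -> itime eta l - itime eta k <= T ->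
    `|\sum_(k <= j < l) theta j *: xi j| <= e.
  move=> T0 e0; exact: (noise_change_of_time eta_gt0 tau1_gt0 ratio_cvg noise T0 e0).
pose q := velocity sigma eps x m v.
pose Bq := (eps^-1 + 1) * ((1 + sigma) * B).
have qB k : `|q k| <= Bq by exact: velocity_bound.
have Bq0 : 0 <= Bq by exact: le_trans (qB 0).
have B_le : B <= B + Bq by rewrite lerDl.
have Bq_le : Bq <= B + Bq by rewrite lerDr.
have q_slow := velocity_slow sigma_gt0 eps_gt0 tau1_gt0 tau2_gt0 eta_gt0 theta_gt0
  eta_cvg ratio_cvg mS xS vS xB' mB' dB' wB' vB' noise_eta.
have xq := step_velocity xS.
have contf := locally_lipschitz_continuous lipf.
have [etab [etab_cvg etabP]] := cvg0_tail_bound eta_cvg.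
have [delb [delb_cvg delbP]] := cvg0_tail_bound slack_cvg0.
have chain T e (T0 : 0 < T) (e0 : 0 < e) :=
  window_chain_rule closedD D_neq0 compactD boundedD contf fD.2 eta_gt0 xq
    (fun k => le_trans (xB' k) B_le) (fun k => le_trans (qB k) Bq_le)
    (fun k => le_trans (dB' k) B_le) q_slow subgradient_near etabP etab_cvg
    delbP delb_cvg T0 e0.
have L_window := lyapunov_window sigma_gt0 eps_gt0 tau1_gt0 tau2_gt0 tau21 eta_gt0
  theta_gt0 eta_cvg ratio_cvg mS xS vS (fun k i => W_ge0 _ _ i) xB' mB' dB' xiB'
  wB' vB' noise_eta chain.
pose L := lyapunov sigma eps tau1 x m v f.
pose g z := f z + sigma / 2 * dotp z z.
have gE : regularized sigma f = g by apply/funext => z; rewrite regularized_dotp.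
have contg : continuous g by exact: regularized_continuous.
pose CE := (2 * tau1)^-1 * (n%:R * ((eps^-1 + 1) * ((1 + sigma) * B))).
have L_g k : `|L k - g (x k)| <= CE * `|m k + sigma *: x k|.
  exact: lyapunov_objective.
have CE0 : 0 <= CE.
  apply: mulr_ge0; last exact: mulr_ge0.
  by rewrite invr_ge0 mulr_ge0 // ltW.
have mv := momentum_velocity_bound sigma eps_gt0 tau1_gt0 eta_gt0 theta_gt0 eta_cvg
  ratio_cvg mS xB' mB' dB' xiB' vB'.
have G0 : 0 < B + eps + 1 by rewrite addr_gt0 // ltr_wpDl.
have L_bounded : exists M, forall k, `|L k| <= M.
  have [Cg hg] := continuous_bounded_on_balls contg B.
  exists (CE * (B + sigma * B) + Cg) => k.
  rewrite -(subrK (g (x k)) (L k)); apply: le_trans (ler_normD _ _) _.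
  apply: lerD; last exact: hg.
  apply: le_trans (L_g k) _; rewrite ler_wpM2l //.
  apply: le_trans (ler_normD _ _) _; apply: lerD => //.
  rewrite normrZ gtr0_norm //; apply: ler_wpM2l => //; exact: ltW.
have eta_sum := eta_divergent eta_gt0 theta_gt0 tau1_gt0 ratio_cvg theta_sum.
have c0 : 0 < sigma / tau1 by rewrite divr_gt0.
have crit : [set g z | z in [set z | regularized_field sigma D z 0]]° = set0.
  by rewrite -gE.
have comparable := theta_eta_comparable eta_gt0 tau1_gt0 ratio_cvg.
have qcvg := velocity_cvg0 closedD D_neq0 compactD convexD boundedD sigma_gt0 tau1_gt0
  c0 (ltW G0) CE0 eta_gt0 eta_cvg eta_sum comparable xq xB' mB' q_slow mv
  (momentum_window_noise mS noise_eta) L_window L_g L_bounded contg subgradient_near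
  slack_cvg0 crit.
have r2 : 0 < r / 2 by rewrite divr_gt0.
have [K1 h1] := mv _ r2; have [|K2 h2] := qcvg (r / 2 / (B + eps + 1)).
  by rewrite divr_gt0.
exists (maxn K1 K2) => k; rewrite geq_max => /andP[K1k K2k].
apply: le_trans (h1 k K1k) _; have /ltW := h2 k K2k.
rewrite ler_pdivlMr // mulrC; lra.
Qed.

Lemma momentum_misfit_cvg0 : `|m k + sigma *: x k| @[k --> \oo] --> 0.
Proof.
apply/cvgrPdist_le => e e0; have [K hK] := momentum_tracks_position e0.
by exists K => // k /= /hK; rewrite sub0r normrN normr_id.
Qed.

(** The elements [d] approach values of the field near [x], and the distance
    from [x] to [- m / sigma], which is [|m + sigma x| / sigma], vanishes. *)
Theorem momentum_perturbed_solution :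
  perturbed_solution (opp_field (regularized_field sigma D))
    (interpolated_process (fun k => theta k / sigma)
       (fun k => - (sigma^-1 *: m k))).
Proof.
have s0 : sigma != 0 by rewrite gt_eqF.
have [Cd hd] := subgradient_bounded; have [Cm hm] := momentum_bounded.
pose misfit k := `|m k + sigma *: x k|.
pose rho k := (1 + sigma) * del k + (1 + sigma^-1) * misfit k.
have xi0 : 0 <= Mxi by exact: le_trans (xiB 0).
have itimeE k : itime (fun k => theta k / sigma) k = itime theta k / sigma.
  by rewrite /itime mulr_suml.
apply: (@interpolated_perturbed_solution _ _ _ _ rho _ (fun k => m k - d k)
  (fun k => - xi k) (Cm + Cd + Mxi)).
- by move=> k; rewrite divr_gt0.
- by rewrite -(mul0r sigma^-1); apply: cvgM theta_cvg _; exact: cvg_cst.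
- move=> z; have [k zk] := theta_sum (z * sigma); exists k.
  by rewrite itimeE ler_pdivlMr.
- by move=> k; rewrite mS; apply/rowP => i; rewrite !mxE; field.
- move=> k; apply: le_trans (ler_normD _ _) (lerD _ _); last by rewrite normrN.
  exact: le_trans (ler_normB _ _) (lerD (hm k) (hd k)).
- move=> k; rewrite normrN (le_trans (xiB k)) // lerDr addr_ge0 //.
    exact: le_trans (hm 0).
  exact: le_trans (hd 0).
- move=> k; have [z [w [zx Dzw dw]]] := subgradient_near k.
  have si : 0 < sigma^-1 by rewrite invr_gt0.
  have del0 : 0 <= del k by exact: le_trans zx.
  have mis0 : 0 <= misfit k by exact: normr_ge0.
  exists z, (- (w + sigma *: z)); split.
  + have -> : z - - (sigma^-1 *: m k) = (z - x k) + sigma^-1 *: (m k + sigma *: x k).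
      by apply/rowP => i; rewrite !mxE; field.
    apply: le_trans (ler_normD _ _) _; rewrite normrZ gtr0_norm // -/(misfit k).
    apply: lerD; first by apply: le_trans zx _; rewrite mulrDl mul1r lerDl mulr_ge0 // ltW.
    by rewrite mulrDl mul1r lerDr.
  + by exists (w + sigma *: z) => //; exists w.
  + have -> : m k - d k - - (w + sigma *: z) =
        (m k + sigma *: x k) - (d k - w) + sigma *: (z - x k).
      by apply/rowP => i; rewrite !mxE; ring.
    apply: le_trans (ler_normD _ _) _.
    have -> : rho k = misfit k + del k + sigma * del k + sigma^-1 * misfit k.
      by rewrite /rho; ring.
    rewrite ler_wpDr ?mulr_ge0 ?(ltW si) //; apply: lerD.
      exact: le_trans (ler_normB _ _) (lerD _ dw).
    by rewrite normrZ gtr0_norm // ler_wpM2l // ltW.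
- rewrite -[X in _ --> X](addr0 0); apply: cvgD.
    by rewrite -(mulr0 (1 + sigma)); apply: cvgM slack_cvg0; exact: cvg_cst.
  by rewrite -(mulr0 (1 + sigma^-1)); apply: cvgM momentum_misfit_cvg0; exact: cvg_cst.
move=> T e T0 e0; have [|| K hK] := noise (T := T * sigma) (e := e * sigma).
- exact: mulr_gt0.
- exact: mulr_gt0.
exists K => k l Kk kl; rewrite !itimeE -mulrBl ler_pdivrMr // => kT.
have -> : \sum_(k <= j < l) (theta j / sigma) *: - xi j =
    - (sigma^-1 *: \sum_(k <= j < l) theta j *: xi j).
  rewrite scaler_sumr -sumrN; apply: eq_bigr => j _.
  by rewrite scalerN scalerA mulrC.
by rewrite normrN normrZ gtr0_norm ?invr_gt0 // mulrC ler_pdivrMr // hK.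
Qed.

End PathAnalysis.

(** * Almost sure conclusion *)

Section AlmostSureNoise.
Context {disp : measure_display} {Omega : measurableType disp} {R : realType}.
Variables (P : probability Omega R) (F : nat -> set (set Omega)).
Hypothesis hF : filtration F.

Definition clamp (M r : R) : R := Num.max (- M) (Num.min r M).

Lemma clamp_id M r : `|r| <= M -> clamp M r = r.
Proof.
by rewrite ler_norml => /andP[h1 h2]; rewrite /clamp min_l // max_r.
Qed.

Lemma clamp_bound M r : 0 <= M -> `|clamp M r| <= M.
Proof.
move=> M0; rewrite ler_norml /clamp le_max lexx /= ge_max ge_min lexx orbT andbT.
by rewrite (le_trans _ M0) // oppr_le0.
Qed.

Lemma measurable_clamp M : measurable_fun setT (clamp M).
Proof.
by apply: measurable_maxr; [|apply: measurable_minr].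
Qed.

(** The exponential estimate requires a noise bounded at every sample point;
    clamping at the almost sure bound provides one without changing the noise
    outside a null set, so its conditional expectations still vanish. *)
Lemma martingale_noise_windows n (xi : nat -> Omega -> 'rV[R]_n) (theta : nat -> R) :
  bounded_martingale_difference P F xi ->
  (forall k, 0 < theta k) ->
  theta k * ln k%:R @[k --> \oo] --> (0 : R) ->
  (forall z, exists k, z <= itime theta k) ->
  {ae P, forall w, forall T e, 0 < T -> 0 < e -> exists K, forall k l,
    (K <= k)%N -> (k <= l)%N -> itime theta l - itime theta k <= T ->
    `|\sum_(k <= j < l) theta j *: xi j.+1 w| <= e}.
Proof.
move=> [xiF xiE [M xiM]] theta_gt0 theta_log theta_sum.
have [sigmaF measF _] := hF.
have theta_cvg := log_scaled_cvg0 theta_gt0 theta_log.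
pose Z i k w := clamp `|M| (xi k w 0 i).
have ZF i k : sub_measurable (F k) (Z i k).
  by apply: sub_measurable_comp => //; exact: measurable_clamp.
have xiZ : {ae P, forall w, forall i k, Z i k w = xi k w 0 i}.
  apply: filterS xiM => w wM i k; apply: clamp_id.
  apply: le_trans (coord_le_norm _ _) (le_trans (norm_le_enorm _) _).
  exact: le_trans (wM k) (ler_norm _).
have Zorth i k A : F k A -> \int[P]_(w in A) Z i k.+1 w = 0.
  move=> FA; have [_ _ _ /(_ A FA)] := xiE k i; rewrite integral0 => xi0.
  rewrite /Rintegral (@ae_eq_integral _ _ _ _ _ (fun w => (xi k.+1 w 0 i)%:E)) //.
  - by rewrite -xi0.
  - exact: measF FA.
  - apply/measurable_EFinP; apply: measurable_funTS.
    exact: (sub_measurable_measurable (measF _) (ZF i k.+1)).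
  - apply/measurable_EFinP; apply: measurable_funTS.
    exact: (sub_measurable_measurable (measF _) (xiF k.+1 i)).
  by apply: filterS xiZ => w wZ _; rewrite wZ.
have windows : {ae P, forall w, forall i, forall T e, 0 < T -> 0 < e ->
    exists K, forall k l, (K <= k)%N -> (k <= l)%N ->
    itime theta l - itime theta k <= T -> `|noise_sum (Z i) theta k l w| <= e}.
  apply: filter_forall => i.
  apply: (noise_windows_vanish hF (normr_ge0 M) (ZF i) _ (Zorth i)) => // k w.
  exact: clamp_bound.
apply: filterS2 xiZ windows => w wZ win T e T0 e0.
have /choice[K hK] i := win i T e T0 e0.
exists (\max_i K i)%N => k l Kk kl kT; apply: norm_le_coord => [|i]; first exact: ltW.
have := hK i k l (leq_trans (leq_bigmax i) Kk) kl kT; rewrite /noise_sum.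
congr (`|_| <= _); rewrite summxE; apply: eq_bigr => j _.
by rewrite mxE wZ.
Qed.

End AlmostSureNoise.

Theorem corollary4p9 (R : realType) (n : nat)
  (disp : measure_display) (Omega : measurableType disp)
  (P : probability Omega R) (F : nat -> set (set Omega))
  (hF : filtration F)
  (sigma : R) (hsigma : 0 < sigma)
  (f : 'rV[R]_n -> R) (hf : locally_lipschitz f)
  (Df : 'rV[R]_n -> set 'rV[R]_n)
  (hA1_pd : path_differentiable f)
  (hA1 : admits_conservative_field f Df)
  (hA1_conv : convex_valued Df)
  (hA2 : [set regularized sigma f x |
             x in [set x | regularized_field sigma Df x 0]]° = set0)
  (hA3 : (-oo < ereal_inf [set (regularized sigma f x)%:E | x in setT])%E)
  (x m v d xi g : nat -> Omega -> 'rV[R]_n)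
  (hrv : forall k, [/\ random_vector (x k), random_vector (m k),
                       random_vector (v k) & random_vector (d k)])
  (eta theta : nat -> R) (eps : R) (hC3 : 0 < eps)
  (hAFMDW : AFMDW sigma eta theta (preconditioner eps) x m v d xi g)
  (hC1 : exists Mx, {ae P, forall w,
           enorm (m 0%N w) <= Mx /\ forall k, enorm (x k w) <= Mx})
  (W : 'rV[R]_n -> 'rV[R]_n -> 'rV[R]_n)
  (hC2_W0 : forall a b i, 0 <= W a b 0 i)
  (hC2_Wb : forall p : 'rV[R]_n * 'rV[R]_n,
           bounded_near (fun q => W q.1 q.2) (nbhs p))
  (tau2 : R) (htau2 : 0 < tau2)
  (hC2 : forall k w, v k.+1 w =
           v k w - (tau2 * eta k) *: (v k w - W (g k w) (m k.+1 w)))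
  (hC4_eta : forall k, 0 < eta k) (hC4_theta : forall k, 0 < theta k)
  (hC4_sum : (\sum_(0 <= k <oo) (theta k)%:E = +oo)%E)
  (hC4_log : theta k * ln k%:R @[k --> \oo] --> (0 : R))
  (tau1 : R) (hC4_tau1 : tau2 / 4 <= tau1) (htau1 : 0 < tau1)
  (hC4_ratio : theta k / eta k @[k --> \oo] --> tau1)
  (hC5 : exists delta : nat -> R,
     [/\ forall k, 0 <= delta k, delta k @[k --> \oo] --> (0 : R) &
         {ae P, forall w, forall k, expansion Df (delta k) (x k w) (d k w)}])
  (hC6 : bounded_martingale_difference P F xi) :
  {ae P, forall w,
    perturbed_solution (opp_field (regularized_field sigma Df))
      (interpolated_process (fun k => theta k / sigma)
         (fun k => - (sigma^-1 *: m k w)))}.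
Proof.
have theta_sum := divergent_itime hC4_theta hC4_sum.
have noise := martingale_noise_windows hF hC6 hC4_theta hC4_log theta_sum.
case: hC1 hC5 (hC6) => Mx hM [delta [_ delta_cvg hd]] [_ _ [Mxi hxi]].
apply: filterS2 (filterI hM hd) (filterI hxi noise) => w [[_ xM] dw] [xiM wnoise].
have enormW (u : 'rV[R]_n) c : enorm u <= c -> `|u| <= c.
  exact: le_trans (norm_le_enorm _).
apply: (@momentum_perturbed_solution _ _ sigma eps tau1 tau2 Mx Mxi f Df W eta theta
  delta (x^~ w) (m^~ w) (v^~ w) (d^~ w) (fun k => xi k.+1 w)) => //.
- by move: hC4_tau1; lra.
- exact: log_scaled_cvg0.
- by move=> k; have [gE -> _] := hAFMDW k w; rewrite gE.
- by move=> k; have [_ _ ->] := hAFMDW k w.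
- by move=> k; have [<- _ _] := hAFMDW k w.
- by move=> k; exact: enormW.
- by move=> k; exact: enormW.
Qed.
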